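(* Let $a,b>(p-1)/2$, and let $\mathcal{X}$, $L(W)=\mathrm{diag}(l_1(W),\ldots,l_p(W))$, $P(\cdot)$, $g(W)$, $z(W)$ and $\mathcal{Z}$ be as in the context. Suppose that the distribution of $W=(W_1,W_2)\in\mathcal{X}$ is \[ t(g(W))(\det W_1)^{a-\frac{p+1}{2}}(\det W_2)^{b-\frac{p+1}{2}}dW_1dW_2, \] where $t:GL(p)\to\mathbb{R}$ is a real-valued function such that $t(B)$, $B\in GL(p)$, does not depend on the sign of each column of $B$. Then $G=g(W)$ and $Z=z(W)$ are independent, and their joint distribution is given by \[ \frac{1}{c_0}\,t(G)\,|\det G|^{2(a+b)-p}\,dG\times\nu_{\mathcal{Z}}(dZ), \] where $c_0=\int_{GL(p)/2^p}t(G)|\det G|^{2(a+b)-p}dG=2^{-p}\int_{GL(p)}t(G)|\det G|^{2(a+b)-p}dG$ and $\nu_{\mathcal{Z}}$ is a probability measure on $\mathcal{Z}$. Furthermore, $(l_1,\ldots,l_p)=(l_1(W),\ldots,l_p(W))$ is independent of $G=g(W)$, and its distribution is given by \[ 2^pc_0\,|\det P(\mathrm{diag}(l_1,\ldots,l_p))|^{2(a+b)}\prod_{i=1}^p l_i^{a-\frac{p+1}{2}}\prod_{i=1}^p(1-l_i)^{b-\frac{p+1}{2}}\prod_{i<j}(l_i-l_j)\,dl_1\cdots dl_p. \]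
   Context: $PD(p)$ is the set of $p\times p$ (real symmetric) positive definite matrices; $GL(p)$ is the group of real nonsingular $p\times p$ matrices; $GL(p)/2^p$ denotes the set of $p\times p$ nonsingular matrices whose first nonzero element in each column is positive; $dG$ is Lebesgue measure on the entries; ${}^t$ denotes transpose; $dW_k=\prod_{1\le i\le j\le p}dw_{k,ij}$, $k=1,2$. The sample space is $\mathcal{X}=\{(W_1,W_2)\in PD(p)\times PD(p):$ the $p$ roots of $\det(W_1-l(W_1+W_2))=0$ are all distinct$\}$. Each $W=(W_1,W_2)\in\mathcal{X}$ can be written as $W_1=BLB^t$, $W_2=B(I_p-L)B^t$ with $B=B(W)\in GL(p)$ and $L=L(W)=\mathrm{diag}(l_1,\ldots,l_p)$, $1>l_1>\cdots>l_p>0$; $L(W)$ is uniquely determined and $B(W)$ is unique up to the sign of each column. Let $\mathcal{N}'$ be the set of $P\in GL(p)$ having exactly one nonzero element in each row and in each column, and let $L\mapsto P(L)\in\mathcal{N}'$ be a given (measurable) function on $\{L=\mathrm{diag}(l_1,\ldots,l_p): 1>l_1>\cdots>l_p>0\}$. Put $z_L=(P(L)LP(L)^t,\ P(L)(I_p-L)P(L)^t)$, $\mathcal{Z}=\{z_L: L=\mathrm{diag}(l_1,\ldots,l_p),\ 1>l_1>\cdots>l_p>0\}$ and $z(W)=z_{L(W)}$. The matrix $g(W)\in GL(p)/2^p$ is obtained from $B(W)P(L(W))^{-1}$ by changing the sign of each column if necessary so that it lies in $GL(p)/2^p$; accordingly the distribution of $G$ is on $GL(p)/2^p$. *)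

(* Defs.v *)
From HB Require Import structures.
From mathcomp Require Import all_boot all_order all_algebra.
From mathcomp Require Import all_classical all_reals all_analysis.

Set Implicit Arguments.
Unset Strict Implicit.
Unset Printing Implicit Defensive.
Import Order.TTheory GRing.Theory Num.Theory.
Import numFieldNormedType.Exports.
Local Open Scope classical_set_scope.
Local Open Scope ring_scope.

(* Matrices carry the sigma-algebra generated by the entries, i.e. the Borel
   sigma-algebra when the entries are real. *)
Definition measure_matrix_display : measure_display -> measure_display.
Proof. exact. Qed.

Section measurable_matrix.
Context d (T : measurableType d) (m n : nat).

Definition mx_coor (k : 'I_(m * n)) (A : 'M[T]_(m, n)) : T := mxvec A ord0 k.

Let mx_set0 : g_sigma_preimage mx_coor set0.
Proof. exact: sigma_algebra0. Qed.

Let mx_setC A : g_sigma_preimage mx_coor A -> g_sigma_preimage mx_coor (~` A).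
Proof. exact: sigma_algebraC. Qed.

Let mx_bigcup (F : (set 'M[T]_(m, n))^nat) :
  (forall i, g_sigma_preimage mx_coor (F i)) ->
  g_sigma_preimage mx_coor (\bigcup_i (F i)).
Proof. exact: sigma_algebra_bigcup. Qed.

HB.instance Definition _ := @isMeasurable.Build (measure_matrix_display d)
  'M[T]_(m, n) (g_sigma_preimage mx_coor) mx_set0 mx_setC mx_bigcup.
End measurable_matrix.

Section measurable_matrix_theory.
Context d (T : measurableType d) (m n : nat).

Lemma measurable_mxE (i : 'I_m) (j : 'I_n) :
  measurable_fun [set: 'M[T]_(m, n)] (fun A => A i j).
Proof.
move=> _ Y mY; rewrite setTI; apply: sub_sigma_algebra => /=.
rewrite -bigcup_seq/=; exists (mxvec_index i j) => /=.
  by rewrite mem_index_enum.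
exists Y => //; rewrite setTI; apply/seteqP.
by split=> A /=; rewrite /mx_coor mxvecE.
Qed.

Lemma measurable_fun_mxP d1 (T1 : measurableType d1) (f : T1 -> 'M[T]_(m, n)) :
  (forall i j, measurable_fun setT (fun x => f x i j)) ->
  measurable_fun setT f.
Proof.
move=> mf.
suff H : <<s \big[setU/set0]_(i < m * n) preimage_set_system setT
    (@mx_coor d T m n i) measurable >> `<=` [set Y | measurable (f @^-1` Y)].
  by move=> _ Y mY; rewrite setTI; exact: H.
apply: smallest_sub.
  split=> /=.
  - by rewrite preimage_set0.
  - by move=> A mA; rewrite setTD preimage_setC; exact: measurableC.
  - by move=> F mF; rewrite preimage_bigcup; exact: bigcupT_measurable.
rewrite -bigcup_seq => Y [k _ [A mA <-]]/=.
case/mxvec_indexP: k => i j.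
rewrite (_ : _ @^-1` _ = setT `&` (fun x => f x i j) @^-1` A).
  exact: mf.
by apply/seteqP; split=> x; rewrite /mx_coor /= mxvecE.
Qed.
End measurable_matrix_theory.

Section sigma_finite_theory.
Context (R : realType).

Lemma sigma_finite_bundle d (T : measurableType d)
    (mu : {measure set T -> \bar R}) : sigma_finite setT mu ->
  exists nu : {sigma_finite_measure set T -> \bar R}, mu = nu :> (set T -> \bar R).
Proof.
move=> smu.
pose H1 := isSFinite.Build _ _ _ (mu : set T -> \bar R)
  (sfinite_measure_sigma_finite smu).
pose H2 := isSigmaFinite.Build _ _ _ (mu : set T -> \bar R) smu.
pose nu : {sigma_finite_measure set T -> \bar R} :=
  HB.pack (mu : set T -> \bar R) (Measure.class mu) H1 H2.
by exists nu.
Qed.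

Context d1 d2 (T1 : measurableType d1) (T2 : measurableType d2).

Lemma product_sigma_finite (m1 : {sigma_finite_measure set T1 -> \bar R})
    (m2 : {sigma_finite_measure set T2 -> \bar R}) :
  sigma_finite setT (m1 \x m2)%E.
Proof.
have /sigma_finiteP[F [TF ndF Foo]] := sigma_finiteT m1.
have /sigma_finiteP[G [TG ndG Goo]] := sigma_finiteT m2.
exists (fun n => F n `*` G n).
 rewrite -setXTT TF TG predeqE => -[x y]; split.
    move=> [/= [n _ Fnx] [k _ Gky]]; exists (maxn n k) => //; split.
    - by move: x Fnx; exact/subsetPset/ndF/leq_maxl.
    - by move: y Gky; exact/subsetPset/ndG/leq_maxr.
  by move=> [n _ []/= ? ?]; split; exists n.
move=> k; have [? ?] := Foo k; have [? ?] := Goo k.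
split; first exact: measurableX.
by rewrite product_measure1E// lte_mul_pinfty// ge0_fin_numE.
Qed.

Lemma pushforward_bundle (mu : {sigma_finite_measure set T1 -> \bar R})
    (f : T1 -> T2) (g : T2 -> T1) :
  measurable_fun setT f -> measurable_fun setT g -> cancel f g ->
  exists nu : {sigma_finite_measure set T2 -> \bar R},
    pushforward mu f = nu.
Proof.
move=> mf mg fK.
pose m : {measure set T2 -> \bar R} :=
  measure_function_pushforward__canonical__measure_function_Measure mu mf.
suff /sigma_finite_bundle[nu nuE] : sigma_finite setT m by exists nu.
have [F FT Ffin] := sigma_finiteT mu.
exists (fun k => g @^-1` F k).
  by rewrite -preimage_bigcup -FT preimage_setT.
move=> k; have [mF Foo] := Ffin k; split.
  by rewrite -[X in measurable X]setTI; exact: mg.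
rewrite /m/= /pushforward (_ : _ @^-1` _ = F k)//.
by apply/seteqP; split=> x /=; rewrite fK.
Qed.

End sigma_finite_theory.

(* Lebesgue measure on R^n as the n-fold product of Lebesgue measure on R. *)
Section lebesgue_tuple.
Variable R : realType.

Definition cons_tuple n (x : measurableTypeR R * n.-tuple R) : n.+1.-tuple R :=
  [tuple of (x.1 : R) :: x.2].

Fixpoint lebesgue_tuple (n : nat) : set (n.-tuple R) -> \bar R :=
  match n with
  | 0 => \d_([tuple] : 0.-tuple R)
  | n'.+1 => pushforward (lebesgue_measure \x @lebesgue_tuple n')%E
               (@cons_tuple n')
  end.
Arguments lebesgue_tuple : clear implicits.

Lemma measurable_cons_tuple n : measurable_fun setT (@cons_tuple n).
Proof. exact: measurable_cons. Qed.

Lemma lebesgue_tuple_bundle n :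
  exists mu : {sigma_finite_measure set (n.-tuple R) -> \bar R},
    lebesgue_tuple n = mu.
Proof.
elim: n => [|n [mu /= ->]]; first by exists (\d_([tuple] : 0.-tuple R)).
have [nu ->] := sigma_finite_bundle (product_sigma_finite lebesgue_measure mu).
pose g (x : n.+1.-tuple R) : measurableTypeR R * n.-tuple R :=
  (thead x, [tuple of behead x]).
apply: (@pushforward_bundle _ _ _ _ _ _ _ g).
- exact: measurable_cons_tuple.
- apply/measurable_fun_pair; [exact: measurable_tnth|exact: measurable_behead].
- by case=> x v; rewrite /g/= theadE; congr pair; apply/val_inj.
Qed.

End lebesgue_tuple.
Arguments lebesgue_tuple : clear implicits.

Section lebesgue_matrix.
Variable R : realType.

Definition mx_of_tuple m n (v : (m * n).-tuple R) : 'M[R]_(m, n) :=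
  \matrix_(i, j) tnth v (mxvec_index i j).

(* [\prod_(i, j) d a_ij] on the space of all m x n matrices *)
Definition lebesgue_mx m n : set 'M[R]_(m, n) -> \bar R :=
  pushforward (lebesgue_tuple R (m * n)) (@mx_of_tuple m n).

Definition upper_pairs p : seq ('I_p * 'I_p) :=
  enum [pred ij : 'I_p * 'I_p | (ij.1 <= ij.2)%N].

Definition sym_of_tuple p (v : (size (upper_pairs p)).-tuple R) : 'M[R]_p :=
  \matrix_(i, j)
    nth 0 v (index (if (i <= j)%N then (i, j) else (j, i)) (upper_pairs p)).

(* [\prod_(i <= j) d w_ij], carried by the symmetric matrices *)
Definition lebesgue_sym p : set 'M[R]_p -> \bar R :=
  pushforward (lebesgue_tuple R (size (upper_pairs p))) (@sym_of_tuple p).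

Lemma upper_pairs_uniq p : uniq (upper_pairs p).
Proof. exact: enum_uniq. Qed.

Lemma lebesgue_mx_bundle m n :
  exists mu : {sigma_finite_measure set 'M[R]_(m, n) -> \bar R},
    @lebesgue_mx m n = mu.
Proof.
rewrite /lebesgue_mx; have [mu ->] := lebesgue_tuple_bundle R (m * n).
pose g (A : 'M[R]_(m, n)) : (m * n).-tuple R := [tuple mxvec A 0 k | k < m * n].
apply: (@pushforward_bundle _ _ _ _ _ _ _ g).
- apply: measurable_fun_mxP => i j.
  under eq_fun do rewrite mxE; exact: measurable_tnth.
- apply/measurable_fun_tnthP => k; case/mxvec_indexP: k => i j.
  have -> : (@tnth _ _)^~ (mxvec_index i j) \o g = fun A => A i j.
    by apply/funext => A /=; rewrite tnth_mktuple mxvecE.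
  exact: measurable_mxE.
- move=> v; apply/eq_from_tnth => k; rewrite tnth_mktuple.
  by case/mxvec_indexP: k => i j; rewrite mxvecE mxE.
Qed.

Lemma lebesgue_sym_bundle p :
  exists mu : {sigma_finite_measure set 'M[R]_p -> \bar R},
    @lebesgue_sym p = mu.
Proof.
rewrite /lebesgue_sym.
have [mu ->] := lebesgue_tuple_bundle R (size (upper_pairs p)).
pose g (A : 'M[R]_p) : (size (upper_pairs p)).-tuple R :=
  [tuple A (tnth (in_tuple (upper_pairs p)) k).1
           (tnth (in_tuple (upper_pairs p)) k).2 | k < size (upper_pairs p)].
apply: (@pushforward_bundle _ _ _ _ _ _ _ g).
- apply: measurable_fun_mxP => i j.
  under eq_fun do rewrite mxE.
  set ij := if _ then _ else _.
  have ijs : (index ij (upper_pairs p) < size (upper_pairs p))%N.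
    rewrite index_mem mem_enum inE /ij; case: ifPn => //=.
    by rewrite -ltnNge; exact: ltnW.
  under eq_fun do rewrite -[index _ _]/(val (Ordinal ijs)) -tnth_nth.
  exact: measurable_tnth.
- apply/measurable_fun_tnthP => k.
  set ij := tnth (in_tuple (upper_pairs p)) k.
  have -> : (@tnth _ _)^~ k \o g = fun A => A ij.1 ij.2.
    by apply/funext => A /=; rewrite tnth_mktuple.
  exact: measurable_mxE.
- move=> v; apply/eq_from_tnth => k; rewrite tnth_mktuple mxE.
  set ij := tnth (in_tuple (upper_pairs p)) k.
  have : ij \in upper_pairs p by exact: (mem_tnth k (in_tuple (upper_pairs p))).
  rewrite mem_enum inE => ->; rewrite -surjective_pairing.
  rewrite /ij (tnth_nth ij) /= index_uniq ?upper_pairs_uniq//.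
  by rewrite -tnth_nth.
Qed.

End lebesgue_matrix.
Arguments lebesgue_mx : clear implicits.
Arguments lebesgue_sym : clear implicits.

Section matrix_sets.
Variables (R : realType) (p : nat).
Implicit Types (A B G L P : 'M[R]_p) (w : 'M[R]_p * 'M[R]_p).

Definition posdef : set 'M[R]_p :=
  [set A | A^T = A /\
           forall v : 'rV[R]_p, v != 0 -> 0 < (v *m A *m v^T) ord0 ord0].

Definition GL : set 'M[R]_p := [set A | A \in unitmx].

(* The first nonzero entry of each column is positive. *)
Definition GLhalf : set 'M[R]_p :=
  [set A | A \in unitmx /\
           forall j, exists i, 0 < A i j /\
                               forall k : 'I_p, (k < i)%N -> A k j = 0].

(* [B *m col_signs s] is [B] with the sign of each column [j] such that
   [s j] holds changed *)
Definition col_signs (s : 'I_p -> bool) : 'M[R]_p :=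
  diag_mx (\row_j (-1) ^+ s j).

Definition monomial_mx : set 'M[R]_p :=
  [set P | [/\ P \in unitmx,
               forall i, exists! j, P i j != 0 &
               forall j, exists! i, P i j != 0]].

Definition ordered_roots : set 'rV[R]_p :=
  [set l | (forall i, 0 < l ord0 i < 1) /\
           forall i j : 'I_p, (i < j)%N -> l ord0 j < l ord0 i].

Definition ordered_diag : set 'M[R]_p := [set diag_mx l | l in ordered_roots].

(* [\det (W1 - l (W1 + W2))] has degree [p] in [l], so having exactly [p]
   distinct zeros in [R] means that its [p] roots are pairwise distinct. *)
Definition sampleX : set ('M[R]_p * 'M[R]_p) :=
  [set w | [/\ posdef w.1, posdef w.2 &
    exists r : p.-tuple R, uniq r /\
      forall l : R, \det (w.1 - l *: (w.1 + w.2)) = 0 <-> l \in r]].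

Definition decomposition w : set ('M[R]_p * 'rV[R]_p) :=
  [set Bl | [/\ Bl.1 \in unitmx, ordered_roots Bl.2,
      w.1 = Bl.1 *m diag_mx Bl.2 *m Bl.1^T &
      w.2 = Bl.1 *m (1%:M - diag_mx Bl.2) *m Bl.1^T]].

(* A choice of (B(W), (l_1(W), ..., l_p(W))); the columns of B(W) are only
   determined up to sign. *)
Definition choose_decomposition w : 'M[R]_p * 'rV[R]_p :=
  xget (1%:M, 0) (decomposition w).

Definition B_of w : 'M[R]_p := (choose_decomposition w).1.
Definition l_of w : 'rV[R]_p := (choose_decomposition w).2.
Definition L_of w : 'M[R]_p := diag_mx (l_of w).

Variable P : 'M[R]_p -> 'M[R]_p.

Definition g_of w : 'M[R]_p :=
  xget 1%:M [set G | GLhalf G /\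
    exists s, G = B_of w *m invmx (P (L_of w)) *m col_signs s].

Definition z_at L : 'M[R]_p * 'M[R]_p :=
  (P L *m L *m (P L)^T, P L *m (1%:M - L) *m (P L)^T).

Definition Zset : set ('M[R]_p * 'M[R]_p) := [set z_at L | L in ordered_diag].

Definition z_of w : 'M[R]_p * 'M[R]_p := z_at (L_of w).

End matrix_sets.
Arguments posdef : clear implicits.
Arguments GL : clear implicits.
Arguments GLhalf : clear implicits.
Arguments monomial_mx : clear implicits.
Arguments ordered_roots : clear implicits.
Arguments ordered_diag : clear implicits.
Arguments sampleX : clear implicits.

Definition independent_rv d d1 d2 (T : measurableType d)
    (T1 : measurableType d1) (T2 : measurableType d2) (R : realType)
    (Pr : probability T R) (X : T -> T1) (Y : T -> T2) : Prop :=
  forall A B, measurable A -> measurable B ->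
    Pr (X @^-1` A `&` Y @^-1` B) = (Pr (X @^-1` A) * Pr (Y @^-1` B))%E.

(* Main.v *)
Require Import Defs.
From HB Require Import structures.
From mathcomp Require Import all_boot all_order all_algebra.
From mathcomp Require Import all_classical all_reals all_analysis.
From mathcomp Require Import measurable_realfun.
From mathcomp Require Import ring lra.
Set Implicit Arguments. Unset Strict Implicit. Unset Printing Implicit Defensive.
Import Order.TTheory GRing.Theory Num.Theory.
Import numFieldNormedType.Exports.
Local Open Scope classical_set_scope.
Local Open Scope ring_scope.

(** The heart of the matter is the change of variables
      [\int\int h(S, W) dS dW
         = \int\int h(B B^t, B L B^t) |det B|^(p+2) \prod_(i<j) (l_i - l_j) dB dl]
    over all [B] and all decreasing [l].  It goes by induction on the size.  Write
    [B = [1, y; 0, I] [b, 0; x, B']]; for fixed [l_1] linear substitutions and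
    [s = b^2] reduce the integral over [y], [b], [x] to one over the Schur complement
    coordinates of [S], the induction hypothesis handles [(B', l_2, ..., l_p)], and
    [W] is [l_1 S] minus a matrix of corank one with positive definite lower block
    [N'].  Reflecting in [l_1 S] turns [N'] into the lower block of [W], and finally
    [l_1] is traded for [w_11] by the secular function
    [phi(l) = l s_11 - n N^-1 n^t], [N = l S' - W'], [n = l s_12 - w_12], which
    satisfies [phi(l) - phi(m) = (l - m) (1, -y_l) S (1, -y_m)^t], [y_l = n N^-1].
    So only Fubini, linear maps and one-dimensional substitutions are needed.  This
    covers pencils whose top eigenvalue exceeds that of the lower block; unipotent
    conjugates of these exhaust the rest.

    The theorem follows with [S = W_1 + W_2] and [B = G P(L)].  The functions
    [L(W)], [B(W)] are measurable because power iteration on [W_1 S^-1] computes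
    them.  The density may be negative only on a null set, so that [t] splits
    into its positive part and a negligible negative part. *)

(** * Measurability of matrix operations *)

(** The true Jacobian of (B, l) -> (B B^t, B L B^t) carries a further factor 2^p. It cancels because
    B is determined only up to the sign of each column, so that each pencil is met 2^p times. The
    factor 2^p of the theorem appears later, when GL(p) is replaced by its half. The substitution z
    = y B' needs an invertible B', yet the integral over (S, W) does not see B. What saves the
    induction is that invertibility of B' is equivalent to a condition on (S, W): the top eigenvalue
    must strictly exceed that of the lower block. A rational number separating the two makes this
    condition measurable. Adding the first row of B to at most one other row makes B' invertible, so
    finitely many unipotent conjugates suffice. The exponents arise as follows. The two densities
    contribute |det B|^(2(a+b)-2(p+1)) and the Jacobian |det B|^(p+2), together |det B|^(2(a+b)-p).
    With B = G P(L) the volume element gives |det P|^p more, hence |det P|^(2(a+b)). *)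

Section measurable_matrix_operations.
Context d (T : measurableType d) (R : realType).

Lemma measurable_mx_entry m n (f : T -> 'M[R]_(m, n)) i j :
  measurable_fun setT f -> measurable_fun setT (fun x => f x i j).
Proof. by move=> mf; apply: (measurableT_comp (measurable_mxE i j) mf). Qed.

Lemma measurable_mx_pointwise m n m' n' (k : 'M[R]_(m, n) -> 'M[R]_(m', n'))
    (f : T -> 'M[R]_(m, n)) :
  (forall i j, exists i' j', forall A, k A i j = A i' j') ->
  measurable_fun setT f -> measurable_fun setT (fun x => k (f x)).
Proof.
move=> kE mf; apply: measurable_fun_mxP => i j.
have [i' [j' kA]] := kE i j.
by under eq_fun do rewrite kA; exact: measurable_mx_entry.
Qed.

Lemma measurable_trmx m n (f : T -> 'M[R]_(m, n)) :
  measurable_fun setT f -> measurable_fun setT (fun x => (f x)^T).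
Proof. by apply: measurable_mx_pointwise => i j; exists j, i => A; rewrite mxE. Qed.

Lemma measurable_addmx m n (f g : T -> 'M[R]_(m, n)) :
  measurable_fun setT f -> measurable_fun setT g ->
  measurable_fun setT (fun x => f x + g x).
Proof.
move=> mf mg; apply: measurable_fun_mxP => i j; under eq_fun do rewrite mxE.
by apply: measurable_funD; exact: measurable_mx_entry.
Qed.

Lemma measurable_oppmx m n (f : T -> 'M[R]_(m, n)) :
  measurable_fun setT f -> measurable_fun setT (fun x => - f x).
Proof.
move=> mf; apply: measurable_fun_mxP => i j; under eq_fun do rewrite mxE.
by apply: measurable_funN; exact: measurable_mx_entry.
Qed.

Lemma measurable_scalemx m n (c : T -> R) (f : T -> 'M[R]_(m, n)) :
  measurable_fun setT c -> measurable_fun setT f ->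
  measurable_fun setT (fun x => c x *: f x).
Proof.
move=> mc mf; apply: measurable_fun_mxP => i j; under eq_fun do rewrite mxE.
by apply: measurable_funM => //; exact: measurable_mx_entry.
Qed.

Lemma measurable_scalar_mx n (c : T -> R) :
  measurable_fun setT c -> measurable_fun setT (fun x => (c x)%:M : 'M[R]_n).
Proof.
move=> mc; apply: measurable_fun_mxP => i j; under eq_fun do rewrite mxE.
by case: (i == j) => //=; under eq_fun do rewrite mulr0n; exact: measurable_cst.
Qed.

Lemma measurable_mulmx m n q (f : T -> 'M[R]_(m, n)) (g : T -> 'M[R]_(n, q)) :
  measurable_fun setT f -> measurable_fun setT g ->
  measurable_fun setT (fun x => f x *m g x).
Proof.
move=> mf mg; apply: measurable_fun_mxP => i j; under eq_fun do rewrite mxE.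
apply: measurable_sum => k; by apply: measurable_funM; exact: measurable_mx_entry.
Qed.

Lemma measurable_row_mx m n1 n2 (f : T -> 'M[R]_(m, n1)) (g : T -> 'M[R]_(m, n2)) :
  measurable_fun setT f -> measurable_fun setT g ->
  measurable_fun setT (fun x => row_mx (f x) (g x)).
Proof.
move=> mf mg; apply: measurable_fun_mxP => i j; under eq_fun do rewrite mxE.
by case: splitP => k _; exact: measurable_mx_entry.
Qed.

Lemma measurable_col_mx m1 m2 n (f : T -> 'M[R]_(m1, n)) (g : T -> 'M[R]_(m2, n)) :
  measurable_fun setT f -> measurable_fun setT g ->
  measurable_fun setT (fun x => col_mx (f x) (g x)).
Proof.
move=> mf mg; apply: measurable_fun_mxP => i j; under eq_fun do rewrite mxE.
by case: splitP => k _; exact: measurable_mx_entry.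
Qed.

Lemma measurable_block_mx m1 m2 n1 n2 (f : T -> 'M[R]_(m1, n1))
    (g : T -> 'M[R]_(m1, n2)) (h : T -> 'M[R]_(m2, n1)) (k : T -> 'M[R]_(m2, n2)) :
  measurable_fun setT f -> measurable_fun setT g ->
  measurable_fun setT h -> measurable_fun setT k ->
  measurable_fun setT (fun x => block_mx (f x) (g x) (h x) (k x)).
Proof.
by move=> mf mg mh mk; apply: measurable_col_mx; apply: measurable_row_mx.
Qed.

Lemma measurable_ulsubmx m1 m2 n1 n2 (f : T -> 'M[R]_(m1 + m2, n1 + n2)) :
  measurable_fun setT f -> measurable_fun setT (fun x => ulsubmx (f x)).
Proof.
apply: measurable_mx_pointwise => i j; exists (lshift _ i), (lshift _ j) => A.
by rewrite !mxE.
Qed.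

Lemma measurable_ursubmx m1 m2 n1 n2 (f : T -> 'M[R]_(m1 + m2, n1 + n2)) :
  measurable_fun setT f -> measurable_fun setT (fun x => ursubmx (f x)).
Proof.
apply: measurable_mx_pointwise => i j; exists (lshift _ i), (rshift _ j) => A.
by rewrite !mxE.
Qed.

Lemma measurable_dlsubmx m1 m2 n1 n2 (f : T -> 'M[R]_(m1 + m2, n1 + n2)) :
  measurable_fun setT f -> measurable_fun setT (fun x => dlsubmx (f x)).
Proof.
apply: measurable_mx_pointwise => i j; exists (rshift _ i), (lshift _ j) => A.
by rewrite !mxE.
Qed.

Lemma measurable_drsubmx m1 m2 n1 n2 (f : T -> 'M[R]_(m1 + m2, n1 + n2)) :
  measurable_fun setT f -> measurable_fun setT (fun x => drsubmx (f x)).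
Proof.
apply: measurable_mx_pointwise => i j; exists (rshift _ i), (rshift _ j) => A.
by rewrite !mxE.
Qed.

Lemma measurable_diag_mx n (f : T -> 'rV[R]_n) :
  measurable_fun setT f -> measurable_fun setT (fun x => diag_mx (f x)).
Proof.
move=> mf; apply: measurable_fun_mxP => i j; under eq_fun do rewrite mxE.
case: (i == j) => //=; last by under eq_fun do rewrite mulr0n; exact: measurable_cst.
by apply: measurable_mx_entry.
Qed.

Lemma measurable_mxtrace n (f : T -> 'M[R]_n) :
  measurable_fun setT f -> measurable_fun setT (fun x => \tr (f x)).
Proof. by move=> mf; apply: measurable_sum => i; exact: measurable_mx_entry. Qed.

Lemma measurable_determinant n (f : T -> 'M[R]_n) :
  measurable_fun setT f -> measurable_fun setT (fun x => \det (f x)).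
Proof.
move=> mf; apply: measurable_sum => s; apply: measurable_funM.
  exact: measurable_cst.
by apply: measurable_prod => i _; exact: measurable_mx_entry.
Qed.

Lemma measurable_invr (f : T -> R) :
  measurable_fun setT f -> measurable_fun setT (fun x => (f x)^-1).
Proof.
move=> mf.
(* Inversion is expressed through a real power, which is known to be measurable; the factor [f x]
   makes both sides 0 where [f x = 0]. *)
rewrite (_ : (fun x => _) = fun x => (f x ^+ 2) `^ (- 1) * f x); last first.
  apply/funext => x; have [->|fx0] := eqVneq (f x) 0; first by rewrite invr0 mulr0.
  rewrite powR_inv1 ?sqr_ge0// expr2 invfM mulrAC mulVf// mul1r//.
apply: measurable_funM => //.
exact: (measurableT_comp (measurable_powR (-1)) (measurable_funX 2 mf)).
Qed.

Lemma measurable_invmx n (f : T -> 'M[R]_n) :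
  measurable_fun setT f -> measurable_fun setT (fun x => invmx (f x)).
Proof.
move=> mf; rewrite /invmx.
(* [invmx] returns a singular matrix unchanged, so the adjugate formula holds only off the zero set
   of the determinant. *)
rewrite (_ : (fun x => _) = fun x => if \det (f x) != 0 then
  (\det (f x))^-1 *: \adj (f x) else f x); last first.
  by apply/funext => x; rewrite unitmxE unitfE.
apply: measurable_fun_ifT => //.
  apply: measurable_neg; apply: measurable_fun_eqr; last exact: measurable_cst.
  exact: measurable_determinant.
apply: measurable_scalemx; first by apply: measurable_invr; exact: measurable_determinant.
apply: measurable_fun_mxP => i j; under eq_fun do rewrite mxE.
apply: measurable_funM; first exact: measurable_cst.
apply: measurable_determinant.
apply: (measurable_mx_pointwise (k := fun A => row' j (col' i A))) mf => k l.
by exists (lift j k), (lift i l) => A; rewrite !mxE.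
Qed.
End measurable_matrix_operations.

Lemma measurable_fst_comp d1 d2 d3 (T : measurableType d1) (T1 : measurableType d2)
    (T2 : measurableType d3) (f : T -> T1 * T2) :
  measurable_fun setT f -> measurable_fun setT (fun x => (f x).1).
Proof. exact: (measurableT_comp measurable_fst). Qed.

Lemma measurable_snd_comp d1 d2 d3 (T : measurableType d1) (T1 : measurableType d2)
    (T2 : measurableType d3) (f : T -> T1 * T2) :
  measurable_fun setT f -> measurable_fun setT (fun x => (f x).2).
Proof. exact: (measurableT_comp measurable_snd). Qed.

Lemma measurable_EFin_comp d (T : measurableType d) (R : realType) (f : T -> R) :
  measurable_fun setT f -> measurable_fun setT (fun x => (f x)%:E).
Proof. by move=> mf; exact/measurable_EFinP. Qed.

Lemma measurable_normr_comp d (T : measurableType d) (R : realType) (f : T -> R) :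
  measurable_fun setT f -> measurable_fun setT (fun x => `|f x|).
Proof. by move=> mf; apply: measurableT_comp mf. Qed.

(** Descends along the syntax of the function and leaves as goals the subterms that it does not
    recognise. *)
Ltac mx_measurable :=
  lazymatch goal with
  | |- measurable_fun _ (fun _ => ?c) => exact: measurable_cst
  | |- measurable_fun _ fst => exact: measurable_fst
  | |- measurable_fun _ snd => exact: measurable_snd
  | |- measurable_fun _ (fun x => x) => exact: measurable_id
  | |- measurable_fun _ (fun x => EFin _) => apply: measurable_EFin_comp; mx_measurable
  | |- measurable_fun _ (fun x => fst _) => apply: measurable_fst_comp; mx_measurable
  | |- measurable_fun _ (fun x => snd _) => apply: measurable_snd_comp; mx_measurable
  | |- measurable_fun _ (fun x => (_, _)) => apply: measurable_fun_pair; mx_measurable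
  | |- measurable_fun _ (fun x => mulmx _ _) => apply: measurable_mulmx; mx_measurable
  | |- measurable_fun _ (fun x => row_mx _ _) => apply: measurable_row_mx; mx_measurable
  | |- measurable_fun _ (fun x => col_mx _ _) => apply: measurable_col_mx; mx_measurable
  | |- measurable_fun _ (fun x => block_mx _ _ _ _) => apply: measurable_block_mx; mx_measurable
  | |- measurable_fun _ (fun x => trmx _) => apply: measurable_trmx; mx_measurable
  | |- measurable_fun _ (fun x => invmx _) => apply: measurable_invmx; mx_measurable
  | |- measurable_fun _ (fun x => ulsubmx _) => apply: measurable_ulsubmx; mx_measurable
  | |- measurable_fun _ (fun x => ursubmx _) => apply: measurable_ursubmx; mx_measurable
  | |- measurable_fun _ (fun x => dlsubmx _) => apply: measurable_dlsubmx; mx_measurable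
  | |- measurable_fun _ (fun x => drsubmx _) => apply: measurable_drsubmx; mx_measurable
  | |- measurable_fun _ (fun x => determinant _) => apply: measurable_determinant; mx_measurable
  | |- measurable_fun _ (fun x => mxtrace _) => apply: measurable_mxtrace; mx_measurable
  | |- measurable_fun _ (fun x => diag_mx _) => apply: measurable_diag_mx; mx_measurable
  | |- measurable_fun _ (fun x => scalar_mx _) => apply: measurable_scalar_mx; mx_measurable
  | |- measurable_fun _ (fun x => GRing.scale _ _) => apply: measurable_scalemx; mx_measurable
  | |- measurable_fun _ (fun x => mule _ _) => apply: emeasurable_funM; mx_measurable
  | |- measurable_fun _ (fun x => GRing.mul _ _) => apply: measurable_funM; mx_measurable
  | |- measurable_fun _ (fun x => GRing.inv _) => apply: measurable_invr; mx_measurable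
  | |- measurable_fun _ (fun x => GRing.exp _ _) => apply: measurable_funX; mx_measurable
  | |- measurable_fun _ (fun x => Num.norm _) => apply: measurable_normr_comp; mx_measurable
  | |- measurable_fun _ (fun x => fun_of_matrix _ _ _) => apply: measurable_mx_entry; mx_measurable
  | |- measurable_fun _ (fun x => _ + _) =>
      first [apply: measurable_addmx; mx_measurable | apply: measurable_funD; mx_measurable]
  | |- measurable_fun _ (fun x => - _) =>
      first [apply: measurable_oppmx; mx_measurable | apply: measurable_funN; mx_measurable]
  | |- measurable_fun _ (fun x => \prod_(_ <- _) _) => apply: measurable_prod => * /=; mx_measurable
  | H : measurable_fun _ ?f |- measurable_fun _ (fun x => ?f _) =>
      apply: (measurableT_comp H); mx_measurable
  | |- measurable_fun _ (fun x => _) => first [assumption | idtac]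
  | |- measurable_fun ?D ?f =>
      first [assumption | change (measurable_fun D (fun x => f x)); mx_measurable]
  | |- _ => idtac
  end.

(** * Lebesgue measure on matrices *)

Section box_measures.
Variable R : realType.
Implicit Types m n p : nat.

Definition mx_box m n (F : 'I_m -> 'I_n -> set R) : set 'M[R]_(m, n) :=
  [set A | forall i j, F i j (A i j)].

Lemma measurable_mx_box m n (F : 'I_m -> 'I_n -> set R) :
  (forall i j, measurable (F i j)) -> measurable (mx_box F).
Proof.
move=> mF.
rewrite (_ : mx_box F = \bigcap_(i in [set: 'I_m]) \bigcap_(j in [set: 'I_n])
    ((fun A : 'M[R]_(m, n) => A i j) @^-1` F i j)); last first.
  by apply/seteqP; split=> [A AF i _ j _|A AF i j]; [exact: AF|exact: AF].
apply: fin_bigcap_measurable => // i _; apply: fin_bigcap_measurable => // j _.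
by rewrite -[X in measurable X]setTI; exact: measurable_mxE.
Qed.

Definition mx_cube m n (k : nat) : set 'M[R]_(m, n) :=
  mx_box (fun _ _ => `[- k%:R, k%:R]%classic).

Definition measurable_mx_boxes m n : set (set 'M[R]_(m, n)) :=
  [set mx_box F | F in [set F | forall i j, measurable (F i j)]].

Lemma measurable_mx_boxesE m n :
  @measurable _ 'M[R]_(m, n) = <<s @measurable_mx_boxes m n >>.
Proof.
apply/seteqP; split; last first.
  apply: smallest_sub; first exact: sigma_algebra_measurable.
  by move=> _ [F mF <-]; exact: measurable_mx_box.
apply: smallest_sub; first exact: smallest_sigma_algebra.
rewrite -bigcup_seq => Y [k _ [A mA <-]]/=; apply: sub_sigma_algebra.
case/mxvec_indexP: k => i j.
exists (fun i' j' => if (i', j') == (i, j) then A else setT).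
  by move=> i' j'; case: ifP.
apply/seteqP; split=> B /=.
  by move=> /(_ i j); rewrite eqxx /mx_coor mxvecE.
by rewrite /mx_coor mxvecE => -[_ AB] i' j'; case: ifPn => // /eqP[-> ->].
Qed.

(** Boxes are stable under intersection and generate the sigma-algebra; the cubes exhaust the space
    and have finite mass. *)
Lemma mx_measure_unique m n (m1 m2 : {measure set 'M[R]_(m, n) -> \bar R}) :
  (forall F, (forall i j, measurable (F i j)) ->
    m1 (mx_box F) = m2 (mx_box F)) ->
  (forall k, m1 (@mx_cube m n k) < +oo)%E ->
  forall A, measurable A -> m1 A = m2 A.
Proof.
move=> m12 fin.
apply: (measure_unique (@measurable_mx_boxes m n) (@mx_cube m n)) => //.
- exact: measurable_mx_boxesE.
- move=> _ _ [F mF <-] [G mG <-]; exists (fun i j => F i j `&` G i j).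
    by move=> i j; exact: measurableI.
  apply/seteqP; split=> A; first by move=> AFG; split=> i j; have [] := AFG i j.
  by move=> [AF AG] i j; split.
- by move=> k; exists (fun _ _ => `[- k%:R, k%:R]%classic).
- apply/seteqP; split=> // A _.
  (* The sum of all absolute values dominates each entry, which gives a cube containing [A]. *)
  pose M := \sum_i \sum_j `|A i j|.
  exists (Num.truncn M).+1 => // i j /=; rewrite in_itv/= -ler_norml.
  apply: (@le_trans _ _ M); last exact/ltW/truncnS_gt.
  rewrite /M (bigD1 i)//= (bigD1 j)//= -addrA lerDl addr_ge0//.
    by apply: sumr_ge0.
  by apply: sumr_ge0 => *; exact: sumr_ge0.
- by move=> _ [F mF <-]; exact: m12.
Qed.

Lemma lebesgue_tuple_box n (F : 'I_n -> set R) : (forall i, measurable (F i)) ->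
  lebesgue_tuple R n [set v | forall i, F i (tnth v i)] =
  (\prod_i lebesgue_measure (F i : set (measurableTypeR R)))%E.
Proof.
elim: n F => [|n IH] F mF.
  rewrite big_ord0/= diracE; rewrite mem_set//= => i; case: i => //.
rewrite big_ord_recl /= -IH; last by move=> i.
have [mu muE] := lebesgue_tuple_bundle R n; rewrite muE.
rewrite /pushforward -product_measure1E//; last first.
  rewrite (_ : [set _ | _] = \bigcap_(i in [set: 'I_n])
    (fun v : n.-tuple R => tnth v i) @^-1` F (lift ord0 i)).
    apply: fin_bigcap_measurable => // i _.
    by rewrite -[X in measurable X]setTI; exact: measurable_tnth.
  by apply/seteqP; split=> [v vF i _|v vF i]; exact: vF.
  exact: mF.
congr (_ _); apply/seteqP; split=> -[x v]/=.
  move=> xvF; split; first exact: (xvF ord0).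
  by move=> i; have := xvF (lift ord0 i); rewrite tnthS.
by move=> [xF vF] i; case: (unliftP ord0 i) => [j|] -> //; rewrite tnthS; exact: vF.
Qed.

(** [lebesgue_mx] is a bare set function, while Fubini asks for the structure of a sigma-finite
    measure; one such structure is fixed here. *)
Lemma lebesgue_mx_sig m n :
  {mu : {sigma_finite_measure set 'M[R]_(m, n) -> \bar R} | lebesgue_mx R m n = mu}.
Proof. exact/cid/lebesgue_mx_bundle. Qed.

Definition mxL m n := sval (lebesgue_mx_sig m n).

Lemma mxLE m n : lebesgue_mx R m n = mxL m n.
Proof. exact: svalP (lebesgue_mx_sig m n). Qed.

Lemma lebesgue_sym_sig p :
  {mu : {sigma_finite_measure set 'M[R]_p -> \bar R} | lebesgue_sym R p = mu}.
Proof. exact/cid/lebesgue_sym_bundle. Qed.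

Definition symL p := sval (lebesgue_sym_sig p).

Lemma symLE p : lebesgue_sym R p = symL p.
Proof. exact: svalP (lebesgue_sym_sig p). Qed.

Lemma mxL_box m n (F : 'I_m -> 'I_n -> set R) :
  (forall i j, measurable (F i j)) ->
  mxL m n (mx_box F) = (\prod_i \prod_j
    lebesgue_measure (F i j : set (measurableTypeR R)))%E.
Proof.
move=> mF; rewrite -mxLE /lebesgue_mx /pushforward.
pose G k := F (enum_val (cast_ord (esym (mxvec_cast m n)) k)).1
  (enum_val (cast_ord (esym (mxvec_cast m n)) k)).2.
have GE i j : G (mxvec_index i j) = F i j.
  by rewrite /G /mxvec_index cast_ordK enum_rankK.
rewrite (_ : _ @^-1` _ = [set v | forall k, G k (tnth v k)]); last first.
  apply/seteqP; split=> v /=.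
    by move=> vF k; case/mxvec_indexP: k => i j; rewrite GE; have := vF i j; rewrite mxE.
  by move=> vG i j; rewrite mxE -GE.
rewrite lebesgue_tuple_box//; last by move=> k; exact: mF.
rewrite pair_big /= (reindex (uncurry (@mxvec_index m n)))/=; last first.
  exact: curry_mxvec_bij.
by apply: eq_bigr => -[i j] _; rewrite GE.
Qed.

(** The entries (i, j) and (j, i) are one and the same coordinate, which must meet both
    constraints. *)
Lemma symL_box p (F : 'I_p -> 'I_p -> set R) :
  (forall i j, measurable (F i j)) ->
  symL p (mx_box F) = (\prod_(i < p) \prod_(j < p | (i <= j)%N)
    lebesgue_measure (F i j `&` F j i : set (measurableTypeR R)))%E.
Proof.
move=> mF; rewrite pair_big_dep/=; rewrite -symLE /lebesgue_sym /pushforward.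
pose G (ij : 'I_p * 'I_p) := F ij.1 ij.2 `&` F ij.2 ij.1.
rewrite (_ : _ @^-1` _ =
    [set v | forall k, G (tnth (in_tuple (upper_pairs p)) k) (tnth v k)]); last first.
  apply/seteqP; split=> v /=.
    move=> vF k; set ij := tnth _ k.
    have : ij \in upper_pairs p by exact: (mem_tnth k (in_tuple (upper_pairs p))).
    rewrite mem_enum inE => ij12.
    have vk : tnth v k = nth 0 v (index ij (upper_pairs p)).
      by rewrite /ij (tnth_nth ij) /= index_uniq ?upper_pairs_uniq// -tnth_nth.
    split.
      by have := vF ij.1 ij.2; rewrite mxE ij12 -surjective_pairing -vk.
    have := vF ij.2 ij.1; rewrite mxE; case: ifPn; last first.
      by rewrite -surjective_pairing -vk.
    move=> ij21; have ij12' : ij.1 = ij.2 by apply/val_inj/anti_leq; rewrite ij12 ij21.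
    have -> : (ij.2, ij.1) = ij by rewrite [RHS]surjective_pairing ij12'.
    by rewrite vk.
  move=> vG i j; rewrite mxE; set ij := if _ then _ else _.
  have ijs : (index ij (upper_pairs p) < size (upper_pairs p))%N.
    rewrite index_mem mem_enum inE /ij; case: ifPn => //=.
    by rewrite -ltnNge; exact: ltnW.
  have := vG (Ordinal ijs).
  rewrite !(tnth_nth ij) (tnth_nth 0)/= nth_index -?index_mem//.
  by rewrite /G /ij; case: ifP => _ [].
rewrite (lebesgue_tuple_box (F := fun k => G (tnth (in_tuple (upper_pairs p)) k))); last first.
  by move=> k; exact: measurableI.
rewrite -(big_tnth _ _ (upper_pairs p) xpredT (fun ij => lebesgue_measure (G ij))).
by rewrite big_enum_cond/=; apply: eq_bigl => ij; rewrite andbT.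
Qed.
End box_measures.

Section tonelli.
Context d1 d2 (T1 : measurableType d1) (T2 : measurableType d2) (R : realType).
Variables (m1 : {sigma_finite_measure set T1 -> \bar R})
  (m2 : {sigma_finite_measure set T2 -> \bar R}).

Lemma integral_prod (f : T1 * T2 -> \bar R) :
  measurable_fun setT f -> (forall x, 0 <= f x)%E ->
  (\int[m1 \x m2]_z f z = \int[m1]_x \int[m2]_y f (x, y))%E.
Proof. by move=> mf f0; rewrite (fubini_tonelli1 f). Qed.

Lemma integral_swap (f : T1 -> T2 -> \bar R) :
  measurable_fun setT (fun x => f x.1 x.2) -> (forall x y, 0 <= f x y)%E ->
  (\int[m1]_x \int[m2]_y f x y = \int[m2]_y \int[m1]_x f x y)%E.
Proof. by move=> mf f0; rewrite (fubini_tonelli (fun x => f x.1 x.2)). Qed.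

Lemma measurable_integral (f : T1 -> T2 -> \bar R) :
  measurable_fun setT (fun x => f x.1 x.2) -> (forall x y, 0 <= f x y)%E ->
  measurable_fun setT (fun x => \int[m2]_y f x y)%E.
Proof.
move=> mf f0.
exact: (measurable_fun_fubini_tonelli_F (m2 := m2) (fun x => f x.1 x.2)).
Qed.
End tonelli.
Arguments integral_swap {d1 d2 T1 T2 R m1 m2} f.
Arguments measurable_integral {d1 d2 T1 T2 R m2} f.

Ltac integral_nonneg := intros; repeat (apply: integral_ge0; intros); auto.

Section lebesgue_matrix_integrals.
Variable R : realType.
Implicit Types m n p : nat.
Local Notation lam := (@lebesgue_measure R).

(** The common source of the entrywise substitutions: the image of [mu] under [phi] and [nu] agree
    on boxes, hence everywhere. *)
Lemma eq_integral_of_boxes d (X : measurableType d) (mu : {measure set X -> \bar R})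
    m n (nu : {measure set 'M[R]_(m, n) -> \bar R}) (phi : X -> 'M[R]_(m, n)) :
  measurable_fun setT phi ->
  (forall F, (forall i j, measurable (F i j)) ->
    mu (phi @^-1` mx_box F) = nu (mx_box F)) ->
  (forall k, nu (@mx_cube R m n k) < +oo)%E ->
  forall f : 'M[R]_(m, n) -> \bar R, measurable_fun setT f ->
  (forall A, 0 <= f A)%E ->
  (\int[nu]_A f A = \int[mu]_x f (phi x))%E.
Proof.
move=> mphi box fin f mf f0.
have := ge0_integral_pushforward mphi mu measurableT mf (fun y _ => f0 y).
rewrite preimage_setT => <-.
pose mu' : {measure set _ -> \bar R} :=
  measure_function_pushforward__canonical__measure_function_Measure mu mphi.
apply: (eq_measure_integral mu') => A mA _.
apply: mx_measure_unique => // F mF.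
by rewrite /mu'/= /pushforward box.
Qed.

Lemma mxL_cube_fin m n k : (mxL R m n (@mx_cube R m n k) < +oo)%E.
Proof.
rewrite mxL_box//=; rewrite ltey_eq; apply/orP; left.
apply: prode_fin_num => i _; apply: prode_fin_num => j _.
by rewrite lebesgue_measure_itv /=; case: ifPn.
Qed.

Lemma symL_cube_fin p k : (symL R p (@mx_cube R p p k) < +oo)%E.
Proof.
rewrite symL_box//=; rewrite ltey_eq; apply/orP; left.
apply: prode_fin_num => i _; apply: prode_fin_num => j _; rewrite setIid.
by rewrite lebesgue_measure_itv /=; case: ifPn.
Qed.

Lemma integral_row_mx m n1 n2 (f : 'M[R]_(m, n1 + n2) -> \bar R) :
  measurable_fun setT f -> (forall A, 0 <= f A)%E ->
  (\int[mxL R m (n1 + n2)]_A f A =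
   \int[mxL R m n1]_A1 \int[mxL R m n2]_A2 f (row_mx A1 A2))%E.
Proof.
move=> mf f0.
pose phi (x : 'M[R]_(m, n1) * 'M[R]_(m, n2)) := row_mx x.1 x.2.
have mphi : measurable_fun setT phi.
  by apply: measurable_row_mx; [exact: measurable_fst|exact: measurable_snd].
rewrite (@eq_integral_of_boxes _ _ (mxL R m n1 \x mxL R m n2)%E _ _ _ phi)//.
- by rewrite integral_prod//; exact: (measurableT_comp mf mphi).
- move=> F mF; rewrite (_ : _ @^-1` _ =
    mx_box (fun i j => F i (lshift n2 j)) `*` mx_box (fun i j => F i (rshift n1 j))).
    rewrite [LHS]product_measure1E; try exact: measurable_mx_box.
    rewrite /= !mxL_box// -big_split/=; apply: eq_bigr => i _.
    by rewrite big_split_ord.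
  apply/seteqP; split=> -[A1 A2] /=.
    move=> AF; split=> i j.
      by have := AF i (lshift n2 j); rewrite row_mxEl.
    by have := AF i (rshift n1 j); rewrite row_mxEr.
  move=> [A1F A2F] i j; case: (split_ordP j) => k ->.
    by rewrite /phi row_mxEl; exact: A1F.
  by rewrite /phi row_mxEr; exact: A2F.
- exact: mxL_cube_fin.
Qed.

Lemma integral_col_mx m1 m2 n (f : 'M[R]_(m1 + m2, n) -> \bar R) :
  measurable_fun setT f -> (forall A, 0 <= f A)%E ->
  (\int[mxL R (m1 + m2) n]_A f A =
   \int[mxL R m1 n]_A1 \int[mxL R m2 n]_A2 f (col_mx A1 A2))%E.
Proof.
move=> mf f0.
pose phi (x : 'M[R]_(m1, n) * 'M[R]_(m2, n)) := col_mx x.1 x.2.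
have mphi : measurable_fun setT phi.
  by apply: measurable_col_mx; [exact: measurable_fst|exact: measurable_snd].
rewrite (@eq_integral_of_boxes _ _ (mxL R m1 n \x mxL R m2 n)%E _ _ _ phi)//.
- by rewrite integral_prod//; exact: (measurableT_comp mf mphi).
- move=> F mF; rewrite (_ : _ @^-1` _ =
    mx_box (fun i j => F (lshift m2 i) j) `*` mx_box (fun i j => F (rshift m1 i) j)).
    rewrite [LHS]product_measure1E; try exact: measurable_mx_box.
    by rewrite /= !mxL_box//= big_split_ord.
  apply/seteqP; split=> -[A1 A2] /=.
    move=> AF; split=> i j.
      by have := AF (lshift m2 i) j; rewrite col_mxEu.
    by have := AF (rshift m1 i) j; rewrite col_mxEd.
  move=> [A1F A2F] i j; case: (split_ordP i) => k ->.
    by rewrite /phi col_mxEu; exact: A1F.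
  by rewrite /phi col_mxEd; exact: A2F.
- exact: mxL_cube_fin.
Qed.

Definition sym_block n (c : 'M[R]_1) (w : 'rV[R]_n) (W : 'M[R]_n) : 'M[R]_(1 + n) :=
  block_mx c w w^T W.

Lemma integral_sym_block n (f : 'M[R]_(1 + n) -> \bar R) :
  measurable_fun setT f -> (forall A, 0 <= f A)%E ->
  (\int[symL R (1 + n)]_A f A =
   \int[mxL R 1 1]_c \int[mxL R 1 n]_w \int[symL R n]_W f (sym_block c w W))%E.
Proof.
move=> mf f0.
pose phi (x : 'M[R]_(1, 1 + n) * 'M[R]_n) :=
  block_mx (lsubmx x.1) (rsubmx x.1) (rsubmx x.1)^T x.2.
have mphi : measurable_fun setT phi.
  apply: measurable_block_mx; last exact: measurable_snd.
  - apply: (measurable_mx_pointwise (k := @lsubmx _ _ _ _)) (@measurable_fst _ _ _ _).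
    by move=> i j; exists i, (lshift n j) => A; rewrite mxE.
  - apply: (measurable_mx_pointwise (k := @rsubmx _ _ _ _)) (@measurable_fst _ _ _ _).
    by move=> i j; exists i, (rshift 1 j) => A; rewrite mxE.
  - apply: (measurable_mx_pointwise (k := fun A => (@rsubmx _ _ _ _ A)^T)) (@measurable_fst _ _ _ _).
    by move=> i j; exists j, (rshift 1 i) => A; rewrite !mxE.
rewrite (@eq_integral_of_boxes _ _ (mxL R 1 (1 + n) \x symL R n)%E _ _ _ phi)//.
- rewrite integral_prod//; last exact: (measurableT_comp mf mphi).
  rewrite integral_row_mx/=.
  + apply: eq_integral => c _; apply: eq_integral => w _; apply: eq_integral => W _ /=.
    by rewrite /phi/= row_mxKl row_mxKr.
  + apply: (measurable_integral (fun r W => f (phi (r, W)))) => //.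
    under eq_fun do rewrite -surjective_pairing.
    exact: (measurableT_comp mf mphi).
  + by move=> A; exact: integral_ge0.
- move=> F mF.
  (* The first row inherits the constraints on the first row and on the first column of the box. *)
  pose F1 (i : 'I_1) (j : 'I_(1 + n)) := F (lshift n ord0) j `&` F j (lshift n ord0).
  rewrite (_ : _ @^-1` _ =
    mx_box F1 `*` mx_box (fun i j => F (rshift 1 i) (rshift 1 j))).
    have mF1 i j : measurable (F1 i j) by exact: measurableI.
    rewrite [LHS]product_measure1E; try exact: measurable_mx_box.
    rewrite /= mxL_box// big_ord1 !symL_box//.
    rewrite [RHS]big_split_ord big_ord1/=; congr (_ * _)%E.
    apply: eq_bigr => i _.
    by rewrite [RHS]big_mkcond/= big_split_ord big_ord1/= mul1e -big_mkcond.
  apply/seteqP; split=> -[r W] /=.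
    move=> AF; split=> i j; last first.
      by have := AF (rshift 1 i) (rshift 1 j); rewrite block_mxEdr.
    rewrite (ord1 i).
    case: (split_ordP j) => k ->.
      have := AF (lshift n ord0) (lshift n k); rewrite (ord1 k) block_mxEul mxE.
      by split.
    split.
      by have := AF (lshift n ord0) (rshift 1 k); rewrite block_mxEur mxE.
    by have := AF (rshift 1 k) (lshift n ord0); rewrite block_mxEdl !mxE.
  move=> [rF WF] i j; rewrite /phi/=.
  case: (split_ordP i) => i' ->; case: (split_ordP j) => j' ->.
  + by rewrite block_mxEul mxE (ord1 i') (ord1 j'); have [] := rF ord0 (lshift n ord0).
  + by rewrite block_mxEur mxE (ord1 i'); have [] := rF ord0 (rshift 1 j').
  + by rewrite block_mxEdl !mxE (ord1 j'); have [] := rF ord0 (rshift 1 i').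
  + by rewrite block_mxEdr; exact: WF.
- exact: symL_cube_fin.
Qed.
End lebesgue_matrix_integrals.

(** * Affine substitutions *)

Section lebesgue_affine.
Variable R : realType.
Local Notation lam := (@lebesgue_measure R).

(** The rescaled image measure gives half-open intervals their length, which characterizes Lebesgue
    measure. A negative [a] exchanges the open and the closed end. *)
Lemma lebesgue_measure_affine (a c : R) (F : set R) : a != 0 -> measurable F ->
  lam [set x | F (c + a * x)] = (`|a|^-1%:E * lam F)%E.
Proof.
move=> a0 mF.
pose phi x : measurableTypeR R := c + a * x.
have mphi : measurable_fun [set: measurableTypeR R] phi.
  apply: measurable_funD; first exact: measurable_cst.
  by apply: measurable_funM; [exact: measurable_cst|exact: measurable_id].
pose mu1 : {measure set (measurableTypeR R) -> \bar R} :=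
  measure_function_pushforward__canonical__measure_function_Measure lam mphi.
have na0 : 0 <= `|a| by [].
pose mu2 : {measure set (measurableTypeR R) -> \bar R} := mscale (NngNum na0) mu1.
suff -> : lam F = mu2 F.
  rewrite /mu2/= /mscale/= /pushforward/= muleA -EFinM mulVf ?normr_eq0// mul1e.
  by [].
apply: lebesgue_measure_unique => // _ [[u v]/= _ <-].
rewrite /mu2/= /mscale/= /pushforward/=.
have [uv|vu] := ltP u v; last first.
  rewrite set_itv_ge ?bnd_simp -?leNgt//.
  by rewrite preimage_set0 !measure0 mule0.
have [a_gt0|a_lt0|] := ltgtP 0 a; last by move=> /esym/eqP; rewrite (negbTE a0).
- rewrite (_ : _ @^-1` _ = `](u - c) / a, (v - c) / a]%classic); last first.
    apply/seteqP; split=> x; rewrite /phi/= !in_itv/= ltr_pdivrMr// ler_pdivlMr//.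
      by rewrite ltrBlDl lerBrDl (mulrC x).
    by rewrite ltrBlDl lerBrDl (mulrC x).
  rewrite !lebesgue_measure_itv/= !lte_fin uv ltr_pM2r ?invr_gt0// ltrD2r uv.
  rewrite gtr0_norm// -!EFinB -EFinM; congr EFin; field; exact: a0.
- rewrite (_ : _ @^-1` _ = `[(v - c) / a, (u - c) / a[%classic); last first.
    apply/seteqP; split=> x; rewrite /phi/= !in_itv/= ler_ndivrMr// ltr_ndivlMr//.
      by rewrite ltrBlDl lerBrDl (mulrC x) andbC.
    by rewrite ltrBlDl lerBrDl (mulrC x) andbC.
  rewrite !lebesgue_measure_itv/= !lte_fin uv ltr_nM2r ?invr_lt0// ltrD2r uv.
  rewrite ltr0_norm// -!EFinB -EFinM; congr EFin; field; exact: a0.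
Qed.

Lemma measurable_affine_preimage (a c : R) (F : set R) : measurable F ->
  measurable [set x | F (c + a * x)].
Proof.
move=> mF; rewrite -[X in measurable X]setTI.
have : measurable_fun setT (fun x : R => c + a * x) by mx_measurable.
by apply.
Qed.

Lemma integral_mxL_affine m n (a : R) (C : 'M[R]_(m, n)) (f : 'M[R]_(m, n) -> \bar R) :
  a != 0 -> measurable_fun setT f -> (forall A, 0 <= f A)%E ->
  ((`|a| ^+ (m * n))%:E * \int[mxL R m n]_A f (C + a *: A)%R =
   \int[mxL R m n]_A f A)%E.
Proof.
move=> a0 mf f0.
have na0 : 0 <= `|a| ^+ (m * n) by rewrite exprn_ge0.
rewrite -(ge0_integral_mscale (mxL R m n) measurableT (NngNum na0))//; last first.
  by mx_measurable.
apply/esym/eq_integral_of_boxes => //; last exact: mxL_cube_fin.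
  by mx_measurable.
move=> F mF; rewrite /= /mscale/=.
rewrite (_ : _ @^-1` _ = mx_box (fun i j => [set x | F i j (C i j + a * x)])); last first.
  by apply/seteqP; split=> A AF i j; have := AF i j; rewrite /= !mxE.
rewrite !mxL_box//; last by move=> i j; exact: measurable_affine_preimage.
under eq_bigr => i _ do under eq_bigr => j _ do rewrite lebesgue_measure_affine//.
under eq_bigr => i _ do rewrite big_split/= prodEFin prodr_const card_ord.
rewrite big_split/= prodEFin prodr_const card_ord muleA -EFinM -exprM (mulnC n).
by rewrite -exprMn mulfV ?normr_eq0// expr1n mul1e.
Qed.

(** Shifts and reflections are the cases [a = 1] and [a = -1]; restricting to them avoids the factor
    |a|^(p(p+1)/2). *)
Lemma integral_symL_affine p (a : R) (C : 'M[R]_p) (f : 'M[R]_p -> \bar R) :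
  `|a| = 1 -> C^T = C -> measurable_fun setT f -> (forall A, 0 <= f A)%E ->
  (\int[symL R p]_A f (C + a *: A)%R = \int[symL R p]_A f A)%E.
Proof.
move=> a1 CT mf f0.
have a0 : a != 0 by rewrite -normr_eq0 a1 oner_eq0.
apply/esym/eq_integral_of_boxes => //; last exact: symL_cube_fin.
  by mx_measurable.
move=> F mF.
rewrite (_ : _ @^-1` _ = mx_box (fun i j => [set x | F i j (C i j + a * x)])); last first.
  by apply/seteqP; split=> A AF i j; have := AF i j; rewrite /= !mxE.
rewrite /= !symL_box//; last by move=> i j; exact: measurable_affine_preimage.
apply: eq_bigr => i _; apply: eq_bigr => j _.
have -> : C j i = C i j by rewrite -[in LHS]CT mxE.
have := lebesgue_measure_affine (C i j) a0 (measurableI _ _ (mF i j) (mF j i)).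
by rewrite a1 invr1 mul1e.
Qed.

(** The measure is carried by symmetric matrices, all of which are fixed by the symmetrization
    [phi]. It is therefore invariant under [phi], and after composition with [phi] the two
    integrands coincide. *)
Lemma eq_integral_sym p (f g : 'M[R]_p -> \bar R) :
  measurable_fun setT f -> measurable_fun setT g ->
  (forall A, 0 <= f A)%E -> (forall A, 0 <= g A)%E ->
  (forall A, A^T = A -> f A = g A) ->
  (\int[symL R p]_A f A = \int[symL R p]_A g A)%E.
Proof.
move=> mf mg f0 g0 fg.
pose phi (A : 'M[R]_p) : 'M[R]_p := 2^-1 *: (A + A^T).
have phiT A : (phi A)^T = phi A by rewrite /phi linearZ linearD/= trmxK addrC.
have phi_id A : A^T = A -> phi A = A.
  move=> AT; apply/matrixP => i j; rewrite !mxE.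
  have -> : A j i = A i j by rewrite -[in LHS]AT mxE.
  by field.
have integral_phi h : measurable_fun setT h -> (forall A, 0 <= h A)%E ->
    (\int[symL R p]_A h A = \int[symL R p]_A h (phi A))%E.
  move=> mh h0; apply: eq_integral_of_boxes => //; last exact: symL_cube_fin.
    by rewrite /phi; mx_measurable.
  move=> F mF; rewrite /= -symLE /lebesgue_sym /pushforward.
  congr lebesgue_tuple; apply/seteqP; split=> v; rewrite /= phi_id//.
    by apply/matrixP => i j; rewrite !mxE; case: ltngtP => // /val_inj ->.
  by apply/matrixP => i j; rewrite !mxE; case: ltngtP => // /val_inj ->.
rewrite integral_phi// [RHS]integral_phi//.
by apply: eq_integral => A _; exact: fg.
Qed.

Lemma integral_mxL_trmx m n (f : 'M[R]_(n, m) -> \bar R) :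
  measurable_fun setT f -> (forall A, 0 <= f A)%E ->
  (\int[mxL R m n]_A f A^T = \int[mxL R n m]_A f A)%E.
Proof.
move=> mf f0; apply/esym/eq_integral_of_boxes => //; last exact: mxL_cube_fin.
  by mx_measurable.
move=> F mF; rewrite (_ : _ @^-1` _ = mx_box (fun i j => F j i)); last first.
  by apply/seteqP; split=> A AF i j; have := AF j i; rewrite /= !mxE.
by rewrite /= !mxL_box// exchange_big.
Qed.

Lemma integral_mxL_shift m n (C : 'M[R]_(m, n)) (f : 'M[R]_(m, n) -> \bar R) :
  measurable_fun setT f -> (forall A, 0 <= f A)%E ->
  (\int[mxL R m n]_A f (C + A)%R = \int[mxL R m n]_A f A)%E.
Proof.
move=> mf f0; rewrite -(integral_mxL_affine C (oner_neq0 R) mf f0).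
rewrite normr1 expr1n mul1e; apply: eq_integral => A _.
by rewrite scale1r.
Qed.

Lemma integral_mxL_reflect m n (C : 'M[R]_(m, n)) (f : 'M[R]_(m, n) -> \bar R) :
  measurable_fun setT f -> (forall A, 0 <= f A)%E ->
  (\int[mxL R m n]_A f (C - A)%R = \int[mxL R m n]_A f A)%E.
Proof.
move=> mf f0.
rewrite -(integral_mxL_affine (a := -1) C _ mf f0) ?oppr_eq0 ?oner_eq0//.
rewrite normrN1 expr1n mul1e; apply: eq_integral => A _.
by rewrite scaleN1r.
Qed.

Lemma integral_symL_shift p (C : 'M[R]_p) (f : 'M[R]_p -> \bar R) : C^T = C ->
  measurable_fun setT f -> (forall A, 0 <= f A)%E ->
  (\int[symL R p]_A f (C + A)%R = \int[symL R p]_A f A)%E.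
Proof.
move=> CT mf f0; rewrite -(integral_symL_affine (a := 1) _ CT mf f0) ?normr1//.
by apply: eq_integral => A _; rewrite scale1r.
Qed.

Lemma integral_symL_reflect p (C : 'M[R]_p) (f : 'M[R]_p -> \bar R) : C^T = C ->
  measurable_fun setT f -> (forall A, 0 <= f A)%E ->
  (\int[symL R p]_A f (C - A)%R = \int[symL R p]_A f A)%E.
Proof.
move=> CT mf f0; rewrite -(integral_symL_affine (a := -1) _ CT mf f0) ?normrN1//.
by apply: eq_integral => A _; rewrite scaleN1r.
Qed.
End lebesgue_affine.

(** * Linear substitutions by Gaussian elimination *)

Section lebesgue_linear.
Variable R : realType.

(** This property is multiplicative in [M], so it has to be checked only for the factors of a block
    elimination: shears, which are translations for all but one block of variables, and block
    diagonal matrices. *)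
Let scales n (M : 'M[R]_n) := forall f : 'rV[R]_n -> \bar R,
  measurable_fun setT f -> (forall v, 0 <= f v)%E ->
  (`|\det M|%:E * \int[mxL R 1 n]_v f (v *m M) = \int[mxL R 1 n]_v f v)%E.

Let scalesM n (M N : 'M[R]_n) : scales M -> scales N -> scales (M *m N).
Proof.
move=> sM sN f mf f0; rewrite det_mulmx normrM EFinM -muleA.
under eq_integral do rewrite mulmxA.
rewrite muleCA (sM (fun v => f (v *m N)))// ?sN//.
by mx_measurable.
Qed.

Let scales_lower n (c : 'cV[R]_n) : scales (block_mx (1%:M : 'M[R]_1) 0 c 1%:M).
Proof.
move=> f mf f0; rewrite det_lblock !det1 mulr1 normr1 mul1e.
rewrite !integral_row_mx//; last by mx_measurable.
rewrite integral_swap//; last by mx_measurable.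
rewrite [RHS]integral_swap//; last by mx_measurable.
apply: eq_integral => v _ /=.
rewrite -[RHS](integral_mxL_shift (v *m c))//; last by mx_measurable.
apply: eq_integral => x _; congr f.
by rewrite mul_row_block !mulmx1 mulmx0 add0r addrC.
Qed.

Let scales_upper n (r : 'rV[R]_n) : scales (block_mx (1%:M : 'M[R]_1) r 0 1%:M).
Proof.
move=> f mf f0; rewrite det_ublock !det1 mulr1 normr1 mul1e.
rewrite !integral_row_mx//; last by mx_measurable.
apply: eq_integral => x _ /=.
rewrite -[RHS](integral_mxL_shift (x *m r))//; last by mx_measurable.
apply: eq_integral => v _; congr f.
by rewrite mul_row_block !mulmx1 mulmx0 addr0.
Qed.

Let scales_diag n (a : R) (D : 'M[R]_n) : a != 0 -> scales D ->
  scales (block_mx (a%:M : 'M[R]_1) 0 0 D).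
Proof.
move=> a0 sD f mf f0; rewrite det_lblock det_scalar1 normrM EFinM.
rewrite !integral_row_mx//; last by mx_measurable.
have mF : measurable_fun setT (fun x => \int[mxL R 1 n]_v f (row_mx x v))%E.
  by apply: measurable_integral => //; mx_measurable.
rewrite -(integral_mxL_affine (a := a) 0 _ mF)//; last first.
  by move=> x; exact: integral_ge0.
rewrite mul1n expr1 -muleA; congr (_ * _)%E.
rewrite -ge0_integralZl//; last 2 first.
- by apply: measurable_integral => //; mx_measurable.
- by move=> x _; exact: integral_ge0.
apply: eq_integral => x _.
rewrite -(sD (fun v => f (row_mx (0 + a *: x)%R v)))//; last by mx_measurable.
congr (_ * _)%E; apply: eq_integral => v _; congr f.
by rewrite mul_row_block !mulmx0 addr0 !add0r mul_mx_scalar.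
Qed.

Lemma integral_mulmxr_row n (M : 'M[R]_n) (f : 'rV[R]_n -> \bar R) :
  M \in unitmx -> measurable_fun setT f -> (forall v, 0 <= f v)%E ->
  (`|\det M|%:E * \int[mxL R 1 n]_v f (v *m M) = \int[mxL R 1 n]_v f v)%E.
Proof.
move=> uM; move: f; rewrite -/(scales M).
elim: n M uM => [|n IH] M uM.
  move=> f mf f0; rewrite det_mx00 normr1 mul1e.
  by apply: eq_integral => v _; rewrite [v *m M]thinmx0 [v]thinmx0.
(* A nonzero corner entry allows the factorization lower shear, diagonal, upper shear; the Schur
   complement [D] falls under the induction hypothesis. *)
have pivot (N : 'M[R]_(1 + n)) : N \in unitmx -> N ord0 ord0 != 0 -> scales N.
  move=> uN N0; pose a := N ord0 ord0.
  pose r := ursubmx N; pose c := dlsubmx N; pose D := drsubmx N - a^-1 *: (c *m r).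
  have ulN : ulsubmx N = a%:M.
    by rewrite [LHS]mx11_scalar; congr (_%:M); rewrite !mxE; congr (N _ _); exact: val_inj.
  have NE : N = block_mx (1%:M : 'M[R]_1) 0 (a^-1 *: c) 1%:M *m
      (block_mx (a%:M : 'M[R]_1) 0 0 D *m block_mx (1%:M : 'M[R]_1) (a^-1 *: r) 0 1%:M).
    rewrite !mulmx_block !mul1mx !mulmx1 !mul0mx !mulmx0 !addr0 !add0r.
    rewrite mul_scalar_mx scalerA mulfV// scale1r mul_mx_scalar scalerA mulfV// scale1r.
    by rewrite -scalemxAl /D addrC subrK -ulN submxK.
  have uD : D \in unitmx.
    move: uN; rewrite NE !unitmx_mul => /and3P[_ + _].
    by rewrite unitmxE det_lblock unitrM => /andP[_]; rewrite -unitmxE.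
  rewrite NE; apply: scalesM; first exact: scales_lower.
  by apply: scalesM; [apply: scales_diag => //; exact: IH|exact: scales_upper].
have [M0|] := eqVneq (M ord0 ord0) 0; last exact: pivot.
have [i Mi0] : exists i, M (rshift 1 i) ord0 != 0.
  apply: contrapT => /forallNP Mi0.
  have: \det (M : 'M[R]_(1 + n)) = 0.
    rewrite (expand_det_col _ ord0) big1// => k _.
    case: (split_ordP (k : 'I_(1 + n))) => j ->.
      by rewrite (ord1 j) (_ : lshift n ord0 = ord0) ?M0 ?mul0r//; exact: val_inj.
    by have /negP := Mi0 j; rewrite negbK => /eqP ->; rewrite mul0r.
  by move/eqP; rewrite -[_ == 0]negbK -unitfE -unitmxE uM.
(* Adding row [i] of the lower part to the first row produces a nonzero pivot. *)
pose e : 'rV[R]_n := delta_mx ord0 i.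
have -> : M = block_mx (1%:M : 'M[R]_1) (- e) 0 1%:M *m
    (block_mx (1%:M : 'M[R]_1) e 0 1%:M *m M).
  rewrite mulmxA mulmx_block !mul1mx !mulmx1 !mul0mx !mulmx0 !addr0 add0r subrr.
  by rewrite -scalar_mx_block mul1mx.
apply: scalesM; first exact: scales_upper.
apply: pivot.
  rewrite unitmx_mul uM andbT unitmxE det_ublock !det1 mulr1; exact: unitr1.
have l0 : (ord0 : 'I_(1 + n)) = lshift n (ord0 : 'I_1) by exact: val_inj.
have lr j : lift (ord0 : 'I_(1 + n)) j = rshift 1 (j : 'I_n) by exact: val_inj.
rewrite mxE big_ord_recl M0 mulr0 add0r (bigD1 i)//= big1 ?addr0; last first.
  by move=> j ji; rewrite lr l0 block_mxEur mxE eqxx/= (negbTE ji) mul0r.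
by rewrite lr [X in block_mx _ _ _ _ X]l0 block_mxEur mxE !eqxx mul1r.
Qed.

Lemma integral_mulmxr m n (M : 'M[R]_n) (f : 'M[R]_(m, n) -> \bar R) :
  M \in unitmx -> measurable_fun setT f -> (forall A, 0 <= f A)%E ->
  ((`|\det M| ^+ m)%:E * \int[mxL R m n]_A f (A *m M) =
   \int[mxL R m n]_A f A)%E.
Proof.
move=> uM; elim: m f => [|m IH] f mf f0.
  rewrite expr0 mul1e; apply: eq_integral => A _.
  by rewrite [A *m M]flatmx0 [A]flatmx0.
rewrite -[m.+1]/(1 + m)%N in f mf f0 *.
rewrite !integral_col_mx//; last by mx_measurable.
rewrite exprS EFinM -muleA -ge0_integralZl//; last 2 first.
- by apply: measurable_integral => //; mx_measurable.
- by move=> x _; exact: integral_ge0.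
rewrite -[RHS](integral_mulmxr_row uM)//; last 2 first.
- by apply: measurable_integral => //; mx_measurable.
- by move=> x; exact: integral_ge0.
congr (_ * _)%E; apply: eq_integral => v _.
rewrite -[RHS]IH//; last by mx_measurable.
by congr (_ * _)%E; apply: eq_integral => A _; rewrite mul_col_mx.
Qed.
End lebesgue_linear.

Lemma integral_mrestr d (T : measurableType d) (R : realType)
    (mu : {measure set T -> \bar R}) (D : set T) (mD : measurable D) (f : T -> \bar R) :
  measurable_fun setT f -> (forall x, 0 <= f x)%E ->
  (\int[mrestr mu mD]_x f x = \int[mu]_(x in D) f x)%E.
Proof.
move=> mf f0; rewrite -(setUv D) ge0_integral_setU//=; last 3 first.
- exact: measurableC.
- exact: measurable_funTS.
- by apply/disj_setPCl.
rewrite [X in (_ + X)%E](_ : _ = 0%E).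
  rewrite adde0; apply: eq_measure_integral => A mA AD.
  by rewrite /= /mrestr setIidl.
apply: null_set_integral => //=; [exact: measurableC| |].
- exact: measurable_funTS.
- by rewrite /= /mrestr setICl measure0.
Qed.

(* The measure is the image of [mu \x lebesgue_measure] restricted to the
   subgraph of [g], so that no approximation by simple functions is needed. *)
Lemma density_measure d d' (X : measurableType d) (Y : measurableType d')
    (R : realType) (mu : {sigma_finite_measure set X -> \bar R})
    (g : X -> R) (phi : X -> Y) :
  measurable_fun setT g -> (forall x, 0 <= g x) -> measurable_fun setT phi ->
  exists m : {measure set Y -> \bar R}, forall f : Y -> \bar R,
    measurable_fun setT f -> (forall y, 0 <= f y)%E ->
    (\int[m]_y f y = \int[mu]_x (f (phi x) * (g x)%:E))%E.
Proof.
move=> mg g0 mphi.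
pose S : set (X * measurableTypeR R) := [set z | 0 <= z.2 < g z.1].
have mS : measurable S.
  rewrite (_ : S = (fun z => (0 <= z.2 :> R) && (z.2 < g z.1)) @^-1` [set true]).
    rewrite -[X in measurable X]setTI.
    have : measurable_fun [set: X * measurableTypeR R]
        (fun z => (0 <= (z.2 : R)) && (z.2 < g z.1)).
      apply: measurable_and.
        by apply: measurable_fun_ler; [exact: measurable_cst|exact: measurable_snd].
      apply: measurable_fun_ltr; first exact: measurable_snd.
      by apply: measurableT_comp mg _; exact: measurable_fst.
    by apply.
  by apply/seteqP; split=> z.
have mphi1 : measurable_fun [set: X * measurableTypeR R] (fun z => phi z.1).
  by apply: measurableT_comp mphi _; exact: measurable_fst.
pose m : {measure set Y -> \bar R} :=
  measure_function_pushforward__canonical__measure_function_Measure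
    (mrestr (mu \x (@lebesgue_measure R))%E mS) mphi1.
exists m => f mf f0; have mfphi := measurableT_comp mf mphi1.
rewrite /m ge0_integral_pushforward// preimage_setT integral_mrestr//=.
rewrite integral_mkcond integral_prod//; last 2 first.
- apply/(measurable_restrictT _ mS); exact: measurable_funTS mfphi.
- by move=> z; rewrite patchE; case: ifP => // _; exact: f0.
apply: eq_integral => x _.
rewrite (_ : (fun y => _) = (fun y => f (phi x) * (\1_`[0%R, g x[%classic y)%:E)%E).
  rewrite ge0_integralZl//; last by apply/measurable_EFinP; exact: measurable_indic.
  rewrite integral_indic//= setIT lebesgue_measure_itv/= lte_fin.
  by case: ltgtP (g0 x) => // [gx|<-] _; rewrite ?sube0.
apply/funext => y; rewrite patchE indicE /=.
rewrite (_ : ((x, y) \in S) = (y \in `[0%R, g x[%classic)).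
  by case: ifP; rewrite ?mule1 ?mule0.
by apply/idP/idP; rewrite !inE /S/= in_itv.
Qed.

(** * One-dimensional substitution *)

Section substitution.
Variable R : realType.
Local Notation lam := (@lebesgue_measure R).
Variables phi dphi : R -> R.
Hypothesis mphi : measurable_fun setT phi.
Hypothesis mdphi : measurable_fun setT dphi.

Section segment.
Variables u v : R.
Hypothesis uv : u < v.
Hypothesis dphiE : forall x, x \in `[u, v] -> is_derive x 1 phi (dphi x).
Hypothesis cdphi : forall x, x \in `[u, v] -> {for x, continuous dphi}.
Hypothesis dphi_gt0 : forall x, x \in `[u, v] -> 0 < dphi x.

Let cphi x : x \in `[u, v] -> {for x, continuous phi}.
Proof.
move=> /dphiE[dx _]; exact/differentiable_continuous/derivable1_diffP.
Qed.

Let dphi1 x : x \in `[u, v] -> derive1 phi x = dphi x.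
Proof. by move=> /dphiE dx; rewrite derive1E derive_val. Qed.

Lemma substitution_lt : {in `[u, v] &, {homo phi : x y / x < y}}.
Proof.
have sub x : x \in `]u, v[ -> x \in `[u, v] by apply: subset_itv_oo_cc.
apply: gtr0_derive1_lt_cc.
- by move=> x /sub /dphiE[].
- by move=> x /sub xuv; rewrite dphi1// dphi_gt0.
- by apply: continuous_in_subspaceT => x; rewrite inE; exact: cphi.
Qed.

Let phi_le : {in `[u, v] &, {homo phi : x y / x <= y}}.
Proof.
by move=> x y xuv yuv; rewrite le_eqVlt => /predU1P[->//|]; move=> /substitution_lt; move/(_ xuv yuv)/ltW.
Qed.

Let integral_dphi x : x \in `[u, v] ->
  (\int[lam]_(t in `]x, v]) (dphi t)%:E = (phi v - phi x)%:E)%E.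
Proof.
move=> xuv; move: (xuv); rewrite in_itv/= => /andP[ux]; rewrite le_eqVlt => /predU1P[->|xv].
  by rewrite set_itvoc0 integral_set0 subrr.
have sub t : t \in `[x, v] -> t \in `[u, v].
  by rewrite !in_itv/= => /andP[xt ->]; rewrite (le_trans ux xt).
rewrite integral_itv_obnd_cbnd; last first.
  exact/measurable_EFinP/measurable_funTS.
rewrite (@continuous_FTC2 _ dphi phi)// ?EFinB//.
- by apply: continuous_in_subspaceT => t; rewrite inE => /sub; exact: cdphi.
- split.
  + by move=> t /subset_itv_oo_cc/sub/dphiE[].
  + by apply: cvg_at_right_filter; apply: cphi.
  + by apply: cvg_at_left_filter; apply: cphi; rewrite in_itv/= lexx andbT ltW.
- by move=> t /subset_itv_oo_cc/sub/dphi1.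
Qed.

(** Both sides integrate [f] against a measure on the line. The left one is the image under [phi] of
    the measure with density [dphi] on the segment. The two measures are compared on the rays []y,
    +oo[], where the fundamental theorem of calculus computes the left one. *)
Lemma substitution_segment (f : R -> \bar R) : measurable_fun setT f ->
  (forall y, 0 <= f y)%E ->
  (\int[lam]_(x in `[u, v]) (f (phi x) * (dphi x)%:E) =
   \int[lam]_(y in `[phi u, phi v]) f y)%E.
Proof.
move=> mf f0.
have uuv : u \in `[u, v] by rewrite in_itv/= lexx ltW.
have vuv : v \in `[u, v] by rewrite in_itv/= lexx ltW.
pose g x := dphi x * \1_`[u, v]%classic x.
have mg : measurable_fun setT g.
  by apply: measurable_funM => //; exact: measurable_indic.
have g0 x : 0 <= g x.
  rewrite /g indicE; case: (boolP (_ \in _)); rewrite ?mulr0// mulr1 inE => xuv.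
  exact/ltW/dphi_gt0.
have restr h : (\int[lam]_x (h x * (g x)%:E) =
    \int[lam]_(x in `[u, v]) (h x * (dphi x)%:E))%E.
  rewrite [RHS]integral_mkcond; apply: eq_integral => x _; rewrite patchE /g indicE.
  by case: ifP => _; rewrite ?mulr1 ?mulr0 ?mule0.
have [m mE] := @density_measure _ _ (measurableTypeR R) (measurableTypeR R) R lam g phi mg g0 mphi.
rewrite -restr -mE//.
rewrite -(integral_mrestr lam (measurable_itv `[phi u, phi v]))//.
apply: eq_measure_integral => A mA _.
pose gR (k : nat) : set R := `]- k%:R, +oo[%classic.
have mray y : m `]y, +oo[%classic = mrestr lam (measurable_itv `[phi u, phi v]) `]y, +oo[%classic.
  have my : measurable (`]y, +oo[%classic : set R) by exact: measurable_itv.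
  rewrite -[X in m X]setIT -[LHS]integral_indic// mE//=; last first.
    by apply/measurable_EFinP; exact: measurable_indic.
  rewrite restr /mrestr.
  rewrite (_ : (fun x => _) = (EFin \o dphi) \_ [set x | y < phi x]); last first.
    apply/funext => x; rewrite patchE indicE.
    rewrite (_ : (phi x \in `]y, +oo[%classic) = (x \in [set x | y < phi x])).
      by case: ifP; rewrite ?mul1e ?mul0e.
    by apply/idP/idP; rewrite !inE/= in_itv/= andbT.
  rewrite -integral_mkcondr.
  (* Three positions of [y]: below the image of the segment, above it, or inside, where [y = phi x0]
     by the intermediate value theorem. *)
  have [yu|uy] := ltP y (phi u).
    rewrite [X in integral _ X](_ : _ = `[u, v]%classic); last first.
      apply/seteqP; split=> [x []//|x xuv]; split=> //=.
      by rewrite (lt_le_trans yu)// phi_le//; move: xuv; rewrite /= in_itv/= => /andP[].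
    rewrite [X in lam X](_ : _ = `[phi u, phi v]%classic); last first.
      apply/seteqP; split=> [x []//|x xuv]; split=> //=; rewrite in_itv/= andbT.
      by rewrite (lt_le_trans yu)//; move: xuv; rewrite /= in_itv/= => /andP[].
    rewrite -integral_itv_obnd_cbnd; last exact/measurable_EFinP/measurable_funTS.
    by rewrite integral_dphi// lebesgue_measure_itv/= lte_fin substitution_lt.
  have [vy|yv] := leP (phi v) y.
    rewrite [X in integral _ X](_ : _ = set0); last first.
      apply/seteqP; split=> [x [xuv /=]|x []//]; rewrite ltNge => /negP; apply.
      by rewrite (le_trans _ vy)// phi_le//; move: xuv; rewrite /= in_itv/= => /andP[].
    rewrite [X in lam X](_ : _ = set0) ?measure0 ?integral_set0//.
    apply/seteqP; split=> [x []|x []//]; rewrite /= !in_itv/= andbT => yx /andP[_ xv].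
    by have := lt_le_trans yx (le_trans xv vy); rewrite ltxx.
  have [||x0 x0uv <-] := @IVT R phi u v y (ltW uv).
  - by apply: continuous_in_subspaceT => t; rewrite inE; exact: cphi.
  - rewrite (min_idPl _) ?(max_idPr _) ?uy ?(ltW yv)//; exact/ltW/substitution_lt.
  rewrite [X in integral _ X](_ : _ = `]x0, v]%classic); last first.
    apply/seteqP; split=> x.
      move=> [/=]; rewrite !in_itv/= => /andP[ux xv] x0x; rewrite xv andbT ltNge.
      apply/negP => xx0; move: x0x; rewrite ltNge phi_le// in_itv/= ux xv//.
    move: (x0uv); rewrite /= !in_itv/= => /andP[ux0 _] /andP[x0x xv].
    have xuv : x \in `[u, v] by rewrite in_itv/= xv (le_trans ux0 (ltW x0x)).
    by split=> //=; exact: substitution_lt.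
  rewrite integral_dphi//.
  rewrite [X in lam X](_ : _ = `]phi x0, phi v]%classic); last first.
    apply/seteqP; split=> x /=; rewrite !in_itv/= andbT.
      by move=> [-> /andP[_ ->]].
    move=> /andP[x0x ->]; split=> //; rewrite andbT (le_trans _ (ltW x0x))// phi_le//.
    by move: x0uv; rewrite in_itv/= => /andP[].
  rewrite lebesgue_measure_itv/= lte_fin.
  have [//|] := ltP (phi x0) (phi v).
  by move=> vx0; rewrite (_ : phi x0 = phi v) ?subrr//; apply/eqP; rewrite eq_le vx0 phi_le//; move: x0uv; rewrite in_itv/= => /andP[].
apply: (@measure_unique _ R (measurableTypeR R) (@RGenOInfty.G R) gR) => //.
- exact: RGenOInfty.measurableE.
- move=> _ _ [x ->] [y ->]; exists (Num.max x y); apply/seteqP; split=> z /=.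
    by rewrite !in_itv/= !andbT gt_max => -[-> ->].
  by rewrite !in_itv/= !andbT gt_max => /andP[].
- by move=> k; exists (- k%:R).
- apply/seteqP; split=> // x _; exists (Num.truncn `|x|).+1 => //=.
  rewrite /gR/= in_itv/= andbT ltrNl (le_lt_trans _ (truncnS_gt _))//.
  by rewrite -normrN ler_norm.
- by move=> _ [y ->]; exact: mray.
- move=> k; rewrite /gR mray /mrestr/=.
  rewrite (@le_lt_trans _ _ (lam `[phi u, phi v]%classic))//.
    rewrite le_measure// ?inE//; apply: measurableI; exact: measurable_itv.
  by rewrite lebesgue_measure_itv/=; case: ifP; rewrite ?ltry.
Qed.
End segment.

(** Monotone convergence over growing segments. As [f] is supported in the image of [D], that image
    need not be determined. *)
Lemma substitution_exhaustion (D : set R) (u v : nat -> R) (f : R -> \bar R) :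
  (forall k, u k < v k) -> nondecreasing_seq (fun k => `[u k, v k]%classic) ->
  D = \bigcup_k `[u k, v k]%classic ->
  (forall x, D x -> is_derive x 1 phi (dphi x)) ->
  (forall x, D x -> {for x, continuous dphi}) ->
  (forall x, D x -> 0 < dphi x) ->
  measurable_fun setT f -> (forall y, 0 <= f y)%E ->
  (forall y, f y != 0%E -> exists2 x, D x & phi x = y) ->
  (\int[lam]_(x in D) (f (phi x) * (dphi x)%:E) = \int[lam]_y f y)%E.
Proof.
move=> uv nduv DE dphiE cdphi dphi_gt0 mf f0 fD.
have subD k x : x \in `[u k, v k] -> D x by move=> xuv; rewrite DE; exists k.
have lt_phi k : {in `[u k, v k] &, {homo phi : x y / x < y}}.
  by apply: substitution_lt => x /subD; [exact: dphiE|exact: dphi_gt0].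
have le_phi k : {in `[u k, v k] &, {homo phi : x y / x <= y}}.
  move=> x y xuv yuv; rewrite le_eqVlt => /predU1P[->//|].
  by move=> /(lt_phi _ _ _ xuv yuv)/ltW.
have ukv k : u k \in `[u k, v k] by rewrite in_itv/= lexx ltW.
have vkv k : v k \in `[u k, v k] by rewrite in_itv/= lexx ltW.
have mfphi : measurable_fun setT (fun x => f (phi x) * (dphi x)%:E)%E.
  apply: emeasurable_funM; first exact: (measurableT_comp mf mphi).
  exact/measurable_EFinP.
have -> : (\int[lam]_y f y)%E = (\int[lam]_(y in \bigcup_k `[phi (u k), phi (v k)]%classic) f y)%E.
  rewrite [RHS]integral_mkcond; apply: eq_integral => y _; rewrite patchE.
  case: ifPn => // /negP ynD; apply/eqP/negPn/negP => /fD[x]; rewrite DE => -[k _ xuv] xy.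
  apply: ynD; rewrite inE; exists k => //=; rewrite in_itv/= -xy.
  by rewrite !(le_phi k)//; move: xuv; rewrite /= in_itv/= => /andP[].
rewrite DE.
have cv1 := @ge0_nondecreasing_set_cvg_integral _ (measurableTypeR R) R
  (fun k => `[u k, v k]%classic) (fun x => f (phi x) * (dphi x)%:E)%E lam nduv.
have nduv' : nondecreasing_seq (fun k => `[phi (u k), phi (v k)]%classic).
  move=> j k jk; apply/subsetPset => y /=; rewrite !in_itv/= => /andP[uy yv].
  have /subsetPset sub := nduv _ _ jk.
  have ujk : u j \in `[u k, v k] by exact: sub (ukv j).
  have vjk : v j \in `[u k, v k] by exact: sub (vkv j).
  have uuj : u k <= u j by move: ujk; rewrite in_itv/= => /andP[].
  have vvj : v j <= v k by move: vjk; rewrite in_itv/= => /andP[].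
  rewrite (le_trans (le_phi k _ _ (ukv k) ujk uuj) uy)/=.
  exact: le_trans yv (le_phi k _ _ vjk (vkv k) vvj).
have cv2 := @ge0_nondecreasing_set_cvg_integral _ (measurableTypeR R) R
  (fun k => `[phi (u k), phi (v k)]%classic) f lam nduv'.
have e : (fun k => \int[lam]_(x in `[u k, v k]) (f (phi x) * (dphi x)%:E))%E =
         (fun k => \int[lam]_(y in `[phi (u k), phi (v k)]) f y)%E.
  apply/funext => k; apply: substitution_segment => // x /subD.
  - exact: dphiE.
  - exact: cdphi.
  - exact: dphi_gt0.
rewrite e in cv1.
apply: (cvg_unique (@ereal_hausdorff R) (cv1 _ _ _) (cv2 _ _ _)).
- by move=> k; exact: measurable_itv.
- by move=> k; exact: measurable_funTS.
- by move=> k x /subD Dx; rewrite mule_ge0// lee_fin ltW// dphi_gt0.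
- by move=> k; exact: measurable_itv.
- by move=> k; exact: measurable_funTS.
- by move=> k x _; exact: f0.
Qed.

(** Such a set is either the whole line or an open ray starting at its infimum. *)
Lemma upclosed_exhaustion (D : set R) : D !=set0 ->
  (forall x y, D x -> x <= y -> D y) -> (forall x, D x -> exists2 y, y < x & D y) ->
  exists u v : nat -> R, [/\ forall k, u k < v k,
    nondecreasing_seq (fun k => `[u k, v k]%classic) &
    D = \bigcup_k `[u k, v k]%classic].
Proof.
move=> [d Dd] up op.
have [[c cD]|noc] := pselect (exists c, lbound D c); last first.
  exists (fun k => - k.+1%:R), (fun k => k.+1%:R); split.
  - by move=> k; rewrite -subr_gt0 opprK -natrD ltr0n.
  - move=> j k jk; apply/subsetPset/subset_itv; rewrite bnd_simp ?lerN2 ?ler_nat//.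
  - have DT x : D x.
      apply: contrapT => nDx; apply: noc; exists x => y Dy.
      by rewrite leNgt; apply/negP => yx; apply: nDx; exact: up Dy (ltW yx).
    apply/seteqP; split=> // x _; exists (Num.truncn `|x|) => //=.
    by rewrite in_itv/= -ler_norml; exact/ltW/truncnS_gt.
have hi : has_inf D by split; [exists d|exists c].
pose i := inf D.
have iD x : D x -> i < x.
  by move=> /op[y yx Dy]; rewrite (le_lt_trans _ yx)//; exact: (ge_inf hi.2 Dy).
have Di x : i < x -> D x.
  by move=> /(inf_lt hi.1)[y Dy yx]; exact: up Dy (ltW yx).
exists (fun k => i + k.+1%:R^-1), (fun k => i + k.+2%:R); split.
- move=> k; rewrite ltrD2l (@le_lt_trans _ _ 1)//; last by rewrite ltr1n.
  by rewrite invf_le1 ?ler1n ?ltr0n.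
- move=> j k jk; apply/subsetPset/subset_itv; rewrite bnd_simp lerD2l ?ler_nat//.
  by rewrite lef_pV2 ?posrE ?ltr0n// ler_nat.
- apply/seteqP; split=> x.
    move=> /iD; rewrite -subr_gt0 => ix.
    pose K := maxn (Num.truncn (x - i)) (Num.truncn (x - i)^-1).
    exists K => //=; rewrite in_itv/= -lerBrDl -[(x <= _)]lerBlDl; apply/andP; split.
      rewrite -[leRHS]invrK lef_pV2 ?posrE ?ltr0n ?invr_gt0//.
      apply/ltW; apply: (lt_le_trans (truncnS_gt _)).
      by rewrite ler_nat ltnS leq_maxr.
    apply/ltW; apply: (lt_le_trans (truncnS_gt _)).
    by rewrite ler_nat ltnS (leq_trans (leq_maxl _ _) (leqnSn _)).
  move=> [k _]; rewrite /= in_itv/= => /andP[ikx _]; apply: Di.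
  by rewrite (lt_le_trans _ ikx)// ltrDl invr_gt0 ltr0n.
Qed.

Lemma substitution_upclosed (D : set R) (f : R -> \bar R) :
  (forall x y, D x -> x <= y -> D y) -> (forall x, D x -> exists2 y, y < x & D y) ->
  (forall x, D x -> is_derive x 1 phi (dphi x)) ->
  (forall x, D x -> {for x, continuous dphi}) ->
  (forall x, D x -> 0 < dphi x) ->
  measurable_fun setT f -> (forall y, 0 <= f y)%E ->
  (forall y, f y != 0%E -> exists2 x, D x & phi x = y) ->
  (\int[lam]_(x in D) (f (phi x) * (dphi x)%:E) = \int[lam]_y f y)%E.
Proof.
move=> up op ? ? ? ? ? fD.
have [D0|] := eqVneq D set0.
  rewrite D0 integral_set0 (_ : f = cst 0%E) ?integral0//.
  by apply/funext => y; apply: contrapT => /eqP /fD[x]; rewrite D0.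
by move=> /set0P /upclosed_exhaustion /(_ up op) [u [v [uv nd DE]]]; exact: substitution_exhaustion nd DE _ _ _ _ _ _.
Qed.
End substitution.

Section scalar_matrices.
Variable R : realType.
Local Notation lam := (@lebesgue_measure R).

Lemma integral_mxL11 (f : 'M[R]_1 -> \bar R) :
  measurable_fun setT f -> (forall c, 0 <= f c)%E ->
  (\int[mxL R 1 1]_c f c = \int[lam]_x f (x : R)%:M)%E.
Proof.
move=> mf f0.
apply: (@eq_integral_of_boxes R _ (measurableTypeR R) lam 1 1 _ (fun x : R => x%:M)) => //.
- by apply: measurable_scalar_mx; exact: measurable_id.
- move=> F mF; rewrite /= mxL_box// !big_ord1; congr lebesgue_measure.
  apply/seteqP; split=> x /=; first by move=> /(_ ord0 ord0); rewrite mxE eqxx mulr1n.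
  by move=> xF i j; rewrite !ord1 mxE eqxx mulr1n.
- exact: mxL_cube_fin.
Qed.

(** With s = c^2 one has ds = 2 |c| dc on each half line, and the two signs of [c] absorb the factor
    2. *)
Lemma integral_mxL11_sqr (f : 'M[R]_1 -> \bar R) :
  measurable_fun setT f -> (forall c, 0 <= f c)%E ->
  (\int[mxL R 1 1]_c (`|c ord0 ord0|%:E * f (c *m c)) =
   \int[mxL R 1 1]_c ((0 < c ord0 ord0)%R%:R%:E * f c))%E.
Proof.
move=> mf f0.
have mpos : measurable_fun setT (fun c : 'M[R]_1 => ((0 < c ord0 ord0)%R)%:R : R).
  apply: (measurableT_comp (f := fun b : bool => b%:R : R)) => //.
  by apply: measurable_fun_ltr => //; exact: measurable_mx_entry.
pose h (c : 'M[R]_1) := (((0 < c ord0 ord0)%R%:R%:E) * (`|c ord0 ord0|%:E * f (c *m c)))%E.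
have mh : measurable_fun setT h by rewrite /h; mx_measurable.
have h0 c : (0 <= h c)%E by rewrite /h !mule_ge0 ?lee_fin.
(* [h] is the integrand on positive [c] and its reflection is the one on negative [c]; at 0 the
   factor [|c|] vanishes. *)
transitivity (\int[mxL R 1 1]_c (h c + h (0 - c)%R))%E.
  apply: eq_integral => c _; rewrite /h sub0r mulmxN mulNmx opprK !mxE normrN oppr_gt0.
  by case: ltgtP => [_|_|<-]; rewrite ?mul1e ?mul0e ?add0e ?adde0// normr0 !mul0e.
rewrite ge0_integralD//; last by mx_measurable.
rewrite (integral_mxL_reflect 0 mh h0) -mule2n -mule_natl -ge0_integralZl//.
rewrite !integral_mxL11//; last 4 first.
- by mx_measurable.
- by move=> c; rewrite mule_ge0.
- by mx_measurable.
- by move=> c; rewrite mule_ge0.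
pose g (y : R) := ((0 < y)%R%:R%:E * f y%:M)%E.
have mg : measurable_fun setT g.
  have : measurable_fun setT (fun y : R => ((0 < (y%:M : 'M[R]_1) ord0 ord0)%R%:R%:E * f y%:M)%E).
    by mx_measurable; apply: (measurableT_comp mpos); mx_measurable.
  by apply: eq_measurable_fun => y _; rewrite mxE eqxx mulr1n.
transitivity (\int[lam]_(y in [set x : R | (0 < x)%R]) (g (y ^+ 2)%R * (2 * y)%:E))%E.
  rewrite [RHS]integral_mkcond; apply: eq_integral => x _; rewrite patchE /h.
  have [x0|x0] := ltP 0 x; last first.
    rewrite memNset /= ?mxE ?eqxx ?mulr1n; first by rewrite ltNge x0 !mul0e mule0.
    by rewrite ltNge x0.
  rewrite mem_set//= !mxE eqxx mulr1n x0 -scalar_mxM -expr2 /g exprn_gt0// !mul1e.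
  by rewrite muleA -EFinM gtr0_norm// muleC.
have dsq (x : R) : is_derive x 1 (fun y : R => y ^+ 2) (2 * x).
  have := is_deriveM (is_derive_id x (1 : R)) (is_derive_id x (1 : R)).
  rewrite (_ : id * id = fun y : R => y ^+ 2); last by apply/funext => y; rewrite expr2.
  by rewrite (_ : _ + _ = 2 * x)// mulr_natl mulr2n /GRing.scale/= mulr1.
transitivity (\int[lam]_y g y)%E; last first.
  by apply: eq_integral => y _; rewrite mxE eqxx mulr1n.
apply: (@substitution_upclosed R (fun y => y ^+ 2) (fun y => 2 * y) _ _ [set x | 0 < x]) => //.
- by apply: measurable_funM; [exact: measurable_cst|exact: measurable_id].
- by move=> x y /= x0 xy; exact: lt_le_trans x0 xy.
- by move=> x /= x0; exists (x / 2); rewrite ?divr_gt0// ltr_pdivrMr// ltr_pMr// ltr1n.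
- by move=> x _; apply: cvgM; [exact: cvg_cst|exact: cvg_id].
- by move=> x /= x0; rewrite mulr_gt0.
- by move=> y; rewrite /g mule_ge0 ?lee_fin.
- move=> y; rewrite /g; case: ltP => [y0 _|_]; last by rewrite mul0e eqxx.
  by exists (Num.sqrt y); rewrite /= ?sqrtr_gt0// sqr_sqrtr// ltW.
Qed.
End scalar_matrices.

Section tonelli3.
Context d1 d2 d3 (T1 : measurableType d1) (T2 : measurableType d2)
  (T3 : measurableType d3) (R : realType).
Variables (m1 : {sigma_finite_measure set T1 -> \bar R})
  (m2 : {sigma_finite_measure set T2 -> \bar R})
  (m3 : {sigma_finite_measure set T3 -> \bar R}).
Variable f : T1 -> T2 -> T3 -> \bar R.
Hypothesis mf : measurable_fun setT (fun x => f x.1 x.2.1 x.2.2).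
Hypothesis f0 : forall x y z, (0 <= f x y z)%E.

Let mf' d (T : measurableType d) (g1 : T -> T1) (g2 : T -> T2) (g3 : T -> T3) :
  measurable_fun setT g1 -> measurable_fun setT g2 -> measurable_fun setT g3 ->
  measurable_fun setT (fun t => f (g1 t) (g2 t) (g3 t)).
Proof.
move=> mg1 mg2 mg3.
apply: (measurableT_comp (f := fun x => f x.1 x.2.1 x.2.2) mf (g := fun t => (g1 t, (g2 t, g3 t)))).
by mx_measurable.
Qed.

Lemma integral_swap23 :
  (\int[m1]_x \int[m2]_y \int[m3]_z f x y z = \int[m1]_x \int[m3]_z \int[m2]_y f x y z)%E.
Proof.
by apply: eq_integral => x _; apply: integral_swap => //; apply: mf'; mx_measurable.
Qed.

Lemma integral_swap12 :
  (\int[m1]_x \int[m2]_y \int[m3]_z f x y z = \int[m2]_y \int[m1]_x \int[m3]_z f x y z)%E.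
Proof.
apply: integral_swap; last by move=> x y; exact: integral_ge0.
by apply: (measurable_integral (fun x z => f x.1 x.2 z)) => //; apply: mf'; mx_measurable.
Qed.
End tonelli3.
Arguments integral_swap23 {d1 d2 d3 T1 T2 T3 R m1 m2 m3} f.
Arguments integral_swap12 {d1 d2 d3 T1 T2 T3 R m1 m2 m3} f.

Lemma integral_rotl d1 d2 d3 (T1 : measurableType d1) (T2 : measurableType d2)
    (T3 : measurableType d3) (R : realType)
    (m1 : {sigma_finite_measure set T1 -> \bar R})
    (m2 : {sigma_finite_measure set T2 -> \bar R})
    (m3 : {sigma_finite_measure set T3 -> \bar R}) (f : T1 -> T2 -> T3 -> \bar R) :
  measurable_fun setT (fun x => f x.1 x.2.1 x.2.2) ->
  (forall x y z, (0 <= f x y z)%E) ->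
  (\int[m1]_x \int[m2]_y \int[m3]_z f x y z = \int[m2]_y \int[m3]_z \int[m1]_x f x y z)%E.
Proof.
move=> mf f0; rewrite integral_swap12//; apply: (integral_swap23 (fun y x z => f x y z)) => //.
apply: (measurableT_comp mf (g := fun t => (t.2.1, (t.1, t.2.2)))); mx_measurable.
Qed.
Arguments integral_rotl {d1 d2 d3 T1 T2 T3 R m1 m2 m3} f.

Lemma integral_rev d1 d2 d3 (T1 : measurableType d1) (T2 : measurableType d2)
    (T3 : measurableType d3) (R : realType)
    (m1 : {sigma_finite_measure set T1 -> \bar R})
    (m2 : {sigma_finite_measure set T2 -> \bar R})
    (m3 : {sigma_finite_measure set T3 -> \bar R}) (f : T1 -> T2 -> T3 -> \bar R) :
  measurable_fun setT (fun x => f x.1 x.2.1 x.2.2) ->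
  (forall x y z, (0 <= f x y z)%E) ->
  (\int[m1]_x \int[m2]_y \int[m3]_z f x y z = \int[m3]_z \int[m2]_y \int[m1]_x f x y z)%E.
Proof.
move=> mf f0; rewrite integral_rotl//; apply: (integral_swap12 (fun y z x => f x y z)) => //.
apply: (measurableT_comp mf (g := fun t => (t.2.2, (t.1, t.2.1)))); mx_measurable.
Qed.
Arguments integral_rev {d1 d2 d3 T1 T2 T3 R m1 m2 m3} f.

(** * Unipotent congruences and Schur complements *)

Section unipotent.
Variable R : realType.

Definition unip_up n (y : 'rV[R]_n) : 'M[R]_(1 + n) := block_mx 1%:M y 0 1%:M.
Definition unip_low n (x : 'cV[R]_n) : 'M[R]_(1 + n) := block_mx 1%:M 0 x 1%:M.

Lemma det_unip_up n (y : 'rV[R]_n) : \det (unip_up y) = 1.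
Proof. by rewrite /unip_up det_ublock !det1 mulr1. Qed.

Lemma det_unip_low n (x : 'cV[R]_n) : \det (unip_low x) = 1.
Proof. by rewrite /unip_low det_lblock !det1 mulr1. Qed.

Lemma unip_up_sym_block n (y : 'rV[R]_n) c w (W : 'M[R]_n) : W^T = W ->
  unip_up y *m sym_block c w W *m (unip_up y)^T =
  sym_block (y *m w^T + w *m y^T + y *m W *m y^T + c) (y *m W + w) W.
Proof.
move=> WT; rewrite /unip_up /sym_block tr_block_mx !trmx1 trmx0 !mulmx_block.
rewrite !mul1mx !mulmx1 !mul0mx !mulmx0 !(addr0, add0r) linearD/= trmx_mul WT.
congr block_mx; last by rewrite addrC.
  by rewrite mulmxDl [RHS]addrC !addrA.
by rewrite addrC.
Qed.

Lemma unip_low_sym_block n (x : 'cV[R]_n) c w (W : 'M[R]_n) :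
  unip_low x *m sym_block c w W *m (unip_low x)^T =
  sym_block c (c *m x^T + w) (x *m w + w^T *m x^T + x *m c *m x^T + W).
Proof.
have cT : c^T = c by apply/matrixP => i j; rewrite !ord1 mxE.
rewrite /unip_low /sym_block tr_block_mx !trmx1 trmx0 !mulmx_block.
rewrite !mul1mx !mulmx1 !mul0mx !mulmx0 !(addr0, add0r) linearD/= trmx_mul trmxK cT.
congr block_mx => //.
by rewrite mulmxDl addrA; congr (_ + _); rewrite [RHS]addrC -addrA; congr (_ + _); exact: addrC.
Qed.

Lemma measurable_sym_block d (T : measurableType d) n (c : T -> 'M[R]_1)
    (w : T -> 'rV[R]_n) (W : T -> 'M[R]_n) :
  measurable_fun setT c -> measurable_fun setT w -> measurable_fun setT W ->
  measurable_fun setT (fun t => sym_block (c t) (w t) (W t)).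
Proof. by move=> *; rewrite /sym_block; mx_measurable. Qed.

Lemma integral_sym_block_rev n (f : 'M[R]_(1 + n) -> \bar R) :
  measurable_fun setT f -> (forall A, 0 <= f A)%E ->
  (\int[symL R (1 + n)]_A f A =
   \int[symL R n]_W \int[mxL R 1 n]_w \int[mxL R 1 1]_c f (sym_block c w W))%E.
Proof.
move=> mf f0; rewrite integral_sym_block//.
by apply: (integral_rev (fun c w W => f (sym_block c w W))) => //;
  apply: (measurableT_comp mf); apply: measurable_sym_block; mx_measurable.
Qed.

(** The congruence fixes [W], translates [w] by an amount depending on [W], and translates [c] by an
    amount depending on [w] and [W]; integrating in the order [c], [w], [W] uses translations only.
    The formula needs [W] symmetric, hence [eq_integral_sym]. *)
Lemma integral_symL_unip_up n (y : 'rV[R]_n) (f : 'M[R]_(1 + n) -> \bar R) :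
  measurable_fun setT f -> (forall A, 0 <= f A)%E ->
  (\int[symL R (1 + n)]_S f (unip_up y *m S *m (unip_up y)^T) =
   \int[symL R (1 + n)]_S f S)%E.
Proof.
move=> mf f0; rewrite [RHS](integral_sym_block_rev mf f0).
rewrite [LHS]integral_sym_block_rev; [|by mx_measurable|by move=> A; exact: f0].
apply: eq_integral_sym.
- apply: measurable_integral => [|*]; last exact: integral_ge0.
  apply: (measurable_integral (fun p c => f (unip_up y *m sym_block c p.2 p.1 *m (unip_up y)^T))) => //.
  mx_measurable; apply: measurable_sym_block; mx_measurable.
- apply: measurable_integral => [|*]; last exact: integral_ge0.
  apply: (measurable_integral (fun p c => f (sym_block c p.2 p.1))) => //.
  mx_measurable; apply: measurable_sym_block; mx_measurable.
- by integral_nonneg.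
- by integral_nonneg.
move=> W WT.
pose g w := (\int[mxL R 1 1]_c f (sym_block c w W))%E.
transitivity (\int[mxL R 1 n]_w g (y *m W + w)%R)%E.
  apply: eq_integral => w _; rewrite /g.
  rewrite -[RHS](integral_mxL_shift (y *m w^T + w *m y^T + y *m W *m y^T)).
  - by apply: eq_integral => c _; rewrite unip_up_sym_block.
  - by mx_measurable; apply: measurable_sym_block; mx_measurable.
  - by move=> c; exact: f0.
apply: integral_mxL_shift => [|w]; last exact: integral_ge0.
apply: measurable_integral; last by move=> *; exact: f0.
by mx_measurable; apply: measurable_sym_block; mx_measurable.
Qed.

Lemma integral_symL_unip_low n (x : 'cV[R]_n) (f : 'M[R]_(1 + n) -> \bar R) :
  measurable_fun setT f -> (forall A, 0 <= f A)%E ->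
  (\int[symL R (1 + n)]_S f (unip_low x *m S *m (unip_low x)^T) =
   \int[symL R (1 + n)]_S f S)%E.
Proof.
move=> mf f0; rewrite [RHS](integral_sym_block mf f0).
rewrite [LHS]integral_sym_block; [|by mx_measurable|by move=> A; exact: f0].
apply: eq_integral => c _.
have cT : c^T = c by apply/matrixP => i j; rewrite !ord1 mxE.
pose g w := (\int[symL R n]_W f (sym_block c w W))%E.
transitivity (\int[mxL R 1 n]_w g (c *m x^T + w)%R)%E.
  apply: eq_integral => w _; rewrite /g.
  rewrite -[RHS](integral_symL_shift (C := x *m w + w^T *m x^T + x *m c *m x^T)).
  - by apply: eq_integral => W _; rewrite unip_low_sym_block.
  - by rewrite !linearD/= !trmx_mul !trmxK cT mulmxA; congr (_ + _); rewrite addrC.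
  - by mx_measurable; apply: measurable_sym_block; mx_measurable.
  - by move=> W; exact: f0.
apply: integral_mxL_shift => [|w]; last exact: integral_ge0.
apply: measurable_integral; last by move=> *; exact: f0.
by mx_measurable; apply: measurable_sym_block; mx_measurable.
Qed.

(** For fixed [c] and [w] this is a translation of the lower block, whatever [k] is. With the
    inverse of the corner entry for [k], the new variable is the Schur complement. *)
Lemma integral_symL_schur n (k : 'M[R]_1 -> R) (f : 'M[R]_(1 + n) -> \bar R) :
  measurable_fun setT k -> measurable_fun setT f -> (forall A, 0 <= f A)%E ->
  (\int[symL R (1 + n)]_S f S =
   \int[symL R n]_W \int[mxL R 1 1]_c \int[mxL R 1 n]_w
     f (sym_block c w (k c *: (w^T *m w) + W)))%E.
Proof.
move=> mk mf f0; rewrite [LHS](integral_sym_block mf f0) [RHS]integral_rotl; last 2 first.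
- by mx_measurable; apply: measurable_sym_block; mx_measurable.
- by move=> *; exact: f0.
apply: eq_integral => c _; apply: eq_integral => w _.
rewrite -[LHS](integral_symL_shift (C := k c *: (w^T *m w))); first by [].
- by rewrite linearZ/= trmx_mul trmxK.
- by mx_measurable; apply: measurable_sym_block; mx_measurable.
- by move=> W; exact: f0.
Qed.

Lemma integral_mxL_unip_low n (x : 'cV[R]_n) (f : 'M[R]_(1 + n) -> \bar R) :
  measurable_fun setT f -> (forall A, 0 <= f A)%E ->
  (\int[mxL R (1 + n) (1 + n)]_B f (unip_low x *m B) =
   \int[mxL R (1 + n) (1 + n)]_B f B)%E.
Proof.
move=> mf f0; rewrite [RHS](integral_col_mx mf f0).
rewrite [LHS]integral_col_mx; [|by mx_measurable|by move=> A; exact: f0].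
apply: eq_integral => r _.
rewrite -[RHS](integral_mxL_shift (x *m r)); [|by mx_measurable|by move=> A; exact: f0].
apply: eq_integral => B _; congr f.
by rewrite /unip_low mul_block_col !mul1mx mul0mx addr0.
Qed.

Lemma integral_mxL_block n (f : 'M[R]_(1 + n) -> \bar R) :
  measurable_fun setT f -> (forall A, 0 <= f A)%E ->
  (\int[mxL R (1 + n) (1 + n)]_B f B =
   \int[mxL R n n]_B \int[mxL R 1 n]_z \int[mxL R n 1]_x \int[mxL R 1 1]_b
     f (block_mx b z x B))%E.
Proof.
move=> mf f0; rewrite (integral_row_mx mf f0).
rewrite integral_swap; [|by mx_measurable|by move=> *; exact: f0].
rewrite integral_col_mx; last 2 first.
- by apply: measurable_integral => //; mx_measurable.
- by move=> A; exact: integral_ge0.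
rewrite integral_swap; last 2 first.
- apply: (measurable_integral (fun p A => f (row_mx A (col_mx p.1 p.2)))) => //.
  by mx_measurable.
- by move=> *; exact: integral_ge0.
apply: eq_integral => B _; apply: eq_integral => z _.
rewrite integral_col_mx; [|by mx_measurable|by move=> *; exact: f0].
rewrite integral_swap; [|by mx_measurable|by move=> *; exact: f0].
by apply: eq_integral => x _; apply: eq_integral => b _; rewrite block_mxEh.
Qed.
End unipotent.

(** * Positive definite matrices and pencils *)

Section positive_definite.
Variable R : realType.
Implicit Types n p : nat.

Lemma mx11E (A : 'M[R]_1) : A = (A ord0 ord0)%:M.
Proof. exact: mx11_scalar. Qed.

Lemma posdef_sym n (A : 'M[R]_n) : posdef R n A -> A^T = A. Proof. by case. Qed.

Lemma posdef_congr n (B A : 'M[R]_n) : B \in unitmx ->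
  posdef R n A -> posdef R n (B *m A *m B^T).
Proof.
move=> uB [AT A0]; split=> [|v v0]; first by rewrite !trmx_mul trmxK AT mulmxA.
rewrite !mulmxA -[v *m B]/(v *m B) -mulmxA -trmx_mul; apply: A0.
by apply: contra v0 => /eqP vB; rewrite -(mulmxK uB v) vB mul0mx.
Qed.

Lemma posdef_congrE n (B A : 'M[R]_n) : B \in unitmx ->
  posdef R n (B *m A *m B^T) <-> posdef R n A.
Proof.
move=> uB; split; last exact: posdef_congr.
have uBV : invmx B \in unitmx by rewrite unitmx_inv.
move=> /(posdef_congr uBV); rewrite trmx_inv !mulmxA mulVmx// mul1mx.
by rewrite mulmxK// unitmx_tr.
Qed.

Lemma posdef_diagP n (d : 'rV[R]_n) :
  posdef R n (diag_mx d) <-> forall i, 0 < d ord0 i.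
Proof.
have q v : (v *m diag_mx d *m v^T) ord0 ord0 = \sum_i d ord0 i * v ord0 i ^+ 2.
  by rewrite mxE; apply: eq_bigr => i _; rewrite mul_mx_diag !mxE mulrAC -expr2 mulrC.
split=> [[_ d0] i|d0].
  have := d0 (delta_mx ord0 i); rewrite q (bigD1 i)//= big1 ?addr0; last first.
    by move=> j ji; rewrite mxE eqxx (negbTE ji) expr0n mulr0.
  rewrite mxE !eqxx expr1n mulr1; apply; apply/negP => /eqP/matrixP/(_ ord0 i).
  by rewrite !mxE !eqxx => /eqP; rewrite oner_eq0.
split=> [|v v0]; first by rewrite tr_diag_mx.
rewrite q lt_neqAle sumr_ge0 ?andbT => [|i _]; last first.
  by rewrite mulr_ge0 ?sqr_ge0// ltW.
apply: contra v0 => /eqP/esym/psumr_eq0P v0; apply/eqP/rowP => i; rewrite mxE.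
have /eqP := v0 (fun i _ => mulr_ge0 (ltW (d0 i)) (sqr_ge0 _)) i isT.
by rewrite mulf_eq0 gt_eqF//= sqrf_eq0 => /eqP.
Qed.

Lemma posdef_block_diagP n (c : 'M[R]_1) (M : 'M[R]_n) :
  posdef R (1 + n) (block_mx c 0 0 M) <-> 0 < c ord0 ord0 /\ posdef R n M.
Proof.
have q (a : 'M[R]_1) (v : 'rV[R]_n) : (row_mx a v *m block_mx c 0 0 M *m (row_mx a v)^T) ord0 ord0 =
    a ord0 ord0 ^+ 2 * c ord0 ord0 + (v *m M *m v^T) ord0 ord0.
  rewrite mul_row_block !mulmx0 addr0 add0r tr_row_mx mul_row_col mxE; congr (_ + _).
  by rewrite [a]mx11E [c]mx11E tr_scalar_mx -!scalar_mxM !mxE eqxx !mulr1n mulrAC expr2.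
split=> [[cMT cM0]|[c0 [MT M0]]].
  have [_ _ _ MT] : [/\ c^T = c, (0 : 'M[R]_(1, n)) = 0, (0 : 'M[R]_(n, 1)) = 0 & M^T = M].
    by move: cMT; rewrite tr_block_mx !trmx0 => /eq_block_mx.
  split.
    have := cM0 (row_mx 1%:M 0); rewrite q !mul0mx !mxE eqxx addr0 expr1n mul1r; apply.
    apply/negP => /eqP/(congr1 lsubmx); rewrite row_mxKl linear0 => /matrixP/(_ ord0 ord0).
    by rewrite !mxE eqxx => /eqP; rewrite oner_eq0.
  split=> // v v0; have := cM0 (row_mx 0 v); rewrite q mxE expr0n mul0r add0r; apply.
  by apply: contra v0 => /eqP/(congr1 rsubmx); rewrite row_mxKr linear0 => ->.
split=> [|v v0]; first by rewrite tr_block_mx !trmx0 MT; congr block_mx; rewrite [c]mx11E tr_scalar_mx.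
rewrite -[v](@hsubmxK R 1 1 n) q.
have [v10|v10] := eqVneq (@rsubmx R 1 1 n v) 0; last first.
  by apply: ltr_wpDl; [rewrite mulr_ge0 ?sqr_ge0// ltW|exact: M0].
rewrite v10 !mul0mx [X in _ + X]mxE addr0 mulr_gt0// exprn_even_gt0//=.
apply: contra v0 => /eqP l0; rewrite -[v](@hsubmxK R 1 1 n) v10 [lsubmx _]mx11E l0 -row_mx0.
by rewrite -scalemx1 scale0r.
Qed.

Lemma posdef_unit n (A : 'M[R]_n) : posdef R n A -> A \in unitmx.
Proof.
move=> [_ A0]; rewrite -row_free_unit -kermx_eq0; apply: contrapT => /negP.
move=> /rowV0Pn[v /sub_kermxP vA v0]; have := A0 v v0.
by rewrite vA mul0mx mxE ltxx.
Qed.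

Lemma posdefD n (A B : 'M[R]_n) : posdef R n A -> posdef R n B -> posdef R n (A + B).
Proof.
move=> [AT A0] [BT B0]; split=> [|v v0]; first by rewrite linearD/= AT BT.
by rewrite mulmxDr mulmxDl mxE addr_gt0//; [exact: A0|exact: B0].
Qed.

Lemma posdefZ n (a : R) (A : 'M[R]_n) : 0 < a -> posdef R n A -> posdef R n (a *: A).
Proof.
move=> a0 [AT A0]; split=> [|v v0]; first by rewrite linearZ/= AT.
by rewrite -scalemxAr -scalemxAl mxE mulr_gt0//; exact: A0.
Qed.

Lemma posdef_drsubmx n (A : 'M[R]_(1 + n)) : posdef R (1 + n) A -> posdef R n (drsubmx A).
Proof.
move=> [AT A0]; split=> [|v v0]; first by rewrite trmx_drsub AT.
have := A0 (row_mx 0 v); rewrite -[in _ *m A](submxK A) mul_row_block !mul0mx !add0r tr_row_mx.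
rewrite mul_row_col trmx0 mulmx0 add0r; apply.
by apply: contra v0 => /eqP/(congr1 rsubmx); rewrite row_mxKr linear0 => ->.
Qed.

(** A unipotent congruence clears the first row and column and leaves the Schur complement. *)
Lemma posdef_sym_blockP n (c : 'M[R]_1) w (W : 'M[R]_n) :
  posdef R (1 + n) (sym_block c w W) <->
  0 < c ord0 ord0 /\ posdef R n (W - (c ord0 ord0)^-1 *: (w^T *m w)).
Proof.
have [c0|c0] := eqVneq (c ord0 ord0) 0.
  split=> [[_ /(_ (row_mx 1%:M 0))]|[]]; last by rewrite c0 ltxx.
  rewrite /sym_block mul_row_block !mul0mx !addr0 tr_row_mx mul_row_col trmx0 mulmx0.
  rewrite addr0 trmx1 mulmx1 mul1mx c0 ltxx => H.
  exfalso; suff: false by []; apply: H.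
  apply/negP => /eqP/(congr1 lsubmx); rewrite row_mxKl linear0 => /matrixP/(_ ord0 ord0).
  by rewrite !mxE eqxx => /eqP; rewrite oner_eq0.
pose x := (c ord0 ord0)^-1 *: w^T.
have -> : sym_block c w W = unip_low x *m
    block_mx c 0 0 (W - (c ord0 ord0)^-1 *: (w^T *m w)) *m (unip_low x)^T.
  have -> : block_mx c 0 0 (W - (c ord0 ord0)^-1 *: (w^T *m w)) =
    sym_block c 0 (W - (c ord0 ord0)^-1 *: (w^T *m w)) by rewrite /sym_block trmx0.
  rewrite unip_low_sym_block addr0 trmx0 mulmx0 mul0mx !add0r /x linearZ/= trmxK.
  rewrite (_ : c *m _ = w); last first.
    by rewrite [in LHS](mx11E c) mul_scalar_mx scalerA mxE eqxx mulr1n mulfV// scale1r.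
  rewrite (_ : _ *m c *m _ = (c ord0 ord0)^-1 *: (w^T *m w)) ?[_ + (W - _)]addrC ?subrK//.
  rewrite [in X in _ *m X *m _](mx11E c) mul_mx_scalar scalerA mulfV// scale1r.
  by rewrite -scalemxAr.
rewrite posdef_congrE; first exact: posdef_block_diagP.
by rewrite unitmxE det_unip_low unitr1.
Qed.

(** The definition quantifies over all vectors; the Schur complement criterion replaces this by a
    recursion through measurable operations. *)
Lemma measurable_posdef n : measurable (posdef R n).
Proof.
elim: n => [|n IH].
  rewrite (_ : posdef R 0 = setT)//; apply/seteqP; split=> // A _.
  by split=> [|v]; rewrite ?[_^T]thinmx0 ?[A]thinmx0 // [v]thinmx0 eqxx.
rewrite -[n.+1]/(1 + n)%N.
pose schur (A : 'M[R]_(1 + n)) := drsubmx A -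
  (ulsubmx A ord0 ord0)^-1 *: ((ursubmx A)^T *m ursubmx A).
rewrite (_ : posdef R (1 + n) = [set A | A^T = A] `&`
   ([set A | (0 < ulsubmx A ord0 ord0)] `&` schur @^-1` posdef R n)); last first.
  have symE (A : 'M[R]_(1 + n)) : A^T = A ->
      A = sym_block (ulsubmx A) (ursubmx A) (drsubmx A).
    by move=> AT; rewrite /sym_block trmx_ursub AT submxK.
  apply/seteqP; split=> A.
    move=> pA; have AT := posdef_sym pA; split=> //.
    by move: pA; rewrite [A in posdef _ _ A]symE// => /posdef_sym_blockP.
  move=> [AT pA]; rewrite [A]symE//; apply/posdef_sym_blockP; exact: pA.
apply: measurableI.
  rewrite (_ : [set A | _] = \bigcap_(i in [set: 'I_(1 + n)]) \bigcap_(j in [set: 'I_(1 + n)])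
      ((fun A : 'M[R]_(1 + n) => A i j == A j i) @^-1` [set true])).
    apply: fin_bigcap_measurable => // i _; apply: fin_bigcap_measurable => // j _.
    rewrite -[X in measurable X]setTI.
    have : measurable_fun setT (fun A : 'M[R]_(1 + n) => A i j == A j i).
      by apply: measurable_fun_eqr; mx_measurable.
    by apply.
  apply/seteqP; split=> A /=.
    by move=> AT i _ j _; apply/eqP; rewrite -{1}AT mxE.
  by move=> AT; apply/matrixP => i j; rewrite mxE; apply/esym/eqP; exact: AT.
apply: measurableI.
  rewrite (_ : [set A | _] = (fun A : 'M[R]_(1 + n) => 0 < ulsubmx A ord0 ord0) @^-1` [set true])//.
  rewrite -[X in measurable X]setTI.
  have : measurable_fun setT (fun A : 'M[R]_(1 + n) => 0 < ulsubmx A ord0 ord0).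
    by apply: measurable_fun_ltr; mx_measurable.
  by apply.
rewrite -[X in measurable X]setTI.
have : measurable_fun setT schur by rewrite /schur; mx_measurable.
by apply.
Qed.

Lemma posdef_mul_tr n (C : 'M[R]_n) : C \in unitmx -> posdef R n (C *m C^T).
Proof.
move=> uC; rewrite -[X in X *m _]mulmx1; apply: posdef_congr => //.
rewrite -diag_const_mx; apply/posdef_diagP => i; by rewrite mxE ltr01.
Qed.

Lemma posdef_cholesky n (A : 'M[R]_n) : posdef R n A ->
  exists2 C, C \in unitmx & A = C *m C^T.
Proof.
elim: n A => [|n IH] A.
  by exists 1%:M; rewrite ?unitmx1// [A]thinmx0 [RHS]thinmx0.
rewrite -[n.+1]/(1 + n)%N in A * => pA; have AT := posdef_sym pA.
move: pA; have -> : A = sym_block (ulsubmx A) (ursubmx A) (drsubmx A).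
  by rewrite /sym_block trmx_ursub AT submxK.
move: (ulsubmx A) (ursubmx A) (drsubmx A) => c w W /posdef_sym_blockP[c0 /IH[C uC WE]].
have s0 : Num.sqrt (c ord0 ord0) != 0 by rewrite gt_eqF// sqrtr_gt0.
pose r := (Num.sqrt (c ord0 ord0))%:M : 'M[R]_1.
exists (block_mx r 0 ((Num.sqrt (c ord0 ord0))^-1 *: w^T) C).
  by rewrite unitmxE det_lblock det_scalar1 unitrM unitfE s0 -unitmxE.
rewrite tr_block_mx mulmx_block trmx0 !mul0mx !mulmx0 !addr0 -WE /sym_block.
rewrite tr_scalar_mx linearZ/= trmxK.
congr block_mx.
- by rewrite -scalar_mxM -expr2 sqr_sqrtr ?ltW// -mx11E.
- by rewrite mul_scalar_mx scalerA mulfV// scale1r.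
- by rewrite mul_mx_scalar scalerA mulfV// scale1r.
- rewrite -scalemxAl -scalemxAr scalerA -invfM -expr2 sqr_sqrtr ?ltW//.
  by rewrite addrC subrK.
Qed.

(** Writing A = C C^t reduces the claim to I + t M, where |v M v^t| is at most |v|^2 times the sum
    [s] of the absolute values of the entries of [M]. *)
Lemma posdef_open n (A B : 'M[R]_n) : posdef R n A -> B^T = B ->
  exists2 e : R, 0 < e & forall t : R, `|t| <= e -> posdef R n (A + t *: B).
Proof.
move=> /posdef_cholesky[C uC AE] BT.
pose M := invmx C *m B *m (invmx C)^T.
have BE : B = C *m M *m C^T.
  by rewrite /M trmx_inv !mulmxA mulmxV// mul1mx mulmxKV// unitmx_tr.
pose s : R := \sum_i \sum_j `|M i j|.
have s0 : 0 <= s by apply: sumr_ge0 => i _; exact: sumr_ge0.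
(* The summand 1 allows [s = 0] and makes the bound s / (s + 1) < 1 strict. *)
exists (s + 1)^-1; first by rewrite invr_gt0 ltr_wpDl.
move=> t te.
have -> : A + t *: B = C *m (1%:M + t *: M) *m C^T.
  by rewrite mulmxDr mulmxDl mulmx1 -AE BE -scalemxAr -scalemxAl.
apply: posdef_congr => //; split=> [|v v0].
  by rewrite linearD/= trmx1 linearZ/= /M !trmx_mul trmxK BT mulmxA.
pose N := \sum_i v ord0 i ^+ 2.
have N0 : 0 < N.
  rewrite lt_neqAle sumr_ge0 ?andbT => [|i _]; last exact: sqr_ge0.
  apply: contra v0 => /eqP/esym/psumr_eq0P v0; apply/eqP/rowP => i; rewrite mxE.
  by have /eqP := v0 (fun i _ => sqr_ge0 _) i isT; rewrite sqrf_eq0 => /eqP.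
have vN i : `|v ord0 i| ^+ 2 <= N.
  rewrite -normrX ger0_norm ?sqr_ge0// /N (bigD1 i)//= lerDl.
  by apply: sumr_ge0 => j _; exact: sqr_ge0.
have vvN i j : `|v ord0 i| * `|v ord0 j| <= N.
  have := sqr_ge0 (`|v ord0 i| - `|v ord0 j|); have := vN i; have := vN j.
  by rewrite !expr2; nra.
have qM : `|(v *m M *m v^T) ord0 ord0| <= s * N.
  have -> : (v *m M *m v^T) ord0 ord0 = \sum_i \sum_j v ord0 i * M i j * v ord0 j.
    rewrite mxE exchange_big/=; apply: eq_bigr => j _.
    by rewrite !mxE mulr_suml.
  rewrite (le_trans (ler_norm_sum _ _ _))// /s mulr_suml ler_sum// => i _.
  rewrite (le_trans (ler_norm_sum _ _ _))// mulr_suml ler_sum// => j _.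
  by rewrite !normrM mulrAC -mulrA mulrCA mulrA mulrC ler_wpM2l// mulrC.
rewrite mulmxDr mulmxDl mulmx1 mxE.
have -> : (v *m v^T) ord0 ord0 = N.
  by rewrite mxE; apply: eq_bigr => i _; rewrite !mxE expr2.
rewrite -scalemxAr -scalemxAl mxE.
have tq : `|t * (v *m M *m v^T) ord0 ord0| < N.
  rewrite normrM (@le_lt_trans _ _ ((s + 1)^-1 * (s * N)))//.
    by apply: ler_pM.
  rewrite mulrA gtr_pMl// mulrC ltr_pdivrMr ?mul1r ?ltrDl// ltr_wpDl//.
by rewrite -ltrBlDl sub0r ltrNl (le_lt_trans _ tq)// -normrN ler_norm.
Qed.
End positive_definite.

(** * Pencils and the order of their roots *)

Section pencils.
Variable R : realType.

(** Boolean, so that it can serve as a 0/1 factor in [jac]. *)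
Definition decr n (l : 'rV[R]_n) : bool :=
  [forall i : 'I_n, forall j : 'I_n, (i < j)%N ==> (l ord0 j < l ord0 i)].

Lemma decrP n (l : 'rV[R]_n) :
  reflect (forall i j : 'I_n, (i < j)%N -> l ord0 j < l ord0 i) (decr l).
Proof.
apply: (iffP forallP) => [H i j ij|H i].
  by have /forallP/(_ j)/implyP := H i; exact.
by apply/forallP => j; apply/implyP; exact: H.
Qed.

Definition pencil n (B : 'M[R]_n) (l : 'rV[R]_n) : 'M[R]_n * 'M[R]_n :=
  (B *m B^T, B *m diag_mx l *m B^T).

Definition simple_pencils n : set ('M[R]_n * 'M[R]_n) :=
  [set w | exists B l, [/\ B \in unitmx, decr l & w = pencil B l]].

Definition vdm n (l : 'rV[R]_n) : R :=
  \prod_(i < n) \prod_(j < n | (i < j)%N) (l ord0 i - l ord0 j).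

Definition jac n (B : 'M[R]_n) (l : 'rV[R]_n) : R :=
  (decr l)%:R * (`|\det B| ^+ n.+2 * vdm l).

(* [interlaced] holds when the top eigenvalue of the pencil strictly exceeds that
   of its lower right block; [q] separates them. *)
Definition interlaced n : set ('M[R]_(1 + n) * 'M[R]_(1 + n)) :=
  [set w | exists q : rat,
    posdef R n (ratr q *: drsubmx w.1 - drsubmx w.2) /\
    ~ posdef R (1 + n) (ratr q *: w.1 - w.2)].

Lemma decr_row_mx n (a : 'M[R]_1) (l : 'rV[R]_n) :
  decr (row_mx a l : 'rV_(1 + n)) =
  decr l && [forall j, l ord0 j < a ord0 ord0].
Proof.
apply/decrP/andP => [H|[/decrP H /forallP Ha] i j].
  split.
    by apply/decrP => i j ij; have := H (rshift 1 i) (rshift 1 j); rewrite !row_mxEr; exact.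
  by apply/forallP => j; have := H (lshift n ord0) (rshift 1 j); rewrite row_mxEl row_mxEr; exact.
case: (split_ordP i) => i' ->; case: (split_ordP j) => j' ->; rewrite ?row_mxEl ?row_mxEr ?ord1//.
by move=> /= ij; apply: H; move: ij; rewrite /= !add1n ltnS.
Qed.

Lemma vdm_row_mx n (a : 'M[R]_1) (l : 'rV[R]_n) :
  vdm (row_mx a l : 'rV_(1 + n)) = (\prod_j (a ord0 ord0 - l ord0 j)) * vdm l.
Proof.
rewrite /vdm big_split_ord big_ord1/=; congr (_ * _).
  rewrite big_mkcond/= big_split_ord big_ord1/= mul1r; apply: eq_bigr => j _.
  by rewrite row_mxEl row_mxEr.
apply: eq_bigr => i _; rewrite big_mkcond/= big_split_ord big_ord1/= mul1r -big_mkcond.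
by apply: eq_big => [j|j _]; rewrite ?ltnS// !row_mxEr.
Qed.

Lemma vdm_ge0 n (l : 'rV[R]_n) : decr l -> 0 < vdm l.
Proof.
move=> /decrP dl; apply: prodr_gt0 => i _; apply: prodr_gt0 => j ij.
by rewrite subr_gt0 dl.
Qed.

Lemma jac_ge0 n (B : 'M[R]_n) (l : 'rV[R]_n) : 0 <= jac B l.
Proof.
rewrite /jac; case: (boolP (decr l)) => [dl|_]; last by rewrite mul0r.
by rewrite mul1r mulr_ge0 ?exprn_ge0// ltW// vdm_ge0.
Qed.

Lemma shift_pencil n (B : 'M[R]_n) (l : 'rV[R]_n) (q : R) :
  q *: (pencil B l).1 - (pencil B l).2 = B *m diag_mx (const_mx q - l) *m B^T.
Proof.
rewrite /pencil/= linearB/= mulmxBr mulmxBl diag_const_mx mul_mx_scalar.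
by rewrite -scalemxAl.
Qed.

(** Lets the largest root be compared with [q] in terms of the pair of matrices alone, without
    reference to [B]. *)
Lemma posdef_pencil n (B : 'M[R]_n) (l : 'rV[R]_n) (q : R) : B \in unitmx ->
  posdef R n (q *: (pencil B l).1 - (pencil B l).2) <-> forall i, l ord0 i < q.
Proof.
move=> uB; rewrite shift_pencil posdef_congrE// posdef_diagP.
by split=> H i; have := H i; rewrite !mxE subr_gt0.
Qed.
End pencils.

(** * Invertible lower blocks and deflation of pencils *)

Section deflation.
Variables (R : realType) (n : nat).
Implicit Types (b a : 'M[R]_1) (z l y w : 'rV[R]_n) (x : 'cV[R]_n) (B S N : 'M[R]_n).

Lemma diag_mx11 a : diag_mx a = a.
Proof. by apply/matrixP => i j; rewrite !mxE !ord1 eqxx mulr1n. Qed.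

Lemma row_mx00 a l : (row_mx a l : 'rV_(1 + n)) ord0 ord0 = a ord0 ord0.
Proof. by rewrite -(row_mxEl a l ord0 ord0); congr (row_mx a l _ _); exact: val_inj. Qed.

Lemma pencil_block b z x B a l :
  pencil (block_mx b z x B) (row_mx a l) =
  (block_mx (b *m b^T + z *m z^T) (b *m x^T + z *m B^T)
     (x *m b^T + B *m z^T) (x *m x^T + B *m B^T),
   block_mx (b *m a *m b^T + z *m diag_mx l *m z^T)
     (b *m a *m x^T + z *m diag_mx l *m B^T)
     (x *m a *m b^T + B *m diag_mx l *m z^T)
     (x *m a *m x^T + B *m diag_mx l *m B^T)).
Proof.
rewrite /pencil diag_mx_row diag_mx11 tr_block_mx !mulmx_block.
by rewrite !mulmx0 !addr0 !add0r.
Qed.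

Lemma decr_head a l i : decr (row_mx a l : 'rV_(1 + n)) ->
  (row_mx a l : 'rV_(1 + n)) ord0 i <= a ord0 ord0.
Proof.
rewrite decr_row_mx => /andP[_ /forallP la].
by case: (split_ordP i) => j ->; rewrite ?row_mxEl ?row_mxEr ?ord1// ltW.
Qed.

(** If u B = 0, then the lower block of q S - W takes the value (q - a) (u x)^2 at u. Its positivity
    forces q > a, so q exceeds every root and q S - W is positive definite, contrary to the choice
    of q. *)
Lemma interlaced_unit b z x B a l : block_mx b z x B \in unitmx ->
  decr (row_mx a l : 'rV_(1 + n)) ->
  interlaced (pencil (block_mx b z x B) (row_mx a l)) -> B \in unitmx.
Proof.
move=> uB dl [q [[_ qpos] nq]].
rewrite -row_free_unit -kermx_eq0; apply: contrapT => /negP.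
move=> /rowV0Pn[u /sub_kermxP uB0 u0]; apply: nq; apply/posdef_pencil => // i.
apply: (le_lt_trans (decr_head _ dl)).
have := qpos u u0; rewrite pencil_block/= !block_mxKdr.
have xax : x *m a *m x^T = a ord0 ord0 *: (x *m x^T).
  by rewrite [in LHS](mx11E a) mul_mx_scalar -scalemxAl.
rewrite xax scalerDr opprD addrACA -scalerBl mulmxDr.
rewrite [X in _ + X](_ : _ = 0) ?addr0; last first.
  by rewrite mulmxBr -scalemxAr !mulmxA uB0 !mul0mx scaler0 subrr.
rewrite -scalemxAr -scalemxAl.
have -> : u *m (x *m x^T) *m u^T = u *m x *m (u *m x)^T by rewrite trmx_mul !mulmxA.
rewrite [u *m x]mx11E tr_scalar_mx.
rewrite -scalar_mxM !mxE eqxx mulr1n -expr2 => q0.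
rewrite -subr_gt0 ltNge; apply/negP => le0.
by move: q0; rewrite ltNge mulr_le0_ge0// sqr_ge0.
Qed.

(** At the top root [a] the contribution of [x] to the lower block of a S - W cancels, leaving B (a
    - l) B^t, which is positive definite. By openness it stays so for a rational slightly below [a],
    where q S - W itself fails to be positive definite. *)
Lemma unit_interlaced b z x B a l : block_mx b z x B \in unitmx ->
  decr (row_mx a l : 'rV_(1 + n)) -> B \in unitmx ->
  interlaced (pencil (block_mx b z x B) (row_mx a l)).
Proof.
move=> uM dl uB.
set w := pencil _ _.
have aS : a ord0 ord0 *: drsubmx w.1 - drsubmx w.2 =
    B *m diag_mx (const_mx (a ord0 ord0) - l) *m B^T.
  rewrite /w pencil_block/= !block_mxKdr -[RHS]shift_pencil /pencil/=.
  by rewrite [in X in _ - (X + _)](mx11E a) mul_mx_scalar -scalemxAl scalerDr opprD addrACA subrr add0r.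
have pa : posdef R n (a ord0 ord0 *: drsubmx w.1 - drsubmx w.2).
  rewrite aS; apply/posdef_congr => //; apply/posdef_diagP => i.
  move: dl; rewrite decr_row_mx => /andP[_ /forallP/(_ i)].
  by rewrite !mxE subr_gt0.
have S'T : (drsubmx w.1)^T = drsubmx w.1 by rewrite trmx_drsub /w/= trmx_mul trmxK.
have [e e0 epos] := posdef_open pa S'T.
have [q] : exists q : rat, ratr q \in `](a ord0 ord0 - e), (a ord0 ord0)[.
  by apply: rat_in_itvoo; rewrite ltrBlDr ltrDl.
rewrite in_itv/= => /andP[aq qa]; exists q; split.
  rewrite (_ : _ - _ = (a ord0 ord0 *: drsubmx w.1 - drsubmx w.2) +
    (ratr q - a ord0 ord0) *: drsubmx w.1); last first.
    by apply/matrixP => i j; rewrite !mxE; ring.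
  apply: epos; rewrite ltr0_norm ?subr_lt0// opprB lerBlDl -lerBlDr ltW//.
move=> /posdef_pencil => /(_ uM)/(_ (lshift n ord0)); rewrite row_mxEl.
by move=> /(lt_trans qa); rewrite ltxx.
Qed.

Lemma unip_low_unit (x : 'cV[R]_n) : unip_low x \in unitmx.
Proof. by rewrite unitmxE det_unip_low unitr1. Qed.

Lemma unip_up_unit (y : 'rV[R]_n) : unip_up y \in unitmx.
Proof. by rewrite unitmxE det_unip_up unitr1. Qed.

(** Let v be the first row of the inverse of [B]. The lower right block is invertible as soon as the
    first entry of v is nonzero. If it vanishes, some other entry v_k does not, and adding the first
    row of [B] to row k turns the first entry of v into - v_k. *)
Lemma exists_unip_low_unit (B : 'M[R]_(1 + n)) : B \in unitmx ->
  exists k : option 'I_n,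
    drsubmx (unip_low (oapp (fun k => delta_mx k ord0) 0 k) *m B) \in unitmx.
Proof.
move=> uB.
(* If u annihilates the lower right block, then (0, u) C is a multiple of the first unit vector, so
   (0, u) = t v, and the first entry gives t = 0. *)
have drunit (C : 'M[R]_(1 + n)) (v : 'rV[R]_(1 + n)) : C \in unitmx ->
    v *m C = delta_mx ord0 ord0 -> v ord0 ord0 != 0 -> drsubmx C \in unitmx.
  move=> uC vC v0; rewrite -row_free_unit -kermx_eq0; apply: contrapT => /negP.
  move=> /rowV0Pn[u /sub_kermxP uC0 /eqP u0]; apply: u0.
  pose t := (u *m dlsubmx C) ord0 ord0.
  have uv : row_mx 0 u = t *: v.
    apply: (can_inj (mulmxK uC)); rewrite -scalemxAl vC -[in LHS](submxK C).
    rewrite mul_row_block !mul0mx !add0r uC0 [u *m _]mx11E -/t.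
    apply/rowP => i; rewrite !mxE; case: (split_ordP i) => j ->.
      rewrite ord1 mxE eqxx mulr1n.
      by rewrite [lshift _ _](_ : _ = ord0) ?eqxx ?mulr1//; exact: val_inj.
    by rewrite mxE mulr0.
  have t0 : t = 0.
    apply: (mulIf v0); rewrite mul0r.
    have /rowP/(_ (lshift n ord0)) := uv; rewrite row_mxEl !mxE => /esym.
    by rewrite (_ : lshift n ord0 = ord0)//; exact: val_inj.
  by have := congr1 rsubmx uv; rewrite row_mxKr t0 scale0r linear0.
have [v vB] : exists v : 'rV[R]_(1 + n), v *m B = delta_mx ord0 ord0.
  by exists (row ord0 (invmx B)); rewrite -row_mul mulVmx// rowE mulmx1.
have [v0|v0] := eqVneq (v ord0 ord0) 0; last first.
  exists None; rewrite /= (_ : unip_low 0 = 1%:M) ?mul1mx; first exact: drunit v0.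
  by rewrite /unip_low -scalar_mx_block.
have [k vk] : exists k : 'I_n, v ord0 (rshift 1 k) != 0.
  apply: contrapT => /forallNP v'0.
  have : v = 0.
    apply/rowP => i; rewrite [RHS]mxE; case: (split_ordP i) => j ->.
      by rewrite ord1 -[RHS]v0; congr (v _ _); exact: val_inj.
    by have /negP := v'0 j; rewrite negbK => /eqP.
  move=> v00; move: vB; rewrite v00 mul0mx => /matrixP/(_ ord0 ord0).
  by rewrite !mxE eqxx => /esym/eqP; rewrite oner_eq0.
exists (Some k); apply: (drunit _ (v *m unip_low (- delta_mx k ord0))).
- by rewrite unitmx_mul unip_low_unit.
- rewrite -mulmxA (mulmxA (unip_low _)) /unip_low mulmx_block !mul1mx !mulmx1 !mul0mx !mulmx0.
  by rewrite !addr0 !add0r addNr -scalar_mx_block mul1mx.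
- rewrite -[v](@hsubmxK R 1 1 n) /unip_low mul_row_block !mulmx1 mulmx0 add0r.
  rewrite row_mx00 mulmxN -colE [X in X != 0]mxE.
  rewrite [X in X + _](_ : _ = 0); first by rewrite add0r !mxE oppr_eq0.
  by rewrite mxE -v0; congr (v _ _); exact: val_inj.
Qed.

(** Transfers the support condition to the smaller size, where the induction hypothesis asks for it.
    After removal of [U], the matrix diag(0, N') equals B1 (a - l) B1^t: it is positive semidefinite
    and singular, so [a] is the top root and the first row of [B1] vanishes outside its first entry.
    The lower right block of [B1] then diagonalizes the smaller pencil. *)
Lemma simple_pencils_descend (y : 'rV[R]_n) (s : 'M[R]_1) (w : 'rV[R]_n)
    (S'' N' : 'M[R]_n) (a : R) :
  0 < s ord0 ord0 -> posdef R n N' ->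
  let U := unip_up y in
  let S := U *m sym_block s w ((s ord0 ord0)^-1 *: (w^T *m w) + S'') *m U^T in
  simple_pencils (S, a *: S - U *m block_mx 0 0 0 N' *m U^T) ->
  simple_pencils (S'', a *: S'' - N').
Proof.
move=> s0 [N'T N'0] U S [B [l [uB dl]]]; rewrite /S => -[SE WE].
have uU : U \in unitmx by exact: unip_up_unit.
have uUT : U^T \in unitmx by rewrite unitmx_tr.
have cancelU (M M' : 'M[R]_(1 + n)) : U *m M *m U^T = U *m M' *m U^T -> M = M'.
  by move=> /(can_inj (mulmxK uUT)) /(can_inj (mulKmx uU)).
have [B1 BE] : exists B1 : 'M[R]_(1 + n), B = U *m B1 by exists (invmx U *m B); rewrite mulKVmx.
have uB1 : B1 \in unitmx by move: uB; rewrite BE unitmx_mul => /andP[].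
have {WE} NE : block_mx 0 0 0 N' = B1 *m diag_mx (const_mx a - l) *m B1^T.
  apply: cancelU; transitivity (a *: (pencil B l).1 - (pencil B l).2).
    by rewrite /pencil/= -WE -SE opprB addrC subrK.
  by rewrite shift_pencil BE trmx_mul !mulmxA.
have {}SE : sym_block s w ((s ord0 ord0)^-1 *: (w^T *m w) + S'') = B1 *m B1^T.
  by apply: cancelU; rewrite SE BE trmx_mul !mulmxA.
have N'_ge0 (u : 'rV[R]_n) : 0 <= (u *m N' *m u^T) ord0 ord0.
  by have [->|/N'0/ltW//] := eqVneq u 0; rewrite !mul0mx mxE.
(* Evaluate the semidefinite form at the row of the inverse of [B1] dual to column [j]. *)
have lea j : l ord0 j <= a.
  have [v vB] : exists v : 'rV[R]_(1 + n), v *m B1 = delta_mx ord0 j.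
    by exists (row j (invmx B1)); rewrite -row_mul mulVmx// rowE mulmx1.
  have : 0 <= (v *m block_mx 0 0 0 N' *m v^T) ord0 ord0.
    rewrite -[v](@hsubmxK R 1 1 n) mul_row_block !mulmx0 !addr0 add0r tr_row_mx.
    by rewrite mul_row_col mul0mx add0r.
  rewrite NE !mulmxA vB -mulmxA -trmx_mul vB mul_mx_diag trmx_delta.
  rewrite mxE (bigD1 j)//= big1 ?addr0 => [|i ij]; last first.
    by rewrite !mxE (negbTE ij) mulr0.
  by rewrite !mxE !eqxx mulr1 mul1r subr_ge0.
(* The first row of diag(0, N') is zero and [B1^T] can be cancelled. *)
have r0 j : usubmx B1 ord0 j * (a - l ord0 j) = 0.
  have : usubmx B1 *m diag_mx (const_mx a - l) = 0.
    have uBT : B1^T \in unitmx by rewrite unitmx_tr.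
    apply: (can_inj (mulmxK uBT)); rewrite mul0mx.
    have := congr1 usubmx NE; rewrite -[X in X *m _ *m _](@vsubmxK R 1 n).
    by rewrite !mul_col_mx !col_mxKu => <-; rewrite row_mx0.
  by move=> /matrixP/(_ ord0 j); rewrite mul_mx_diag !mxE.
have [j0 j0P] : exists j0, usubmx B1 ord0 j0 != 0.
  apply: contrapT => /forallNP H.
  have : (row_mx 1%:M 0 : 'rV[R]_(1 + n)) = 0.
    apply: (can_inj (mulmxK uB1)); rewrite mul0mx -[B1](@vsubmxK R 1 n).
    rewrite mul_row_col mul1mx mul0mx addr0; apply/rowP => j; rewrite [RHS]mxE.
    by have /negP := H j; rewrite negbK => /eqP.
  move=> /(congr1 lsubmx); rewrite row_mxKl linear0 => /matrixP/(_ ord0 ord0).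
  by rewrite !mxE eqxx => /eqP; rewrite oner_eq0.
have al0 : l ord0 ord0 = a.
  have alj : l ord0 j0 = a.
    by have /eqP := r0 j0; rewrite mulf_eq0 (negbTE j0P)/= subr_eq0 => /eqP.
  apply/eqP; rewrite eq_le lea/= -alj; have [->//|j00] := eqVneq j0 ord0.
  by apply/ltW; move/decrP : dl; apply; rewrite lt0n.
(* The remaining roots are strictly smaller than [a], so the products in [r0] force these entries to
   vanish. *)
have z0 : ursubmx B1 = 0.
  apply/rowP => j; rewrite [RHS]mxE.
  have /eqP := r0 (rshift 1 j); rewrite -al0 mulf_eq0 subr_eq0.
  have /decrP/(_ ord0 (rshift 1 j) isT) lt := dl.
  by rewrite (gt_eqF lt) orbF => /eqP; rewrite !mxE.
move: uB1 SE NE dl; rewrite -[B1]submxK -[l](@hsubmxK R 1 1 n) z0.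
move: (ulsubmx B1) (dlsubmx B1) (drsubmx B1) => b x C uB1 SE NE.
rewrite decr_row_mx => /andP[dl' _].
have l0a : lsubmx l = a%:M.
  rewrite [LHS]mx11E -al0 mxE; congr (l _ _)%:M; exact: val_inj.
exists C, (rsubmx l); split=> //.
  by move: uB1; rewrite !unitmxE det_lblock unitrM => /andP[].
move: SE; rewrite tr_block_mx mulmx_block trmx0 !mul0mx !mulmx0 !addr0 => /eq_block_mx[sE wE _ S''E].
have {S''E} S''E : S'' = C *m C^T.
  have /addrI// : x *m x^T + S'' = x *m x^T + C *m C^T.
  rewrite -S''E; congr (_ + _); rewrite wE sE trmx_mul trmxK mulmxA -(mulmxA x).
  rewrite [b]mx11E tr_scalar_mx -!scalar_mxM mul_mx_scalar -scalemxAl scalerA.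
  rewrite mxE eqxx mulr1n mulVf ?scale1r//; apply/eqP => b0.
  by move: s0; rewrite sE [b]mx11E tr_scalar_mx -!scalar_mxM mxE eqxx mulr1n b0 ltxx.
rewrite /pencil -S''E; congr pair.
move: NE; rewrite l0a.
have -> : const_mx a - row_mx a%:M (rsubmx l) = row_mx 0 (const_mx a - rsubmx l) :> 'rV[R]_(1 + n).
  rewrite -row_mx_const -[RHS]/(row_mx _ _) opp_row_mx add_row_mx; congr row_mx.
  by apply/matrixP => i j; rewrite !ord1 !mxE eqxx mulr1n subrr.
rewrite diag_mx_row (_ : diag_mx 0 = 0) ?linear0// tr_block_mx !mulmx_block trmx0.
rewrite !(mulmx0, mul0mx, addr0, add0r) => /eq_block_mx[_ _ _ ->].
by rewrite -shift_pencil /pencil/= -S''E opprB addrC subrK.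
Qed.

(** The witness is the top root. It is at least [q], since otherwise [q] would exceed all roots;
    raising [q] to it keeps the lower block positive definite. This places the corner entry of W in
    the range of the secular function. *)
Lemma interlaced_root (w : 'M[R]_(1 + n) * 'M[R]_(1 + n)) :
  simple_pencils w -> interlaced w ->
  exists a : R, posdef R n (a *: drsubmx w.1 - drsubmx w.2) /\ \det (a *: w.1 - w.2) = 0.
Proof.
move=> [B [l [uB dl ->]]] [q [pq nq]].
pose a := l ord0 (lshift n ord0).
have la i : l ord0 i <= a.
  by have := @decr_head (lsubmx l) (rsubmx l) i; rewrite hsubmxK mxE; exact.
exists a; split.
  have qa : ratr q <= a.
    rewrite leNgt; apply/negP => aq; apply: nq; apply/posdef_pencil => // i.
    exact: le_lt_trans (la i) aq.
  rewrite (_ : _ - _ = (ratr q *: drsubmx (pencil B l).1 - drsubmx (pencil B l).2) +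
    (a - ratr q) *: drsubmx (pencil B l).1); last first.
    by apply/matrixP => i j; rewrite !mxE; ring.
  move: qa; rewrite le_eqVlt => /predU1P[qa|qa]; first by rewrite -qa subrr scale0r addr0.
  apply: posdefD => //; apply: posdefZ; first by rewrite subr_gt0.
  exact/posdef_drsubmx/posdef_mul_tr.
rewrite shift_pencil !det_mulmx det_diag (bigD1 (lshift n ord0))//= !mxE.
by rewrite subrr mul0r mulr0 mul0r.
Qed.
End deflation.

(** * The secular function *)

Section limits.
Variable R : realType.

Lemma cvg_sum_fin (T I : Type) (A : set_system T) {FA : Filter A} (r : seq I)
    (F : I -> T -> R) (G : I -> R) :
  (forall i, F i t @[t --> A] --> G i) ->
  \sum_(i <- r) F i t @[t --> A] --> \sum_(i <- r) G i.
Proof.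
move=> FG; elim: r => [|i r IH].
  by under eq_fun do rewrite big_nil; rewrite big_nil; exact: cvg_cst.
under eq_fun do rewrite big_cons; rewrite big_cons.
exact: cvgD (FG i) IH.
Qed.

(** Differentiability in the form of Carathéodory: the difference quotient extends continuously to
    [x]. *)
Lemma is_derive_quotient (f : R -> R) (tau : R -> R) (x : R) (d : R) :
  0 < d -> (forall y, `|y - x| < d -> f y - f x = (y - x) * tau y) ->
  tau y @[y --> x] --> tau x -> is_derive x 1 f (tau x).
Proof.
move=> d0 ftau ctau.
have cv : h^-1 *: ((f \o shift x) (h *: 1) - f x) @[h --> 0^'] --> tau x.
  have c1 : tau (h + x) @[h --> 0^'] --> tau x.
    have hx : h + x @[h --> 0^'] --> x.
      apply/cvgrPdist_lt => e e0; near=> h.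
      rewrite opprD addrCA subrr addr0 normrN; near: h; exact: dnbhs0_lt.
    exact: (@cvg_comp _ _ _ (fun h => h + x) tau _ (nbhs x)).
  apply: cvg_trans c1; apply: near_eq_cvg.
  near=> h.
  have h0 : h != 0 by near: h; exact: nbhs_dnbhs_neq.
  have hd : `|h| < d.
    by near: h; apply: dnbhs0_lt.
  by rewrite /= /GRing.scale/= mulr1 ftau addrK// mulKf.
by apply: DeriveDef; [apply/cvg_ex; exists (tau x)|apply/cvg_lim].
Unshelve. all: by end_near. Qed.
End limits.

Lemma measurable_indic_posdef d (T : measurableType d) (R : realType) n
    (f : T -> 'M[R]_n) : measurable_fun setT f ->
  measurable_fun setT (fun x => \1_(posdef R n) (f x) : R).
Proof.
move=> mf; apply: (measurableT_comp _ mf); apply: measurable_indic.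
exact: measurable_posdef.
Qed.

Section secular.
Variables (R : realType) (n : nat).
Variables (s11 : 'M[R]_1) (s12 w : 'rV[R]_n) (S' W' : 'M[R]_n).
Hypothesis pS : posdef R (1 + n) (sym_block s11 s12 S').
Hypothesis W'T : W'^T = W'.

Let pS' : posdef R n S'.
Proof. by have := posdef_drsubmx pS; rewrite /sym_block block_mxKdr. Qed.

Let S'T : S'^T = S'. Proof. exact: posdef_sym. Qed.

Definition sec_N (l : R) := l *: S' - W'.
Definition sec_n (l : R) := l *: s12 - w.
Definition sec_y (l : R) := sec_n l *m invmx (sec_N l).
Definition sec_phi (l : R) : R :=
  (l *: s11 - sec_n l *m invmx (sec_N l) *m (sec_n l)^T) ord0 ord0.
Definition sec_tau (l m : R) : R :=
  (s11 - sec_y l *m s12^T - s12 *m (sec_y m)^T + sec_y l *m S' *m (sec_y m)^T) ord0 ord0.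
Definition sec_D : set R := [set l | posdef R n (sec_N l)].

Lemma sec_D_up x y : sec_D x -> x <= y -> sec_D y.
Proof.
rewrite /sec_D/= => px; rewrite le_eqVlt => /predU1P[<-//|xy].
rewrite (_ : sec_N y = sec_N x + (y - x) *: S').
  by apply: posdefD => //; apply: posdefZ => //; rewrite subr_gt0.
by apply/matrixP => i j; rewrite !mxE; ring.
Qed.

Lemma sec_D_open x : sec_D x -> exists2 d : R, 0 < d & forall y, `|y - x| <= d -> sec_D y.
Proof.
rewrite /sec_D/= => px; have [d d0 dP] := posdef_open px S'T.
exists d => // y yx; rewrite (_ : sec_N y = sec_N x + (y - x) *: S'); first exact: dP.
by apply/matrixP => i j; rewrite !mxE; ring.
Qed.

Let N_unit l : sec_D l -> sec_N l \in unitmx. Proof. exact: posdef_unit. Qed.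

Let yN l : sec_D l -> sec_y l *m sec_N l = sec_n l.
Proof. by move=> Dl; rewrite mulmxKV// N_unit. Qed.

Let NT l : (sec_N l)^T = sec_N l.
Proof. by rewrite /sec_N linearB/= linearZ/= S'T W'T. Qed.

(** Substitute (l - m) s12 = n_l - n_m and (l - m) S' = N_l - N_m into the right side; with y N = n
    everything telescopes. The derivative of [sec_phi] follows without differentiating a matrix
    inverse. *)
Lemma sec_phiB l m : sec_D l -> sec_D m ->
  sec_phi l - sec_phi m = (l - m) * sec_tau l m.
Proof.
move=> Dl Dm.
have yNm : sec_N m *m (sec_y m)^T = (sec_n m)^T by rewrite -(yN Dm) [RHS]trmx_mul NT.
have sc (a : R) (A : 'M[R]_1) : a * A ord0 ord0 = (a *: A) ord0 ord0 by rewrite mxE.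
have sb (A B : 'M[R]_1) : A ord0 ord0 - B ord0 ord0 = (A - B) ord0 ord0 by rewrite !mxE.
rewrite /sec_phi /sec_tau sc sb -!/(sec_y _); congr (fun_of_matrix _ ord0 ord0).
have dn : (l - m) *: s12 = sec_n l - sec_n m.
  by rewrite /sec_n opprB addrA subrK scalerBl.
have dN : (l - m) *: S' = sec_N l - sec_N m.
  by rewrite /sec_N opprB addrA subrK scalerBl.
have e1 : (l - m) *: (sec_y l *m s12^T) = sec_y l *m (sec_n l)^T - sec_y l *m (sec_n m)^T.
  by rewrite scalemxAr -linearZ/= dn linearB/= mulmxBr.
have e2 : (l - m) *: (s12 *m (sec_y m)^T) = sec_n l *m (sec_y m)^T - sec_n m *m (sec_y m)^T.
  by rewrite scalemxAl dn mulmxBl.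
have e3 : (l - m) *: (sec_y l *m S' *m (sec_y m)^T) =
    sec_n l *m (sec_y m)^T - sec_y l *m (sec_n m)^T.
  by rewrite scalemxAl scalemxAr dN mulmxBr yN// mulmxBl -[X in _ - X]mulmxA yNm.
have e4 : sec_n m *m (sec_y m)^T = sec_y m *m (sec_n m)^T.
  by apply/matrixP => i j; rewrite !ord1 -[in LHS](trmxK (sec_n m)) -trmx_mul mxE.
rewrite scalerDr !scalerBr e1 e2 e3 e4 scalerBl.
by apply/matrixP => i j; rewrite !mxE; ring.
Qed.

(** By the adjugate formula over polynomials the entries of [sec_y] are rational functions of [l],
    hence continuous where [sec_N] is invertible. *)
Let polN : 'M[{poly R}]_n := 'X *: map_mx polyC S' - map_mx polyC W'.
Let poln : 'rV[{poly R}]_n := 'X *: map_mx polyC s12 - map_mx polyC w.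

Let polNE l : map_mx (horner_eval l) polN = sec_N l.
Proof. by apply/matrixP => i j; rewrite !mxE horner_evalE !hornerE. Qed.

Let polnE l : map_mx (horner_eval l) poln = sec_n l.
Proof. by apply/matrixP => i j; rewrite !mxE horner_evalE !hornerE. Qed.

Let yE l k : sec_D l ->
  sec_y l ord0 k = ((\det polN).[l])^-1 * ((poln *m \adj polN) ord0 k).[l].
Proof.
move=> Dl; rewrite /sec_y /invmx N_unit// -scalemxAr mxE; congr (_^-1 * _).
  by rewrite -polNE -horner_evalE det_map_mx.
by rewrite -polNE -polnE -map_mx_adj -map_mxM mxE.
Qed.

Lemma sec_y_cvg x k : sec_D x -> sec_y l ord0 k @[l --> x] --> sec_y x ord0 k.
Proof.
move=> Dx; rewrite yE//.
have : ((\det polN).[l])^-1 * ((poln *m \adj polN) ord0 k).[l] @[l --> x] -->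
   ((\det polN).[x])^-1 * ((poln *m \adj polN) ord0 k).[x].
  apply: cvgM; last exact: continuous_horner.
  apply: cvgV; last exact: continuous_horner.
  rewrite -horner_evalE -det_map_mx polNE.
  by have := N_unit Dx; rewrite unitmxE unitfE.
apply: cvg_trans; apply: near_eq_cvg.
have [d d0 dP] := sec_D_open Dx.
near=> l; rewrite yE//; apply: dP; rewrite distrC.
near: l; exact: cvgr_dist_le.
Unshelve. all: by end_near. Qed.

(** It is the corner entry of the conjugate of S by [unip_up (- sec_y l)], which is again positive
    definite. *)
Lemma sec_tau_gt0 l : 0 < sec_tau l l.
Proof.
have := posdef_congr (unip_up_unit (- sec_y l)) pS.
rewrite unip_up_sym_block// => /posdef_sym_blockP[+ _].
rewrite (_ : _ + s11 = s11 - sec_y l *m s12^T - s12 *m (sec_y l)^T +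
  sec_y l *m S' *m (sec_y l)^T)//.
by rewrite linearN/= !mulNmx !mulmxN opprK addrC !addrA.
Qed.

(** Covers both uses: the constant [m] gives the derivative of [sec_phi], the identity gives the
    continuity of that derivative. *)
Lemma sec_tau_cvg2 (m : R -> R) x : sec_D x ->
  (forall k, sec_y (m l) ord0 k @[l --> x] --> sec_y x ord0 k) ->
  sec_tau l (m l) @[l --> x] --> sec_tau x x.
Proof.
move=> Dx ym.
have tauE a b : sec_tau a b = s11 ord0 ord0 - \sum_k sec_y a ord0 k * s12 ord0 k
    - \sum_k s12 ord0 k * sec_y b ord0 k
    + \sum_j (\sum_i sec_y a ord0 i * S' i j) * sec_y b ord0 j.
  rewrite /sec_tau !mxE; congr (_ - _ - _ + _).
  - by apply: eq_bigr => k _; rewrite !mxE.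
  - by apply: eq_bigr => k _; rewrite !mxE.
  - by apply: eq_bigr => k _; rewrite !mxE.
under eq_fun do rewrite tauE; rewrite tauE.
apply: cvgD; [apply: cvgB; [apply: cvgB; first exact: cvg_cst|]|].
- by apply: cvg_sum_fin => k; apply: cvgMl; exact: sec_y_cvg.
- by apply: cvg_sum_fin => k; apply: cvgMr; exact: ym.
- apply: cvg_sum_fin => j; apply: cvgM; last exact: ym.
  by apply: cvg_sum_fin => k; apply: cvgMl; exact: sec_y_cvg.
Qed.

Lemma sec_phi_derive x : sec_D x -> is_derive x 1 sec_phi (sec_tau x x).
Proof.
move=> Dx; have [d d0 dP] := sec_D_open Dx.
apply: (is_derive_quotient (tau := fun y => sec_tau y x) d0) => [y yx|].
  by apply: sec_phiB => //; apply: dP; exact: ltW.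
by apply: (@sec_tau_cvg2 (fun=> x)) => // k; exact: cvg_cst.
Qed.

(** Conjugation by [unip_up (- sec_y a)] makes a S - W block diagonal. Its lower block is
    invertible, so the corner, which is [sec_phi a] minus the entry of [c], must vanish. *)
Lemma secular_root a c : sec_D a ->
  \det (a *: sym_block s11 s12 S' - sym_block c w W') = 0 -> sec_phi a = c ord0 ord0.
Proof.
move=> Da.
have -> : a *: sym_block s11 s12 S' - sym_block c w W' =
    sym_block (a *: s11 - c) (sec_n a) (sec_N a).
  by rewrite /sym_block scale_block_mx opp_block_mx add_block_mx /sec_n linearB/= linearZ.
set M := sym_block _ _ _ => dM.
have : \det (unip_up (- sec_y a) *m M *m (unip_up (- sec_y a))^T) = 0.
  by rewrite !det_mulmx dM mulr0 mul0r.
rewrite unip_up_sym_block ?NT// !mulNmx (yN Da) addNr /sym_block trmx0 det_lblock.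
move/eqP; rewrite mulf_eq0 => /orP[|]; last first.
  by have := N_unit Da; rewrite unitmxE unitfE => /negbTE ->.
rewrite addrK det_mx11 => /eqP e.
apply/eqP; rewrite -subr_eq0 -e /sec_phi -/(sec_y a).
have -> : sec_y a *m (sec_n a)^T = sec_n a *m (sec_y a)^T.
  by apply/matrixP => i j; rewrite !ord1 -[in LHS](trmxK (sec_y a)) -trmx_mul mxE.
by apply/eqP; rewrite !mxE; ring.
Qed.

Lemma measurable_sec_phi : measurable_fun setT sec_phi.
Proof. by rewrite /sec_phi /sec_n /sec_N; mx_measurable. Qed.

Lemma measurable_sec_tau : measurable_fun setT (fun l => sec_tau l l).
Proof. by rewrite /sec_tau /sec_y /sec_n /sec_N; mx_measurable. Qed.

Lemma integral_secular (F : 'M[R]_1 -> \bar R) : measurable_fun setT F ->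
  (forall c, 0 <= F c)%E ->
  (forall c, F c != 0%E -> exists2 a, sec_D a & sec_phi a = c ord0 ord0) ->
  (\int[mxL R 1 1]_l
     ((\1_(posdef R n) (sec_N (l ord0 ord0)) * sec_tau (l ord0 ord0) (l ord0 ord0))%:E
      * F (sec_phi (l ord0 ord0))%:M) = \int[mxL R 1 1]_c F c)%E.
Proof.
move=> mF F0 FD.
have mD : measurable sec_D.
  rewrite -[X in measurable X]setTI.
  have : measurable_fun setT sec_N by rewrite /sec_N; mx_measurable.
  by apply=> //; exact: measurable_posdef.
have mphiM : measurable_fun setT (fun x : R => F x%:M).
  by apply: measurableT_comp => //; mx_measurable.
have tau0 x := ltW (sec_tau_gt0 x).
rewrite (integral_mxL11 mF F0) integral_mxL11; last first.
- by move=> c; rewrite mule_ge0// lee_fin mulr_ge0.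
- apply: emeasurable_funM.
    apply: measurable_EFin_comp; apply: measurable_funM.
      by apply: measurable_indic_posdef; rewrite /sec_N; mx_measurable.
    rewrite /sec_tau /sec_y /sec_n /sec_N; mx_measurable.
  apply: measurableT_comp => //; apply: measurable_scalar_mx.
  by rewrite /sec_phi /sec_n /sec_N; mx_measurable.
have sD := @substitution_upclosed _ sec_phi (fun x => sec_tau x x)
  measurable_sec_phi measurable_sec_tau sec_D (fun x => F x%:M) sec_D_up.
rewrite -[RHS]sD; first last.
- by move=> y /FD[x Dx phx]; exists x; rewrite // phx mxE eqxx.
- by move=> y.
- exact: mphiM.
- by move=> x _; exact: sec_tau_gt0.
- by move=> x Dx; apply: (@sec_tau_cvg2 id) => // k; exact: sec_y_cvg.
- by move=> x; exact: sec_phi_derive.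
(* [sec_D] has no least element because positive definiteness is an open condition. *)
- move=> x /sec_D_open[d d0 dP]; exists (x - d); first by rewrite ltrBlDr ltrDl.
  by apply: dP; rewrite addrAC subrr add0r normrN gtr0_norm.
rewrite [RHS]integral_mkcond; apply: eq_integral => x _.
rewrite patchE indicE !mxE eqxx mulr1n /sec_D.
case: (boolP (x \in _)) => xD.
  by rewrite (mem_set (set_mem xD : posdef R n (sec_N x))) mul1r muleC.
rewrite (_ : _ \in _ = false) ?mul0r ?mul0e//.
by apply: contraNF xD => H; exact/mem_set/(set_mem H).
Qed.
End secular.

Lemma measurable_interlaced (R : realType) n : measurable (@interlaced R n).
Proof.
have -> : @interlaced R n = \bigcup_(q : rat) (
    ((fun w : 'M[R]_(1 + n) * 'M[R]_(1 + n) => ratr q *: drsubmx w.1 - drsubmx w.2) @^-1` posdef R n) `&`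
    ~` ((fun w : 'M[R]_(1 + n) * 'M[R]_(1 + n) => ratr q *: w.1 - w.2) @^-1` posdef R (1 + n))).
  by apply/seteqP; split=> w; [move=> [q [? ?]]; exists q|move=> [q _ [? ?]]; exists q].
apply: bigcupT_measurable_rat => q; apply: measurableI; last apply: measurableC.
- rewrite -[X in measurable X]setTI.
  have : measurable_fun setT (fun w : 'M[R]_(1 + n) * 'M[R]_(1 + n) =>
    ratr q *: drsubmx w.1 - drsubmx w.2) by mx_measurable.
  by apply=> //; exact: measurable_posdef.
- rewrite -[X in measurable X]setTI.
  have : measurable_fun setT (fun w : 'M[R]_(1 + n) * 'M[R]_(1 + n) =>
    ratr q *: w.1 - w.2) by mx_measurable.
  by apply=> //; exact: measurable_posdef.
Qed.

(** * The change of variables *)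

Ltac pencil_measurable :=
  mx_measurable;
  try (first [apply: measurable_indic_posdef | apply: measurable_sym_block
             | apply: measurable_maxr]; pencil_measurable).

Section scaled_substitutions.
Variable R : realType.

Lemma integral_mulmxr_row_in n (M : 'M[R]_n) (f : 'rV[R]_n -> \bar R) :
  M \in unitmx -> measurable_fun setT f -> (forall v, 0 <= f v)%E ->
  (\int[mxL R 1 n]_v f v = \int[mxL R 1 n]_v (`|\det M|%:E * f (v *m M)))%E.
Proof.
move=> uM mf f0; rewrite -(integral_mulmxr_row uM mf f0) ge0_integralZl//.
- by mx_measurable.
Qed.

Lemma integral_mxL_scale_in m n (a : R) (f : 'M[R]_(m, n) -> \bar R) :
  a != 0 -> measurable_fun setT f -> (forall A, 0 <= f A)%E ->
  (\int[mxL R m n]_A f A = \int[mxL R m n]_A ((`|a| ^+ (m * n))%:E * f (a *: A)%R))%E.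
Proof.
move=> a0 mf f0; rewrite -(integral_mxL_affine 0 a0 mf f0) ge0_integralZl//.
- by congr (_ * _)%E; apply: eq_integral => A _; rewrite add0r.
- by mx_measurable.
Qed.

Lemma integral2Zl d1 d2 (T1 : measurableType d1) (T2 : measurableType d2)
    (m1 : {sigma_finite_measure set T1 -> \bar R})
    (m2 : {sigma_finite_measure set T2 -> \bar R}) (k : R) (f : T1 -> T2 -> \bar R) :
  0 <= k -> measurable_fun setT (fun x => f x.1 x.2) -> (forall x y, 0 <= f x y)%E ->
  (\int[m1]_x \int[m2]_y (k%:E * f x y) = k%:E * \int[m1]_x \int[m2]_y f x y)%E.
Proof.
move=> k0 mf f0.
have mf2 x : measurable_fun setT (f x) by exact: (measurableT_comp mf (pair1_measurable x)).
rewrite -ge0_integralZl//.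
- by apply: eq_integral => x _; rewrite ge0_integralZl.
- exact: measurable_integral.
- by move=> x _; integral_nonneg.
Qed.
End scaled_substitutions.

(** * Removing the first row and column *)

Section deflation_step.
Variables (R : realType) (n : nat) (h : 'M[R]_(1 + n) * 'M[R]_(1 + n) -> \bar R).
Hypothesis mh : measurable_fun setT h.
Hypothesis h0 : forall w, (0 <= h w)%E.
Hypothesis hY : forall w, h w != 0%E -> simple_pencils w.
Hypothesis hE : forall w, h w != 0%E -> interlaced w.

(** The determinant is the Jacobian of y -> y N, by which [y] later becomes part of the first row of
    W. *)
Definition cone_weight (N : 'M[R]_n) : R := \1_(posdef R n) N * `|\det N|.

(** For positive definite [N] this is a positive semidefinite matrix of corank one with lower block
    [N]: the shape of a S - W at the top root [a]. *)
Definition low_cone (y : 'rV[R]_n) (N : 'M[R]_n) : 'M[R]_(1 + n) :=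
  unip_up y *m block_mx 0 0 0 N *m (unip_up y)^T.

(** The corner entry stands for s = b^2 and is positive when [S] is positive definite; the maximum
    removes the range s <= 0 and keeps the integrand nonnegative. *)
Definition cone_integrand (a : 'M[R]_1) (N : 'M[R]_n) (y : 'rV[R]_n) (S : 'M[R]_(1 + n)) :=
  ((cone_weight N *
    Num.max 0 (ulsubmx (unip_up (- y) *m S *m (unip_up (- y))^T) ord0 ord0))%:E
   * h (S, (a ord0 ord0 *: S - low_cone y N)%R))%E.

Definition schur_up (s : 'M[R]_1) (w : 'rV[R]_n) (S : 'M[R]_n) : 'M[R]_(1 + n) :=
  sym_block s w ((s ord0 ord0)^-1 *: (w^T *m w) + S).

Definition schur_integrand a N y S := cone_integrand a N y (unip_up y *m S *m (unip_up y)^T).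

(** The function of the smaller pencil to which the induction hypothesis is applied, for fixed top
    root [a]. *)
Definition deflated a (w : 'M[R]_n * 'M[R]_n) : \bar R :=
  (\int[mxL R 1 n]_y \int[mxL R 1 1]_s \int[mxL R 1 n]_v
    schur_integrand a (a ord0 ord0 *: w.1 - w.2) y (schur_up s v w.1))%E.

Lemma cone_weight_ge0 N : 0 <= cone_weight N.
Proof. by rewrite mulr_ge0. Qed.

Lemma cone_integrand_ge0 a N y S : (0 <= cone_integrand a N y S)%E.
Proof. by rewrite mule_ge0// lee_fin mulr_ge0// ?cone_weight_ge0// le_max lexx. Qed.

Lemma schur_integrandE a N y S : schur_integrand a N y S =
  ((cone_weight N * Num.max 0 (ulsubmx S ord0 ord0))%:E
   * h (unip_up y *m S *m (unip_up y)^T,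
        (a ord0 ord0 *: (unip_up y *m S *m (unip_up y)^T) - low_cone y N)%R))%E.
Proof.
rewrite /schur_integrand /cone_integrand; congr ((_ * Num.max _ (ulsubmx _ _ _))%:E * _)%E.
have UN : unip_up (- y) *m unip_up y = 1%:M.
  rewrite /unip_up mulmx_block !(mul1mx, mulmx1, mul0mx, mulmx0, addr0, add0r) addrN.
  by rewrite -scalar_mx_block.
by rewrite !mulmxA UN mul1mx -mulmxA -trmx_mul UN trmx1 mulmx1.
Qed.

Lemma measurable_cone_integrand d (T : measurableType d) (a : T -> 'M[R]_1) N y S :
  measurable_fun setT a -> measurable_fun setT N -> measurable_fun setT y ->
  measurable_fun setT S -> measurable_fun setT (fun t => cone_integrand (a t) (N t) (y t) (S t)).
Proof.
by move=> ma mN my mS; rewrite /cone_integrand /cone_weight /low_cone /unip_up; pencil_measurable.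
Qed.

Lemma measurable_schur_integrand d (T : measurableType d) (a : T -> 'M[R]_1) N y S :
  measurable_fun setT a -> measurable_fun setT N -> measurable_fun setT y ->
  measurable_fun setT S -> measurable_fun setT (fun t => schur_integrand (a t) (N t) (y t) (S t)).
Proof.
move=> ma mN my mS; apply: measurable_cone_integrand => //.
by rewrite /unip_up; pencil_measurable.
Qed.

Lemma schur_integrand_ge0 a N y S : (0 <= schur_integrand a N y S)%E.
Proof. exact: cone_integrand_ge0. Qed.

Lemma deflated_ge0 a w : (0 <= deflated a w)%E.
Proof. by integral_nonneg; exact: schur_integrand_ge0. Qed.

Lemma measurable_deflated :
  measurable_fun setT (fun x : 'M[R]_1 * ('M[R]_n * 'M[R]_n) => deflated x.1 x.2).
Proof.
rewrite /deflated.
apply: (measurable_integral (m2 := mxL R 1 n) (fun (x : 'M[R]_1 * ('M[R]_n * 'M[R]_n)) y =>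
  \int[mxL R 1 1]_s \int[mxL R 1 n]_v
    schur_integrand x.1 (x.1 ord0 ord0 *: x.2.1 - x.2.2) y (schur_up s v x.2.1)))%E; last first.
  by integral_nonneg; exact: schur_integrand_ge0.
apply: (measurable_integral (m2 := mxL R 1 1) (fun (x : ('M[R]_1 * ('M[R]_n * 'M[R]_n)) * 'rV[R]_n) s =>
  \int[mxL R 1 n]_v
    schur_integrand x.1.1 (x.1.1 ord0 ord0 *: x.1.2.1 - x.1.2.2) x.2 (schur_up s v x.1.2.1)))%E; last first.
  by integral_nonneg; exact: schur_integrand_ge0.
apply: (measurable_integral (m2 := mxL R 1 n) (fun (x : (('M[R]_1 * ('M[R]_n * 'M[R]_n)) * 'rV[R]_n) * 'M[R]_1) v =>
    schur_integrand x.1.1.1 (x.1.1.1 ord0 ord0 *: x.1.1.2.1 - x.1.1.2.2) x.1.2 (schur_up x.2 v x.1.1.2.1)))%E; last first.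
  by move=> *; exact: schur_integrand_ge0.
by apply: measurable_schur_integrand; rewrite /schur_up; pencil_measurable.
Qed.

Lemma pencil_mul m (U C : 'M[R]_m) l :
  pencil (U *m C) l = (U *m (pencil C l).1 *m U^T, U *m (pencil C l).2 *m U^T).
Proof. by rewrite /pencil/= trmx_mul !mulmxA. Qed.

Lemma pencil_schur (b a : 'M[R]_1) (w l : 'rV[R]_n) (B : 'M[R]_n) : b ord0 ord0 != 0 ->
  pencil (block_mx b 0 ((b ord0 ord0)^-1 *: w^T) B) (row_mx a l) =
  (schur_up (b *m b) w (pencil B l).1,
   a ord0 ord0 *: schur_up (b *m b) w (pencil B l).1 -
   block_mx 0 0 0 (a ord0 ord0 *: (pencil B l).1 - (pencil B l).2)).
Proof.
move=> b0; rewrite pencil_block !mul0mx !addr0 trmx0 !mulmx0 !addr0.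
have bE (A : 'M[R]_1) : A = (A ord0 ord0)%:M := mx11E A.
move: b0; rewrite [b]bE [a]bE; move: (b ord0 ord0) (a ord0 ord0) => {b a}b a.
rewrite !mxE eqxx !mulr1n => b0.
rewrite !tr_scalar_mx -!scalar_mxM linearZ/= trmxK !mul_scalar_mx !mul_mx_scalar.
rewrite -?scalemxAl -?scalemxAr -?scalemxAl !scalerA /schur_up /sym_block.
move: (w^T *m w) (B *m B^T) (B *m diag_mx l *m B^T) => ww BB BLB.
rewrite !mxE eqxx mulr1n mulfV// !scale1r.
rewrite scale_block_mx opp_block_mx add_block_mx !subr0.
congr (_, _); congr block_mx.
- by congr (_ *: _ + _); field.
- by rewrite scale_scalar_mx; congr scalar_mx; ring.
- by congr (_ *: _); field.
- by congr (_ *: _); field.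
- by apply/matrixP => i j; rewrite !mxE; field.
Qed.

Lemma measurable_jac d (T : measurableType d) m (B : T -> 'M[R]_m) (l : T -> 'rV[R]_m) :
  measurable_fun setT B -> measurable_fun setT l ->
  measurable_fun setT (fun t => jac (B t) (l t)).
Proof.
move=> mB ml; rewrite /jac; apply: measurable_funM.
  (* The indicator of a decreasing row is a finite product of indicators of comparisons. *)
  rewrite (_ : (fun t => _) = (fun t => \prod_(i < m) \prod_(j < m)
      ((i < j)%N ==> (l t ord0 j < l t ord0 i)%R)%:R)); last first.
    apply/funext => t; case: (boolP (decr (l t))) => [/decrP dl|].
      rewrite big1// => i _; rewrite big1// => j _.
      by case: (boolP (i < j)%N) => // /dl ->.
    move=> /forallPn[i /forallPn[j ij]]; rewrite (bigD1 i)//= (bigD1 j)//=.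
    by rewrite (negbTE ij) !mul0r.
  apply: measurable_prod => i _; apply: measurable_prod => j _.
  case: (i < j)%N => /=; last exact: measurable_cst.
  apply: (measurableT_comp (f := fun b : bool => b%:R : R)) => //.
  by apply: measurable_fun_ltr; mx_measurable.
rewrite /vdm; apply: measurable_funM; first by mx_measurable.
apply: measurable_prod => i _; under eq_fun do rewrite big_mkcond/=.
by apply: measurable_prod => j _; case: (i < j)%N; mx_measurable.
Qed.

(** Both sides vanish. On the left, a nonzero integrand would have an interlaced pencil and so an
    invertible [B]. On the right, [jac] kills singular [B] and unordered [l], and the cone weight
    kills an [a] that is not above all of [l]. *)
Lemma integral_deflation_degenerate a l B : ~~ ((B \in unitmx) && decr (row_mx a l : 'rV_(1 + n))) ->
  (\int[mxL R 1 n]_z \int[mxL R n 1]_x \int[mxL R 1 1]_b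
     (h (pencil (block_mx b z x B) (row_mx a l)) * (jac (block_mx b z x B) (row_mx a l))%:E) =
   (jac B l)%:E * deflated a (pencil B l))%E.
Proof.
move=> ndeg; transitivity (0%E : \bar R).
  apply: integral0_eq => z _; apply: integral0_eq => x _; apply: integral0_eq => b _.
  apply/eqP; rewrite mule_eq0; set C := block_mx _ _ _ _.
  have [//|hC] := eqVneq (h _) 0%E; rewrite eqe /= /jac.
  case: (boolP (decr _)) => [dr|]; last by rewrite mul0r.
  case: (boolP (C \in unitmx)) => [uC|]; last first.
    by rewrite unitmxE unitfE negbK => /eqP ->; rewrite normr0 expr0n mul0r mulr0.
  by exfalso; move: ndeg; rewrite dr andbT (interlaced_unit uC dr (hE hC)).
symmetry; apply/eqP; rewrite mule_eq0 eqe.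
case: (boolP (B \in unitmx)) ndeg => [uB|]; last first.
  by rewrite /jac unitmxE unitfE negbK => /eqP ->; rewrite normr0 expr0n mul0r mulr0 eqxx.
rewrite /= decr_row_mx negb_and => /orP[ndl|/forallPn[j la]].
  by rewrite /jac (negbTE ndl) mul0r eqxx.
apply/orP; right; apply/eqP.
have cw : cone_weight (a ord0 ord0 *: (pencil B l).1 - (pencil B l).2) = 0.
  rewrite /cone_weight indicE memNset ?mul0r// => /posdef_pencil/(_ j).
  by move=> /(_ uB) aj; rewrite aj in la.
apply: integral0_eq => y _; apply: integral0_eq => s _; apply: integral0_eq => v _.
by rewrite schur_integrandE cw mul0r mul0e.
Qed.

Let F a l B b z x : \bar R :=
  (h (pencil (block_mx b z x B) (row_mx a l)) * (jac (block_mx b z x B) (row_mx a l))%:E)%E.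

Let F_ge0 a l B b z x : (0 <= F a l B b z x)%E.
Proof. by rewrite mule_ge0// lee_fin jac_ge0. Qed.

Let mF d (T : measurableType d) a l B (b : T -> 'M[R]_1) z x : measurable_fun setT b ->
  measurable_fun setT z -> measurable_fun setT x ->
  measurable_fun setT (fun t => F a l B (b t) (z t) (x t)).
Proof.
move=> mb mz mx; apply: emeasurable_funM.
  by rewrite /pencil; mx_measurable.
by apply: measurable_EFin_comp; apply: measurable_jac; mx_measurable.
Qed.

Let Gf a l B y (s : 'M[R]_1) : \bar R := (\int[mxL R 1 n]_w
  ((`|\det B| ^+ n.+3 * vdm (row_mx a l : 'rV[R]_(1 + n)) * Num.max 0 (s ord0 ord0))%:E
   * h (unip_up y *m schur_up s w (B *m B^T) *m (unip_up y)^T,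
        (a ord0 ord0 *: (unip_up y *m schur_up s w (B *m B^T) *m (unip_up y)^T)
         - low_cone y (a ord0 ord0 *: (pencil B l).1 - (pencil B l).2))%R)))%E.

Let Gf_ge0 a l B y s : decr (row_mx a l : 'rV_(1 + n)) -> (0 <= Gf a l B y s)%E.
Proof.
move=> dl; integral_nonneg; rewrite mule_ge0// lee_fin mulr_ge0 ?le_max ?lexx//.
by rewrite mulr_ge0// ltW// vdm_ge0.
Qed.

Let mGf a l B y : decr (row_mx a l : 'rV_(1 + n)) -> measurable_fun setT (Gf a l B y).
Proof.
move=> dl; rewrite /Gf.
apply: (measurable_integral (m2 := mxL R 1 n) (fun (s : 'M[R]_1) (w : 'rV[R]_n) =>
  ((`|\det B| ^+ n.+3 * vdm (row_mx a l : 'rV[R]_(1 + n)) * Num.max 0 (s ord0 ord0))%:E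
   * h (unip_up y *m schur_up s w (B *m B^T) *m (unip_up y)^T,
        (a ord0 ord0 *: (unip_up y *m schur_up s w (B *m B^T) *m (unip_up y)^T)
         - low_cone y (a ord0 ord0 *: (pencil B l).1 - (pencil B l).2))%R))))%E.
  by rewrite /low_cone /schur_up; pencil_measurable.
move=> s w; rewrite mule_ge0// lee_fin mulr_ge0 ?le_max ?lexx//.
by rewrite mulr_ge0// ltW// vdm_ge0.
Qed.

(** Powers of |b|: n + 3 from the determinant, minus n from x = b^-1 w^t. Of the remaining |b|^3,
    one factor is used up by the substitution s = b^2 and the other two make the weight [s] in
    [Gf]. *)
Let F_Gf a l B y b : decr (row_mx a l : 'rV_(1 + n)) ->
  (\int[mxL R n 1]_x F a l B (y *m x + b) (y *m B) x =
   `|b ord0 ord0|%:E * Gf a l B y (b *m b))%E.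
Proof.
move=> dl.
have blockE x : block_mx (y *m x + b) (y *m B) x B = unip_up y *m block_mx b 0 x B.
  by rewrite /unip_up mulmx_block !(mul1mx, mul0mx, mulmx0, addr0, add0r) addrC.
have detE x : \det (block_mx (y *m x + b) (y *m B) x B) = b ord0 ord0 * \det B.
  by rewrite blockE det_mulmx det_unip_up mul1r det_lblock det_mx11.
have [b0|b0] := eqVneq (b ord0 ord0) 0.
  rewrite b0 normr0 mul0e; apply: integral0_eq => x _.
  by rewrite /F /jac detE b0 mul0r normr0 expr0n mul0r mulr0 mule0.
have bV : (b ord0 ord0)^-1 != 0 by rewrite invr_eq0.
rewrite (integral_mxL_scale_in bV); first last.
- by move=> x; exact: F_ge0.
- by apply: mF; mx_measurable.
rewrite -(@integral_mxL_trmx _ 1 n (fun x => (`|(b ord0 ord0)^-1| ^+ (n * 1))%:E *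
   F a l B (y *m ((b ord0 ord0)^-1 *: x) + b) (y *m B) ((b ord0 ord0)^-1 *: x))%E); first last.
- by move=> x; rewrite mule_ge0// F_ge0.
- by apply: emeasurable_funM; [mx_measurable|apply: mF; mx_measurable].
rewrite /Gf -ge0_integralZl//; first last.
- by move=> w _; rewrite mule_ge0// lee_fin mulr_ge0 ?le_max ?lexx// mulr_ge0// ltW// vdm_ge0.
- by rewrite /low_cone /schur_up; pencil_measurable.
apply: eq_integral => w _.
rewrite /F /jac detE dl mul1r blockE pencil_mul pencil_schur//.
have sq : (b *m b) ord0 ord0 = b ord0 ord0 ^+ 2.
  by rewrite [b]mx11E -scalar_mxM mxE eqxx mulr1n !mxE eqxx mulr1n expr2.
have bb : 0 < b ord0 ord0 ^+ 2 by rewrite exprn_even_gt0.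
rewrite sq (max_idPr (ltW bb)) mulmxBr mulmxBl -scalemxAr -scalemxAl -/(low_cone _ _).
have key (H : \bar R) : ((`|(b ord0 ord0)^-1| ^+ (n * 1))%:E *
    (H * (`|b ord0 ord0 * \det B| ^+ n.+3 * vdm (row_mx a l : 'rV[R]_(1 + n)))%:E) =
   `|b ord0 ord0|%:E * ((`|\det B| ^+ n.+3 * vdm (row_mx a l : 'rV[R]_(1 + n)) *
     b ord0 ord0 ^+ 2)%:E * H))%E.
  rewrite (muleC H) !muleA -!EFinM; congr (_%:E * H)%E.
  rewrite muln1 normrM normfV exprVn exprMn -(real_normK (num_real (b ord0 ord0))).
  have x0 : `|b ord0 ord0| != 0 by rewrite normr_eq0.
  move: (`|b ord0 ord0|) x0 => x x0.
  by rewrite !(exprS x) expr0; have := expf_neq0 n x0; move: (x ^+ n) => X X0; field.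
exact: key.
Qed.

(* The substitutions are [z = y B], [b -> b + y x], [x = b^-1 w^t] and [s = b^2]. *)
Lemma integral_deflation a l B :
  (\int[mxL R 1 n]_z \int[mxL R n 1]_x \int[mxL R 1 1]_b
     (h (pencil (block_mx b z x B) (row_mx a l)) * (jac (block_mx b z x B) (row_mx a l))%:E) =
   (jac B l)%:E * deflated a (pencil B l))%E.
Proof.
have [/andP[uB dl]|] := boolP ((B \in unitmx) && decr (row_mx a l : 'rV_(1 + n))); last first.
  exact: integral_deflation_degenerate.
have mI : measurable_fun setT (fun z => \int[mxL R n 1]_x \int[mxL R 1 1]_b F a l B b z x)%E.
  apply: (measurable_integral (m2 := mxL R n 1)
    (fun z x => \int[mxL R 1 1]_b F a l B b z x))%E; last by integral_nonneg.
  apply: (measurable_integral (m2 := mxL R 1 1)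
    (fun z b => F a l B b z.1 z.2))%E; last by [].
  by apply: mF; mx_measurable.
rewrite (integral_mulmxr_row_in uB mI); last by integral_nonneg.
rewrite /deflated -ge0_integralZl//; first last.
- by rewrite lee_fin jac_ge0.
- by move=> y _; integral_nonneg; exact: schur_integrand_ge0.
- apply: (measurable_integral (m2 := mxL R 1 1)
    (fun y s => \int[mxL R 1 n]_v _))%E; last by integral_nonneg; exact: schur_integrand_ge0.
  apply: (measurable_integral (m2 := mxL R 1 n)
    (fun z v => schur_integrand _ _ z.1 (schur_up z.2 v _))); last by move=> *; exact: schur_integrand_ge0.
  by apply: measurable_schur_integrand; rewrite /schur_up; pencil_measurable.
apply: eq_integral => y _.
have -> : (\int[mxL R n 1]_x \int[mxL R 1 1]_b F a l B b (y *m B) x =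
   \int[mxL R 1 1]_b Gf a l B y b)%E.
  transitivity (\int[mxL R n 1]_x \int[mxL R 1 1]_b F a l B (y *m x + b) (y *m B) x)%E.
    apply: eq_integral => x _.
    rewrite (integral_mxL_shift (y *m x) (f := fun b => F a l B b (y *m B) x))//.
    by apply: mF; mx_measurable.
  rewrite (integral_swap (fun x b => F a l B (y *m x + b) (y *m B) x)); first last.
  - by [].
  - by apply: mF; mx_measurable.
  under eq_integral do rewrite F_Gf//.
  rewrite integral_mxL11_sqr; first last.
  - by move=> c; exact: Gf_ge0.
  - exact: mGf.
  apply: eq_integral => c _; case: ltP => [_|c0]; first by rewrite mul1e.
  rewrite mul0e; apply/esym/integral0_eq => w _.
  by rewrite (max_idPl c0) mulr0 mul0e.
pose N := a ord0 ord0 *: (pencil B l).1 - (pencil B l).2.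
pose H (s : 'M[R]_1) v := ((Num.max 0 (s ord0 ord0))%:E *
   h (unip_up y *m schur_up s v (B *m B^T) *m (unip_up y)^T,
        (a ord0 ord0 *: (unip_up y *m schur_up s v (B *m B^T) *m (unip_up y)^T)
         - low_cone y N)%R))%E.
have mH : measurable_fun setT (fun x => H x.1 x.2).
  by rewrite /H /low_cone /schur_up; pencil_measurable.
have H0 s v : (0 <= H s v)%E by rewrite mule_ge0// lee_fin le_max lexx.
(* Powers of |det B|: one from z = y B and n + 3 from the block determinant. On the other side, n +
   2 come from [jac B l] and two from det N, which also supplies the new factors a - l_j of the
   Vandermonde product. *)
transitivity (`|\det B|%:E *
    ((`|\det B| ^+ n.+3 * vdm (row_mx a l : 'rV[R]_(1 + n)))%:E *
      \int[mxL R 1 1]_s \int[mxL R 1 n]_v H s v))%E.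
  congr (_ * _)%E; rewrite -(integral2Zl _ _ _ mH H0); last first.
    by rewrite mulr_ge0// ltW// vdm_ge0.
  apply: eq_integral => s _; apply: eq_integral => v _.
  by rewrite EFinM -muleA.
transitivity ((jac B l)%:E * ((cone_weight N)%:E *
      \int[mxL R 1 1]_s \int[mxL R 1 n]_v H s v))%E; last first.
  congr (_ * _)%E; rewrite -(integral2Zl _ _ (cone_weight_ge0 N) mH H0).
  apply: eq_integral => s _; apply: eq_integral => v _.
  rewrite schur_integrandE [in RHS]EFinM -[in RHS]muleA.
  by have -> : ulsubmx (schur_up s v (pencil B l).1) = s by rewrite block_mxKul.
move: (integral _ _ _) => I.
rewrite !muleA -!EFinM; congr (_%:E * I)%E.
move: (dl); rewrite decr_row_mx => /andP[dl' /forallP la].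
have pN : posdef R n N by apply/posdef_pencil.
rewrite /jac dl' mul1r /cone_weight indicE mem_set// mul1r vdm_row_mx.
rewrite /N shift_pencil !det_mulmx det_tr det_diag !normrM normr_prod.
rewrite [in RHS](eq_bigr (fun j => a ord0 ord0 - l ord0 j)); last first.
  by move=> j _; rewrite !mxE gtr0_norm// subr_gt0.
rewrite !(exprS `|\det B|).
by move: (\prod_(i < n) _) => Q; ring.
Qed.

Lemma simple_pencils_sym m w : @simple_pencils R m w -> w.1^T = w.1 /\ w.2^T = w.2.
Proof.
move=> [B [l [_ _ ->]]]; split; rewrite /pencil/= !trmx_mul trmxK//.
by rewrite tr_diag_mx mulmxA.
Qed.

Lemma simple_pencils_posdef m w : @simple_pencils R m w -> posdef R m w.1.
Proof. by move=> [B [l [uB _ ->]]]; exact: posdef_mul_tr. Qed.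

(** Reflection in a S preserves the measure on symmetric matrices only when S is symmetric; other S
    contribute nothing. *)
Lemma schur_integrand_sym a N y s v S : S^T <> S -> schur_integrand a N y (schur_up s v S) = 0%E.
Proof.
move=> ST; rewrite schur_integrandE; apply/eqP; rewrite mule_eq0; apply/orP; right.
apply: contrapT => /negP/hY/simple_pencils_sym[/= + _]; apply: contra_not ST.
rewrite !trmx_mul trmxK mulmxA.
have uU := unip_up_unit y; have uUT : (unip_up y)^T \in unitmx by rewrite unitmx_tr.
move=> /(can_inj (mulmxK uUT))/(can_inj (mulKmx uU)).
rewrite /schur_up /sym_block tr_block_mx => /eq_block_mx[_ _ _].
by rewrite linearD/= linearZ/= trmx_mul trmxK => /addrI.
Qed.

(** Reflection in a S makes N a variable independent of S. The corner [s], the row [v] and the Schur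
    complement S then reassemble into a full symmetric matrix, and conjugation by [unip_up y]
    preserves its measure. *)
Lemma integral_deflated_up a :
  (\int[symL R n]_S \int[symL R n]_W deflated a (S, W) =
   \int[symL R n]_N \int[mxL R 1 n]_y \int[symL R (1 + n)]_S cone_integrand a N y S)%E.
Proof.
pose Kf S N : \bar R := (\int[mxL R 1 n]_y \int[mxL R 1 1]_s \int[mxL R 1 n]_v
  schur_integrand a N y (schur_up s v S))%E.
have Kf0 S N : (0 <= Kf S N)%E by integral_nonneg; exact: schur_integrand_ge0.
have mK3 : measurable_fun setT (fun x : 'M[R]_n * ('M[R]_n * 'rV[R]_n) =>
   \int[mxL R 1 1]_s \int[mxL R 1 n]_v schur_integrand a x.2.1 x.2.2 (schur_up s v x.1))%E.
  apply: (measurable_integral (m2 := mxL R 1 1) (fun (x : 'M[R]_n * ('M[R]_n * 'rV[R]_n)) s =>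
   \int[mxL R 1 n]_v schur_integrand a x.2.1 x.2.2 (schur_up s v x.1)))%E; last first.
    by integral_nonneg; exact: schur_integrand_ge0.
  apply: (measurable_integral (m2 := mxL R 1 n) (fun (x : ('M[R]_n * ('M[R]_n * 'rV[R]_n)) * 'M[R]_1) v =>
   schur_integrand a x.1.2.1 x.1.2.2 (schur_up x.2 v x.1.1)))%E; last first.
    by move=> *; exact: schur_integrand_ge0.
  by apply: measurable_schur_integrand; rewrite /schur_up; pencil_measurable.
have mKf S : measurable_fun setT (Kf S).
  apply: (measurable_integral (m2 := mxL R 1 n) (fun N y =>
     \int[mxL R 1 1]_s \int[mxL R 1 n]_v schur_integrand a N y (schur_up s v S)))%E; last first.
    by integral_nonneg; exact: schur_integrand_ge0.
  exact: (measurableT_comp mK3 (pair1_measurable S)).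
transitivity (\int[symL R n]_S \int[symL R n]_N Kf S N)%E.
  apply: eq_integral => S _.
  have [ST|ST] := pselect (S^T = S).
    have CT : (a ord0 ord0 *: S)^T = a ord0 ord0 *: S by rewrite linearZ/= ST.
    apply: etrans (integral_symL_reflect CT (mKf S) (Kf0 S)).
    by apply: eq_integral => W _; reflexivity.
  transitivity (0%E : \bar R).
    apply: integral0_eq => W _; apply: integral0_eq => y _; apply: integral0_eq => s _.
    by apply: integral0_eq => v _; exact: schur_integrand_sym.
  apply/esym/integral0_eq => W _; apply: integral0_eq => y _; apply: integral0_eq => s _.
  by apply: integral0_eq => v _; exact: schur_integrand_sym.
rewrite (integral_rotl (fun S N y => \int[mxL R 1 1]_s \int[mxL R 1 n]_v
   schur_integrand a N y (schur_up s v S))%E mK3); last by integral_nonneg; exact: schur_integrand_ge0.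
apply: eq_integral => N _; apply: eq_integral => y _.
apply: etrans (integral_symL_unip_up y (f := cone_integrand a N y) _ _); first last.
- exact: cone_integrand_ge0.
- by apply: measurable_cone_integrand; pencil_measurable.
rewrite (integral_symL_schur (k := fun c => (c ord0 ord0)^-1)); first last.
- by move=> S; exact: cone_integrand_ge0.
- by apply: measurable_cone_integrand; rewrite /unip_up; pencil_measurable.
- by mx_measurable.
by [].
Qed.

(** [cone_integrand] in the variable v = y N; the factor |det N| has been spent on this
    substitution. *)
Definition secular_integrand (a : 'M[R]_1) (N : 'M[R]_n) (v : 'rV[R]_n) (S : 'M[R]_(1 + n)) :=
  ((\1_(posdef R n) N *
    Num.max 0 (ulsubmx (unip_up (- (v *m invmx N)) *m S *m (unip_up (- (v *m invmx N)))^T) ord0 ord0))%:E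
   * h (S, (a ord0 ord0 *: S - low_cone (v *m invmx N) N)%R))%E.

Lemma secular_integrand_ge0 a N v S : (0 <= secular_integrand a N v S)%E.
Proof. by rewrite mule_ge0// lee_fin mulr_ge0// le_max lexx. Qed.

Lemma measurable_secular_integrand d (T : measurableType d) (a : T -> 'M[R]_1) N v S :
  measurable_fun setT a -> measurable_fun setT N -> measurable_fun setT v ->
  measurable_fun setT S -> measurable_fun setT (fun t => secular_integrand (a t) (N t) (v t) (S t)).
Proof.
by move=> ma mN mv mS; rewrite /secular_integrand /low_cone /unip_up; pencil_measurable.
Qed.

Lemma integral_cone_integrand_lin a N S :
  (\int[mxL R 1 n]_y cone_integrand a N y S = \int[mxL R 1 n]_v secular_integrand a N v S)%E.
Proof.
have [pN|pN] := pselect (posdef R n N); last first.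
  transitivity (0%E : \bar R); [|apply/esym]; apply: integral0_eq => y _.
    by rewrite /cone_integrand /cone_weight indicE memNset// !mul0r mul0e.
  by rewrite /secular_integrand indicE memNset// !mul0r mul0e.
have uN := posdef_unit pN.
apply/esym/(etrans (integral_mulmxr_row_in uN _ _)).
- by apply: measurable_secular_integrand; mx_measurable.
- by move=> v; exact: secular_integrand_ge0.
apply: eq_integral => y _; rewrite /secular_integrand /cone_integrand mulmxK// /cone_weight.
by rewrite muleA -EFinM indicE mem_set// !mul1r.
Qed.

(** Turns (N, v) into the lower block and the row of W by reflecting in the corresponding blocks of
    a S. *)
Lemma integral_secular_integrand_reflect a S : S^T = S ->
  (\int[symL R n]_N \int[mxL R 1 n]_v secular_integrand a N v S =
   \int[symL R n]_W \int[mxL R 1 n]_w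
     secular_integrand a (a ord0 ord0 *: drsubmx S - W) (a ord0 ord0 *: ursubmx S - w) S)%E.
Proof.
move=> ST.
have mf : measurable_fun setT (fun N => \int[mxL R 1 n]_v secular_integrand a N v S)%E.
  apply: (measurable_integral (m2 := mxL R 1 n) (fun N v => secular_integrand a N v S)).
    by apply: measurable_secular_integrand; mx_measurable.
  by move=> *; exact: secular_integrand_ge0.
have CT : (a ord0 ord0 *: drsubmx S)^T = a ord0 ord0 *: drsubmx S.
  by rewrite linearZ/= trmx_drsub ST.
apply/esym/(etrans _ (integral_symL_reflect CT mf _)); last first.
  by integral_nonneg; exact: secular_integrand_ge0.
apply: eq_integral => W _.
apply: (@integral_mxL_reflect _ 1 n (a ord0 ord0 *: ursubmx S)
  (fun v => secular_integrand a (a ord0 ord0 *: drsubmx S - W) v S)).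
- by apply: measurable_secular_integrand; mx_measurable.
- by move=> v; exact: secular_integrand_ge0.
Qed.

(** The last substitution, from [a] to the corner entry of W. The corner entry in the integrand is
    exactly the derivative [sec_tau] of the secular function. *)
Lemma integral_secular_integrand_secular (S : 'M[R]_(1 + n)) (W : 'M[R]_n) (w : 'rV[R]_n) :
  posdef R (1 + n) S ->
  (\int[mxL R 1 1]_a
     secular_integrand a (a ord0 ord0 *: drsubmx S - W) (a ord0 ord0 *: ursubmx S - w) S =
   \int[mxL R 1 1]_c h (S, sym_block c w W))%E.
Proof.
move=> pS; have ST := posdef_sym pS.
have [WT|WT] := pselect (W^T = W); last first.
  transitivity (0%E : \bar R); [|apply/esym]; apply: integral0_eq => c _.
    rewrite /secular_integrand indicE memNset ?mul0r ?mul0e//.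
    move=> /posdef_sym; rewrite linearB/= linearZ/= trmx_drsub ST.
    by move/addrI/oppr_inj.
  apply/eqP; apply: contrapT => /negP/hY/simple_pencils_sym[_ /=].
  by rewrite /sym_block tr_block_mx => /eq_block_mx[].
have SE : S = sym_block (ulsubmx S) (ursubmx S) (drsubmx S).
  by rewrite /sym_block trmx_ursub ST submxK.
move: pS; rewrite [X in posdef _ _ X]SE => pS.
(* Here the interlacing hypothesis is what guarantees that the support lies in the image of the
   substitution. *)
have hw c : h (S, sym_block c w W) != 0%E ->
    exists2 a, sec_D (drsubmx S) W a &
      sec_phi (ulsubmx S) (ursubmx S) w (drsubmx S) W a = c ord0 ord0.
  move=> hc; have [a [pa da]] := interlaced_root (hY hc) (hE hc).
  move: pa da; rewrite /= /sym_block block_mxKdr -/(sym_block c w W) => pa.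
  rewrite [X in _ *: X]SE => da.
  by exists a => //; exact: (secular_root pS WT).
apply: etrans (integral_secular pS WT (F := fun c => h (S, sym_block c w W)) _ _ hw); last first.
- by move=> c; exact: h0.
- by pencil_measurable.
apply: eq_integral => a _.
rewrite /secular_integrand -/(sec_n _ _ _) -/(sec_N _ _ _) -/(sec_y _ _ _ _ _).
set a0 := a ord0 ord0.
case: (pselect (posdef R n (sec_N (drsubmx S) W a0))) => [pN|pN]; last first.
  by rewrite indicE memNset// !mul0r !mul0e.
have NT := posdef_sym pN; have uN := posdef_unit pN.
rewrite indicE mem_set// !mul1r.
set y := sec_y _ _ _ _ a0.
have yN : y *m sec_N (drsubmx S) W a0 = sec_n (ursubmx S) w a0 by rewrite mulmxKV.
have tauE : ulsubmx (unip_up (- y) *m S *m (unip_up (- y))^T) ord0 ord0 =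
    sec_tau (ulsubmx S) (ursubmx S) w (drsubmx S) W a0 a0.
  rewrite [in LHS]SE unip_up_sym_block ?trmx_drsub ?ST// block_mxKul /sec_tau -/y.
  by rewrite linearN/= !mulNmx !mulmxN opprK; congr (fun_of_matrix _ _ _); rewrite addrC !addrA.
rewrite tauE (max_idPr (ltW (sec_tau_gt0 _ _ pS _))); congr (_ * h (S, _))%E.
have -> : low_cone y (sec_N (drsubmx S) W a0) =
   sym_block (y *m sec_N (drsubmx S) W a0 *m y^T) (y *m sec_N (drsubmx S) W a0)
     (sec_N (drsubmx S) W a0).
  rewrite /low_cone (_ : block_mx 0 0 0 _ = sym_block 0 0 (sec_N (drsubmx S) W a0)).
    by rewrite unip_up_sym_block// trmx0 mulmx0 mul0mx !addr0 add0r.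
  by rewrite /sym_block trmx0.
have -> : a0 *: S = a0 *: sym_block (ulsubmx S) (ursubmx S) (drsubmx S) by rewrite -SE.
rewrite yN /sym_block scale_block_mx opp_block_mx add_block_mx.
congr block_mx.
- rewrite /sec_phi -mx11E; congr (_ - _).
  by rewrite trmx_mul trmx_inv NT mulmxA.
- by rewrite /sec_n opprB addrC subrK.
- by rewrite /sec_n linearB/= linearZ/= opprB addrC subrK.
- by rewrite /sec_N opprB addrC subrK.
Qed.

Lemma integral_deflated :
  (\int[mxL R 1 1]_a \int[symL R n]_S \int[symL R n]_W deflated a (S, W) =
   \int[symL R (1 + n)]_S \int[symL R (1 + n)]_W h (S, W))%E.
Proof.
transitivity (\int[mxL R 1 1]_a \int[symL R (1 + n)]_S \int[symL R n]_N
    \int[mxL R 1 n]_y cone_integrand a N y S)%E.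
  apply: eq_integral => a _; rewrite integral_deflated_up.
  have mu3 : measurable_fun setT (fun x : 'M[R]_n * ('rV[R]_n * 'M[R]_(1 + n)) =>
      cone_integrand a x.1 x.2.1 x.2.2) by apply: measurable_cone_integrand; mx_measurable.
  rewrite (integral_rotl (fun N y S => cone_integrand a N y S) mu3); last first.
    by move=> *; exact: cone_integrand_ge0.
  rewrite (integral_rotl (fun y S N => cone_integrand a N y S)).
  - by [].
  - by apply: measurable_cone_integrand; mx_measurable.
  - by move=> *; exact: cone_integrand_ge0.
have mu2 : measurable_fun setT (fun x : 'M[R]_1 * 'M[R]_(1 + n) =>
   \int[symL R n]_N \int[mxL R 1 n]_y cone_integrand x.1 N y x.2)%E.
  apply: (measurable_integral (m2 := symL R n) (fun (x : 'M[R]_1 * 'M[R]_(1 + n)) N =>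
     \int[mxL R 1 n]_y cone_integrand x.1 N y x.2))%E; last first.
    by integral_nonneg; exact: cone_integrand_ge0.
  apply: (measurable_integral (m2 := mxL R 1 n) (fun (x : ('M[R]_1 * 'M[R]_(1 + n)) * 'M[R]_n) y =>
     cone_integrand x.1.1 x.2 y x.1.2)); last by move=> *; exact: cone_integrand_ge0.
  by apply: measurable_cone_integrand; mx_measurable.
rewrite (integral_swap (fun a S => \int[symL R n]_N \int[mxL R 1 n]_y cone_integrand a N y S)%E mu2); last first.
  by integral_nonneg; exact: cone_integrand_ge0.
apply: eq_integral => S _.
have [pS|pS] := pselect (posdef R (1 + n) S); last first.
  have hS W : h (S, W) = 0%E.
    by apply/eqP; apply: contrapT => /negP/hY/simple_pencils_posdef.
  rewrite [RHS]integral0_eq//; apply: integral0_eq => a _; apply: integral0_eq => N _.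
  by apply: integral0_eq => y _; rewrite /cone_integrand hS mule0.
transitivity (\int[mxL R 1 1]_a \int[symL R n]_W \int[mxL R 1 n]_w
     secular_integrand a (a ord0 ord0 *: drsubmx S - W) (a ord0 ord0 *: ursubmx S - w) S)%E.
  apply: eq_integral => a _; apply: etrans (integral_secular_integrand_reflect a (posdef_sym pS)).
  by apply: eq_integral => N _; exact: integral_cone_integrand_lin.
rewrite (integral_rotl (fun (a : 'M[R]_1) (W : 'M[R]_n) (w : 'rV[R]_n) => secular_integrand a (a ord0 ord0 *: drsubmx S - W)
   (a ord0 ord0 *: ursubmx S - w) S)); first last.
- by move=> *; exact: secular_integrand_ge0.
- by apply: measurable_secular_integrand; mx_measurable.
rewrite [RHS]integral_sym_block_rev; first last.
- by move=> W; exact: h0.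
- by mx_measurable.
apply: eq_integral => W _; apply: eq_integral => w _.
exact: integral_secular_integrand_secular.
Qed.

End deflation_step.

(** * The induction on the size *)

Section pencil_change_of_variables.
Variable R : realType.

Definition pencil_integral n (h : 'M[R]_n * 'M[R]_n -> \bar R) : \bar R :=
  (\int[mxL R 1 n]_l \int[mxL R n n]_B (h (pencil B l) * (jac B l)%:E))%E.

Definition pair_integral n (h : 'M[R]_n * 'M[R]_n -> \bar R) : \bar R :=
  (\int[symL R n]_S \int[symL R n]_W h (S, W))%E.

Lemma measurable_pencil_integrand n (h : 'M[R]_n * 'M[R]_n -> \bar R) :
  measurable_fun setT h ->
  measurable_fun setT (fun x : 'rV[R]_n * 'M[R]_n =>
    h (pencil x.2 x.1) * (jac x.2 x.1)%:E)%E.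
Proof.
move=> mh; apply: emeasurable_funM; first by rewrite /pencil; mx_measurable.
by apply: measurable_EFin_comp; apply: measurable_jac; mx_measurable.
Qed.

Lemma integral2D d1 d2 (T1 : measurableType d1) (T2 : measurableType d2)
    (m1 : {sigma_finite_measure set T1 -> \bar R})
    (m2 : {sigma_finite_measure set T2 -> \bar R}) (f g : T1 -> T2 -> \bar R) :
  measurable_fun setT (fun x => f x.1 x.2) -> (forall x y, 0 <= f x y)%E ->
  measurable_fun setT (fun x => g x.1 x.2) -> (forall x y, 0 <= g x y)%E ->
  (\int[m1]_x \int[m2]_y (f x y + g x y) =
   \int[m1]_x \int[m2]_y f x y + \int[m1]_x \int[m2]_y g x y)%E.
Proof.
move=> mf f0 mg g0.
have mf2 x : measurable_fun setT (f x) by exact: (measurableT_comp mf (pair1_measurable x)).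
have mg2 x : measurable_fun setT (g x) by exact: (measurableT_comp mg (pair1_measurable x)).
rewrite -ge0_integralD//.
- by apply: eq_integral => x _; rewrite ge0_integralD.
- by move=> x _; integral_nonneg.
- exact: measurable_integral.
- by move=> x _; integral_nonneg.
- exact: measurable_integral.
Qed.

Lemma deflated_simple n (h : 'M[R]_(1 + n) * 'M[R]_(1 + n) -> \bar R) a w :
  (forall w, h w != 0%E -> simple_pencils w) -> deflated h a w != 0%E -> simple_pencils w.
Proof.
move=> hY; apply: contraPP => nw; apply/negP; rewrite negbK; apply/eqP.
apply: integral0_eq => y _; apply: integral0_eq => s _; apply: integral0_eq => v _.
rewrite schur_integrandE.
apply/eqP; apply: contrapT => /negP; rewrite mule_eq0 negb_or => /andP[+ /hY].
rewrite eqe mulf_eq0 negb_or /cone_weight mulf_eq0 negb_or => /andP[/andP[pN _] s0] sw.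
apply: nw.
have {}s0 : 0 < s ord0 ord0.
  move: s0; rewrite /schur_up /sym_block block_mxKul.
  by case: leP => //; rewrite eqxx.
have {}pN : posdef R n (a ord0 ord0 *: w.1 - w.2).
  by move: pN; rewrite indicE; case: (boolP (_ \in _)) => [/set_mem//|]; rewrite eqxx.
have := simple_pencils_descend s0 pN (sw : simple_pencils (_, _)).
by rewrite opprB addrC subrK; case: (w).
Qed.

Lemma pencil_change_of_variables_step n (h : 'M[R]_(1 + n) * 'M[R]_(1 + n) -> \bar R) :
  (forall k : 'M[R]_n * 'M[R]_n -> \bar R, measurable_fun setT k -> (forall w, 0 <= k w)%E ->
     (forall w, k w != 0%E -> simple_pencils w) -> pair_integral k = pencil_integral k) ->
  measurable_fun setT h -> (forall w, 0 <= h w)%E ->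
  (forall w, h w != 0%E -> simple_pencils w) -> (forall w, h w != 0%E -> interlaced w) ->
  pair_integral h = pencil_integral h.
Proof.
move=> IH mh h0 hY hE; rewrite /pair_integral -(integral_deflated mh h0 hY hE).
have mpi := measurable_pencil_integrand mh.
rewrite /pencil_integral integral_row_mx; first last.
- by move=> l; integral_nonneg; rewrite mule_ge0// lee_fin jac_ge0.
- apply: (measurable_integral (m2 := mxL R (1 + n) (1 + n)) (fun l B =>
    (h (pencil B l) * (jac B l)%:E)))%E => //.
  by move=> l B; rewrite mule_ge0// lee_fin jac_ge0.
apply: eq_integral => a _.
have mka : measurable_fun setT (deflated h a).
  exact: (measurableT_comp (measurable_deflated mh h0) (pair1_measurable a)).
have ka0 w : (0 <= deflated h a w)%E by exact: deflated_ge0.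
rewrite -/(pair_integral (deflated h a)) (IH _ mka ka0 (fun w => deflated_simple hY)).
apply: eq_integral => l _.
rewrite integral_mxL_block; first last.
- by move=> B; rewrite mule_ge0// lee_fin jac_ge0.
- exact: (measurableT_comp mpi (pair1_measurable _)).
by apply: eq_integral => B _; rewrite (integral_deflation mh h0 hE) muleC.
Qed.

Lemma pair_integralD n (k1 k2 : 'M[R]_n * 'M[R]_n -> \bar R) :
  measurable_fun setT k1 -> (forall w, 0 <= k1 w)%E ->
  measurable_fun setT k2 -> (forall w, 0 <= k2 w)%E ->
  pair_integral (k1 \+ k2) = (pair_integral k1 + pair_integral k2)%E.
Proof.
move=> mk1 k10 mk2 k20.
apply: (@integral2D _ _ _ _ (symL R n) (symL R n) (fun S W => k1 (S, W)) (fun S W => k2 (S, W))).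
- by mx_measurable.
- by move=> *; exact: k10.
- by mx_measurable.
- by move=> *; exact: k20.
Qed.

Lemma pencil_integralD n (k1 k2 : 'M[R]_n * 'M[R]_n -> \bar R) :
  measurable_fun setT k1 -> (forall w, 0 <= k1 w)%E ->
  measurable_fun setT k2 -> (forall w, 0 <= k2 w)%E ->
  pencil_integral (k1 \+ k2) = (pencil_integral k1 + pencil_integral k2)%E.
Proof.
move=> mk1 k10 mk2 k20.
apply: etrans (@integral2D _ _ _ _ (mxL R 1 n) (mxL R n n)
  (fun l B => k1 (pencil B l) * (jac B l)%:E)%E (fun l B => k2 (pencil B l) * (jac B l)%:E)%E _ _ _ _).
- apply: eq_integral => l _; apply: eq_integral => B _.
  by rewrite ge0_muleDl.
- exact: measurable_pencil_integrand.
- by move=> l B; rewrite mule_ge0// lee_fin jac_ge0.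
- exact: measurable_pencil_integrand.
- by move=> l B; rewrite mule_ge0// lee_fin jac_ge0.
Qed.

Definition lowact n (x : 'cV[R]_n) (w : 'M[R]_(1 + n) * 'M[R]_(1 + n)) :=
  (unip_low x *m w.1 *m (unip_low x)^T, unip_low x *m w.2 *m (unip_low x)^T).

Lemma lowact_pencil n (x : 'cV[R]_n) B l : lowact x (pencil B l) = pencil (unip_low x *m B) l.
Proof. by rewrite pencil_mul. Qed.

Lemma lowactK n (x : 'cV[R]_n) w : lowact x (lowact (- x) w) = w.
Proof.
have UN : unip_low x *m unip_low (- x) = 1%:M.
  rewrite /unip_low mulmx_block !(mul1mx, mulmx1, mul0mx, mulmx0, addr0, add0r) addrN.
  by rewrite -scalar_mx_block.
by case: w => S W; rewrite /lowact/=; congr pair; rewrite !mulmxA UN mul1mx -mulmxA -trmx_mul UN trmx1 mulmx1.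
Qed.

Lemma lowact_simple n (x : 'cV[R]_n) w : simple_pencils w -> simple_pencils (lowact x w).
Proof.
move=> [B [l [uB dl ->]]]; exists (unip_low x *m B), l; split=> //.
  by rewrite unitmx_mul unip_low_unit.
by rewrite lowact_pencil.
Qed.

Lemma pair_integral_lowact n (x : 'cV[R]_n) (h : 'M[R]_(1 + n) * 'M[R]_(1 + n) -> \bar R) :
  measurable_fun setT h -> (forall w, 0 <= h w)%E ->
  pair_integral (h \o lowact x) = pair_integral h.
Proof.
move=> mh h0; rewrite /pair_integral.
have mW S : measurable_fun setT (fun W => h (S, W)) by mx_measurable.
transitivity (\int[symL R (1 + n)]_S \int[symL R (1 + n)]_W
  h ((unip_low x *m S *m (unip_low x)^T)%R, W))%E.
  apply: eq_integral => S _.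
  exact: (@integral_symL_unip_low R n x (fun W => h ((unip_low x *m S *m (unip_low x)^T)%R, W)) (mW _) (fun W => h0 _)).
apply: (integral_symL_unip_low x (f := fun S => \int[symL R (1 + n)]_W h (S, W))%E).
  apply: (measurable_integral (m2 := symL R (1 + n)) (fun S W => h (S, W))) => //.
  by mx_measurable.
by integral_nonneg.
Qed.

Lemma pencil_integral_lowact n (x : 'cV[R]_n) (h : 'M[R]_(1 + n) * 'M[R]_(1 + n) -> \bar R) :
  measurable_fun setT h -> (forall w, 0 <= h w)%E ->
  pencil_integral (h \o lowact x) = pencil_integral h.
Proof.
move=> mh h0; apply: eq_integral => l _.
rewrite -(integral_mxL_unip_low x (f := fun B => h (pencil B l) * (jac B l)%:E)%E); first last.
- by move=> B; rewrite mule_ge0// lee_fin jac_ge0.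
- exact: (measurableT_comp (measurable_pencil_integrand mh) (pair1_measurable _)).
apply: eq_integral => B _; rewrite /= lowact_pencil /jac det_mulmx det_unip_low mul1r//.
Qed.

Definition low_column n (k : option 'I_n) : 'cV[R]_n := oapp (fun k => delta_mx k ord0) 0 k.

(** Induction on the list: the part of [k] on pencils that the first conjugation makes interlaced is
    split off. Both integrals are invariant under unipotent conjugation, so this part reduces to the
    interlaced case. *)
Lemma pencil_change_of_variables_cover n (s : seq (option 'I_n)) (k : 'M[R]_(1 + n) * 'M[R]_(1 + n) -> \bar R) :
  (forall k : 'M[R]_n * 'M[R]_n -> \bar R, measurable_fun setT k -> (forall w, 0 <= k w)%E ->
     (forall w, k w != 0%E -> simple_pencils w) -> pair_integral k = pencil_integral k) ->
  measurable_fun setT k -> (forall w, 0 <= k w)%E ->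
  (forall w, k w != 0%E -> simple_pencils w) ->
  (forall w, k w != 0%E -> exists2 i, i \in s & interlaced (lowact (low_column i) w)) ->
  pair_integral k = pencil_integral k.
Proof.
move=> IH; pose E i := lowact (low_column i) @^-1` interlaced (R := R) (n := n).
have mlow x : measurable_fun setT (@lowact n x).
  by rewrite /lowact; mx_measurable.
have mE i : measurable (E i).
  by rewrite -[E i]setTI; apply: mlow => //; exact: measurable_interlaced.
elim: s k => [|i s IHs] k mk k0 kY kE.
  have k00 w : k w = 0%E by apply/eqP; apply: contrapT => /negP/kE[].
  rewrite /pair_integral /pencil_integral.
  transitivity (0%E : \bar R); [|apply/esym]; apply: integral0_eq => x _; apply: integral0_eq => y _.
    exact: k00.
  by rewrite k00 mul0e.
pose k1 w := ((\1_(E i) w)%:E * k w)%E.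
pose k2 w := ((\1_(~` E i) w)%:E * k w)%E.
have mk1 : measurable_fun setT k1.
  by apply: emeasurable_funM => //; apply: measurable_EFin_comp; exact: measurable_indic.
have mk2 : measurable_fun setT k2.
  apply: emeasurable_funM => //; apply: measurable_EFin_comp; apply: measurable_indic.
  exact: measurableC.
have k10 w : (0 <= k1 w)%E by rewrite mule_ge0// lee_fin.
have k20 w : (0 <= k2 w)%E by rewrite mule_ge0// lee_fin.
have kD w : k w = (k1 w + k2 w)%E.
  rewrite /k1 /k2 -ge0_muleDl ?lee_fin// -EFinD !indicE in_setC.
  by case: (w \in E i) => /=; rewrite ?addr0 ?add0r mul1e.
have e1 : pair_integral k1 = pencil_integral k1.
  rewrite -(pair_integral_lowact (- low_column i) mk1 k10) -(pencil_integral_lowact (- low_column i) mk1 k10).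
  apply: (pencil_change_of_variables_step IH).
  - exact: (measurableT_comp mk1 (mlow _)).
  - by move=> w; exact: k10.
  - move=> w; rewrite /= mule_eq0 negb_or => /andP[_ /kY/(lowact_simple (low_column i))].
    by rewrite lowactK.
  - move=> w; rewrite /= mule_eq0 negb_or => /andP[+ _].
    rewrite indicE; case: (boolP (_ \in _)); last by rewrite eqxx.
    by move=> /set_mem; rewrite /E /= lowactK.
have e2 : pair_integral k2 = pencil_integral k2.
  apply: IHs => // w; rewrite mule_eq0 negb_or => /andP[+ kw].
    by move=> _; exact: kY.
  rewrite indicE in_setC; case: (boolP (_ \in _)) => [|/negP nE _]; first by rewrite eqxx.
  have [j] := kE w kw; rewrite inE => /predU1P[->|js Ej]; last by exists j.
  by move=> /mem_set/nE.
have -> : k = k1 \+ k2 by apply/funext.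
by rewrite (pair_integralD mk1 k10 mk2 k20) (pencil_integralD mk1 k10 mk2 k20) e1 e2.
Qed.

Lemma pencil_change_of_variables n (h : 'M[R]_n * 'M[R]_n -> \bar R) :
  measurable_fun setT h -> (forall w, 0 <= h w)%E ->
  (forall w, h w != 0%E -> simple_pencils w) -> pair_integral h = pencil_integral h.
Proof.
elim: n h => [|n IH] h mh h0 hY.
  (* In size 0 each space of matrices is one point of mass 1. *)
  rewrite /pair_integral /pencil_integral.
  have m1 : symL R 0 setT = 1%E.
    have := @symL_box R 0 (fun _ _ => setT) (fun _ _ => measurableT).
    rewrite big_ord0 => <-; congr (symL R 0 _).
    by apply/seteqP; split=> A // _ [].
  have m2 : mxL R 0 0 setT = 1%E.
    have := @mxL_box R 0 0 (fun _ _ => setT) (fun _ _ => measurableT).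
    rewrite big_ord0 => <-; congr (mxL R 0 0 _).
    by apply/seteqP; split=> A // _ [].
  have m3 : mxL R 1 0 setT = 1%E.
    have := @mxL_box R 1 0 (fun _ _ => setT) (fun _ _ => measurableT).
    rewrite big1 => [<-|i _]; last by rewrite big_ord0.
    by congr (mxL R 1 0 _); apply/seteqP; split=> A // _ i [].
  have c1 (k : 'M[R]_0 -> \bar R) : (\int[symL R 0]_S k S = k 0%R)%E.
    rewrite (eq_integral (cst (k 0))) => [|S _]; last by rewrite [S]thinmx0.
    by rewrite integral_cst//= m1 mule1.
  have c2 (k : 'M[R]_0 -> \bar R) : (\int[mxL R 0 0]_S k S = k 0%R)%E.
    rewrite (eq_integral (cst (k 0))) => [|S _]; last by rewrite [S]thinmx0.
    by rewrite integral_cst//= m2 mule1.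
  have c3 (k : 'rV[R]_0 -> \bar R) : (\int[mxL R 1 0]_S k S = k 0%R)%E.
    rewrite (eq_integral (cst (k 0))) => [|S _]; last by rewrite [S]thinmx0.
    by rewrite integral_cst//= m3 mule1.
  rewrite !c1 c3 c2 /jac det_mx00 normr1 expr1n /vdm big_ord0 !mulr1.
  have -> : decr (0 : 'rV[R]_0) by apply/decrP => -[].
  rewrite mule1; congr (h (_, _)); exact/esym/thinmx0.
rewrite -[n.+1]/(1 + n)%N in h mh h0 hY *.
apply: (pencil_change_of_variables_cover (s := enum {: option 'I_n}) IH mh h0 hY) => w /hY[B [l [uB dl ->]]].
have [i ui] := exists_unip_low_unit uB.
exists i; first by rewrite mem_enum.
rewrite lowact_pencil.
have uLB : unip_low (low_column i) *m B \in unitmx by rewrite unitmx_mul unip_low_unit.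
rewrite -[_ *m B]submxK -[l](@hsubmxK R 1 1 n).
by apply: unit_interlaced; rewrite ?submxK ?hsubmxK.
Qed.
End pencil_change_of_variables.

(** * Measurable decompositions *)

Section first_nonzero.
Variables (R : realType) (n : nat).

Fixpoint first_nz_in (s : seq 'I_n) (c v : 'I_n -> R) : R :=
  if s is i :: s' then (if c i == 0 then first_nz_in s' c v else v i) else 0.

(* [v i] for the first [i] such that [c i != 0] *)
Definition first_nz := first_nz_in (enum 'I_n).

Lemma first_nzP (c v : 'I_n -> R) (i : 'I_n) : c i != 0 ->
  (forall k : 'I_n, (k < i)%N -> c k = 0) -> first_nz c v = v i.
Proof.
move=> ci ck; rewrite /first_nz.
have : sorted (fun i j : 'I_n => (i < j)%N) (enum 'I_n).
  have := iota_ltn_sorted 0 n; rewrite -val_enum_ord sorted_map.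
  by apply: sub_sorted => a b.
have : i \in enum 'I_n by rewrite mem_enum.
elim: (enum 'I_n) => //= k s IH; rewrite inE => /predU1P[<-|si] ps.
  by rewrite (negbTE ci).
move: (ps); rewrite path_sortedE; last by move=> a b d; exact: ltn_trans.
move=> /andP[/allP/(_ i si) ki ss].
by rewrite (ck k ki) eqxx; exact: IH.
Qed.

Lemma exists_first_nz (c : 'I_n -> R) : (exists i, c i != 0) ->
  exists2 i, c i != 0 & forall k : 'I_n, (k < i)%N -> c k = 0.
Proof.
move=> [i0 ci0]; case: (@arg_minnP _ i0 (fun i => c i != 0) val ci0) => i ci imin.
exists i => // k ki; apply/eqP; apply: contraLR ki => ck.
by rewrite -leqNgt; exact: imin.
Qed.

Lemma measurable_first_nz d (T : measurableType d) (c v : T -> 'I_n -> R) :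
  (forall i, measurable_fun setT (fun x => c x i)) ->
  (forall i, measurable_fun setT (fun x => v x i)) ->
  measurable_fun setT (fun x => first_nz (c x) (v x)).
Proof.
move=> mc mv; rewrite /first_nz; elim: (enum 'I_n) => [|i s IH] /=.
  exact: measurable_cst.
apply: measurable_fun_ifT => //; apply: measurable_fun_eqr => //; exact: measurable_cst.
Qed.
End first_nonzero.

(** * Normalizing the signs of the columns *)

Section column_signs.
Variables (R : realType) (n : nat).
Implicit Types A B : 'M[R]_n.

(** An explicit measurable form of the sign change that [g_of] obtains by choice: each column is
    multiplied by the sign of its first nonzero entry. *)
Definition norm_signs A : 'M[R]_n :=
  \matrix_(i, j) (A i j * Num.sg (first_nz (A ^~ j) (A ^~ j))).

Lemma mul_col_signs A s i j : (A *m col_signs R s) i j = A i j * (-1) ^+ s j.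
Proof. by rewrite mul_mx_diag !mxE. Qed.

Lemma col_signs_unit s : col_signs R s \in @unitmx R n.
Proof.
rewrite unitmxE det_diag unitfE prodf_seq_neq0; apply/allP => i _.
by rewrite mxE /= signr_eq0.
Qed.

Lemma det_col_signs (s : 'I_n -> bool) : `|\det (col_signs R s)| = 1.
Proof.
by rewrite det_diag normr_prod big1// => i _; rewrite mxE normr_sign.
Qed.

Lemma unit_col_nz A j : A \in unitmx -> exists i, A i j != 0.
Proof.
move=> uA; apply: contrapT => /forallNP A0.
have : A *m delta_mx j (ord0 : 'I_1) = 0.
  rewrite -colE; apply/colP => i; rewrite !mxE.
  by have /negP := A0 i; rewrite negbK => /eqP.
move=> /(congr1 (mulmx (invmx A))); rewrite mulKmx// mulmx0 => /matrixP/(_ j ord0).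
by rewrite !mxE !eqxx => /eqP; rewrite oner_eq0.
Qed.

Lemma norm_signsE A : A \in unitmx -> exists s, norm_signs A = A *m col_signs R s.
Proof.
move=> uA; exists (fun j => first_nz (A ^~ j) (A ^~ j) < 0); apply/matrixP => i j.
rewrite mul_col_signs mxE.
have [k Ak k0] := exists_first_nz (unit_col_nz j uA).
rewrite (@first_nzP _ _ (A ^~ j) (A ^~ j) k Ak k0); congr (_ * _).
by rewrite sgr_def Ak mulr1n.
Qed.

Lemma norm_signs_half A : A \in unitmx -> GLhalf R n (norm_signs A).
Proof.
move=> uA; have [s sE] := norm_signsE uA; split=> [|j].
  by rewrite sE unitmx_mul uA col_signs_unit.
have [k Ak k0] := exists_first_nz (unit_col_nz j uA).
exists k; split=> [|i ik]; last by rewrite mxE k0// mul0r.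
by rewrite mxE (@first_nzP _ _ (A ^~ j) (A ^~ j) k Ak k0) mulrC -normrEsg normr_gt0.
Qed.

Lemma GLhalf_norm_signs A s : GLhalf R n (A *m col_signs R s) ->
  norm_signs A = A *m col_signs R s.
Proof.
move=> [uAs half]; apply/matrixP => i j; have [k [Ak k0]] := half j.
have nz l : (A *m col_signs R s) l j != 0 -> A l j != 0.
  by apply: contraNneq => Al; rewrite mul_col_signs Al mul0r.
rewrite mul_col_signs mxE (@first_nzP _ _ _ _ k).
- move: Ak; rewrite mul_col_signs; case: (s j) => /=.
    by rewrite expr1 mulrN1 oppr_gt0 => Ak; rewrite ltr0_sg.
  by rewrite expr0 mulr1 => Ak; rewrite gtr0_sg.
- by apply: nz; rewrite gt_eqF.
- move=> l lk; have := k0 l lk; rewrite mul_col_signs => /eqP.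
  by rewrite mulf_eq0 signr_eq0 orbF => /eqP.
Qed.

Lemma col_signsM (s s' : 'I_n -> bool) :
  col_signs R s *m col_signs R s' = col_signs R (fun j => s j (+) s' j).
Proof.
apply/matrixP => i j; rewrite mul_col_signs !mxE signr_addb.
by have [->|_] := eqVneq i j; rewrite ?mulr1n// mulr0n mul0r.
Qed.

Lemma norm_signs_col_signs A s : A \in unitmx ->
  norm_signs (A *m col_signs R s) = norm_signs A.
Proof.
move=> uA; have [s' E] := norm_signsE uA.
have e : A *m col_signs R s *m col_signs R (fun j => s j (+) s' j) = norm_signs A.
  rewrite -mulmxA col_signsM E; congr (_ *m col_signs R _); apply/funext => j.
  by rewrite addbA addbb.
rewrite -e; apply: GLhalf_norm_signs; rewrite e; exact: norm_signs_half.
Qed.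

Lemma measurable_norm_signs d (T : measurableType d) (f : T -> 'M[R]_n) :
  measurable_fun setT f -> measurable_fun setT (fun x => norm_signs (f x)).
Proof.
move=> mf; apply: measurable_fun_mxP => i j; under eq_fun do rewrite mxE.
apply: measurable_funM; first by mx_measurable.
apply: measurableT_comp; last by apply: measurable_first_nz => k; mx_measurable.
rewrite (_ : Num.sg = (fun x : R => if x == 0 then 0 else if x < 0 then -1 else 1)); last first.
  by apply/funext => x; rewrite sgr_def; case: (eqVneq x 0) => //= x0; rewrite mulr1n; case: (x < 0).
apply: measurable_fun_ifT => //; first exact: measurable_fun_eqr.
by apply: measurable_fun_ifT => //; exact: measurable_fun_ltr.
Qed.

(** Sign changes pass through a monomial matrix at the cost of a permutation. Hence the signs left
    open in B(W) do not affect g(W). *)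
Lemma monomial_col_signs P s : monomial_mx R n P ->
  exists s', col_signs R s *m invmx P = invmx P *m col_signs R s'.
Proof.
move=> [uP rP cP].
have pP (j : 'I_n) : {i | P i j != 0 & forall i', P i' j != 0 -> i' = i}.
  by apply: cid2; have [i [Pi Ui]] := cP j; exists i => // i' /Ui.
exists (fun i => s (projT1 (cid (rP i)))).
have : P *m col_signs R s = col_signs R (fun i => s (projT1 (cid (rP i)))) *m P.
  apply/matrixP => i j; rewrite mul_col_signs mul_diag_mx !mxE.
  case: cid => /= k [Pk Uk]; have [->|Pij] := eqVneq (P i j) 0; first by rewrite mul0r mulr0.
  by rewrite (Uk _ Pij) mulrC.
set s' := fun i => _ => e.
apply: (can_inj (mulKmx uP)); rewrite mulmxA e -mulmxA mulmxV// mulmx1.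
by rewrite mulmxA mulmxV// mul1mx.
Qed.
End column_signs.

(** * Power iteration *)

Section power_iteration.
Variables (R : realType) (n : nat).
Implicit Types S W B : 'M[R]_n.

(** For S = B B^t and W = B D B^t this is B D^m B^t. Ratios of traces tend to the top root, and
    after division by its powers the matrices tend to b b^t for the corresponding column b. *)
Definition krylov S W m : 'M[R]_n := iter m (mulmx (W *m invmx S)) S.

(** The upper limit is defined for all arguments and measurable in them; on the pencils of interest
    the sequence converges. *)
Definition top_root S W : R :=
  fine (limn_esup (fun m => (\tr (krylov S W m.+1) / \tr (krylov S W m))%:E)).

Definition top_proj S W : 'M[R]_n :=
  \matrix_(i, j) fine (limn_esup (fun m => ((top_root S W)^-1 ^+ m * krylov S W m i j)%:E)).

Fixpoint residual S W k : 'M[R]_n :=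
  if k is k'.+1 then
    let V := residual S W k' in V - top_root S V *: top_proj S V
  else W.

Lemma measurable_limn_esup_fine d (T : measurableType d) (f : T -> nat -> R) :
  (forall m, measurable_fun setT (fun x => f x m)) ->
  measurable_fun setT (fun x => fine (limn_esup (fun m => (f x m)%:E))).
Proof.
move=> mf; apply: measurableT_comp; first exact: fine_measurable.
apply: (measurable_fun_limn_esup (f := fun m x => (f x m)%:E)) => m.
exact: measurable_EFin_comp.
Qed.

Lemma measurable_krylov d (T : measurableType d) (S W : T -> 'M[R]_n) m :
  measurable_fun setT S -> measurable_fun setT W ->
  measurable_fun setT (fun x => krylov (S x) (W x) m).
Proof.
move=> mS mW; rewrite /krylov; elim: m => [|m IH] //=.
by mx_measurable.
Qed.

Lemma measurable_top_root d (T : measurableType d) (S W : T -> 'M[R]_n) :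
  measurable_fun setT S -> measurable_fun setT W ->
  measurable_fun setT (fun x => top_root (S x) (W x)).
Proof.
move=> mS mW; apply: measurable_limn_esup_fine => m.
apply: measurable_funM; last apply: measurable_invr; apply: measurable_mxtrace;
  exact: measurable_krylov.
Qed.

Lemma measurable_top_proj d (T : measurableType d) (S W : T -> 'M[R]_n) :
  measurable_fun setT S -> measurable_fun setT W ->
  measurable_fun setT (fun x => top_proj (S x) (W x)).
Proof.
move=> mS mW; apply: measurable_fun_mxP => i j; under eq_fun do rewrite mxE.
apply: measurable_limn_esup_fine => m; apply: measurable_funM.
  by apply: measurable_funX; apply: measurable_invr; exact: measurable_top_root.
by apply: measurable_mx_entry; exact: measurable_krylov.
Qed.

Lemma measurable_residual d (T : measurableType d) (S W : T -> 'M[R]_n) k :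
  measurable_fun setT S -> measurable_fun setT W ->
  measurable_fun setT (fun x => residual (S x) (W x) k).
Proof.
move=> mS mW; elim: k => //= k IH.
apply: measurable_addmx => //; apply: measurable_oppmx; apply: measurable_scalemx.
  exact: measurable_top_root.
exact: measurable_top_proj.
Qed.

Lemma fine_limn_esup_cvg (u : nat -> R) (l : R) : u m @[m --> \oo] --> l ->
  fine (limn_esup (fun m => (u m)%:E)) = l.
Proof.
move=> ul; have : (EFin \o u) m @[m --> \oo] --> l%:E.
  by apply: cvg_EFin => //; exact: nearW.
by move=> /cvg_limn_einf_sup[_]; rewrite /comp => ->.
Qed.

Lemma krylovE B (d : 'rV[R]_n) m : B \in unitmx ->
  krylov (B *m B^T) (B *m diag_mx d *m B^T) m =
  B *m diag_mx (\row_j d ord0 j ^+ m) *m B^T.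
Proof.
move=> uB; rewrite /krylov; elim: m => [|m IH].
  rewrite /= (_ : \row_j _ = const_mx 1) ?diag_const_mx ?mulmx1//.
  by apply/rowP => j; rewrite !mxE expr0.
have uBT : B^T \in unitmx by rewrite unitmx_tr.
have uS : B *m B^T \in unitmx by rewrite unitmx_mul uB.
rewrite iterS IH; set F := diag_mx (\row_j _ ^+ m).
have -> : B *m F *m B^T = B *m B^T *m (invmx B^T *m F *m B^T).
  by rewrite !mulmxA mulmxK.
rewrite (mulmxA _ (B *m B^T)) mulmxKV// !mulmxA mulmxK// /F.
rewrite -(mulmxA B) mulmx_diag; congr (_ *m diag_mx _ *m _).
by apply/rowP => j; rewrite !mxE exprS.
Qed.

(** Entries equal to 0 are allowed beside the dominant one, since the residuals replace the roots
    already found by 0. *)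
Lemma cvg_dominant (d : 'rV[R]_n) (c : 'I_n -> R) k :
  (forall j, j != k -> 0 <= d ord0 j < d ord0 k) -> 0 < d ord0 k ->
  \sum_j (d ord0 j / d ord0 k) ^+ m * c j @[m --> \oo] --> c k.
Proof.
move=> dk dk0.
have -> : c k = \sum_j (if j == k then c k else 0) by rewrite -big_mkcond big_pred1_eq.
apply: cvg_sum_fin => j; have [->|jk] := eqVneq j k.
  rewrite mulfV ?gt_eqF//; under eq_fun do rewrite expr1n mul1r; exact: cvg_cst.
rewrite -[X in _ --> X](mul0r (c j)); apply: cvgMl; apply: cvg_expr.
have /andP[d0 d1] := dk _ jk.
have q0 : 0 <= d ord0 j / d ord0 k by rewrite divr_ge0// ltW.
by rewrite (ger0_norm q0) ltr_pdivrMr// mul1r.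
Qed.

Section dominant.
Variables (B : 'M[R]_n) (d : 'rV[R]_n) (k : 'I_n).
Hypothesis uB : B \in unitmx.
Hypothesis dk : forall j, j != k -> 0 <= d ord0 j < d ord0 k.
Hypothesis dk0 : 0 < d ord0 k.

Let krylov_entry m i i' : krylov (B *m B^T) (B *m diag_mx d *m B^T) m i i' =
  d ord0 k ^+ m * \sum_j (d ord0 j / d ord0 k) ^+ m * (B i j * B i' j).
Proof.
rewrite krylovE// mxE mulr_sumr; apply: eq_bigr => j _.
rewrite mul_mx_diag !mxE expr_div_n.
have : d ord0 k ^+ m != 0 by rewrite expf_neq0// gt_eqF.
by move: (d ord0 k ^+ m) => x x0; field.
Qed.

Let krylov_tr m : \tr (krylov (B *m B^T) (B *m diag_mx d *m B^T) m) =
  d ord0 k ^+ m * \sum_j (d ord0 j / d ord0 k) ^+ m * (\sum_i B i j ^+ 2).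
Proof.
rewrite /mxtrace; under eq_bigr do rewrite krylov_entry.
rewrite -mulr_sumr exchange_big/=; congr (_ * _); apply: eq_bigr => j _.
by rewrite mulr_sumr; apply: eq_bigr => i _; rewrite -expr2.
Qed.

Let col_gt0 : 0 < \sum_i B i k ^+ 2.
Proof.
have [i Bi] := unit_col_nz k uB.
rewrite (bigD1 i)//= ltr_wpDr ?exprn_even_gt0//.
by apply: sumr_ge0 => j _; exact: sqr_ge0.
Qed.

Lemma top_rootE : top_root (B *m B^T) (B *m diag_mx d *m B^T) = d ord0 k.
Proof.
apply: fine_limn_esup_cvg.
pose c j := \sum_i B i j ^+ 2.
rewrite (_ : (fun m => _) = fun m => (\sum_j (d ord0 j / d ord0 k) ^+ m * (d ord0 j * c j)) /
   (\sum_j (d ord0 j / d ord0 k) ^+ m * c j)); last first.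
  apply/funext => m; rewrite !krylov_tr -/c exprS.
  have -> : \sum_j (d ord0 j / d ord0 k) ^+ m * (d ord0 j * c j) =
      d ord0 k * \sum_j (d ord0 j / d ord0 k) ^+ m.+1 * c j.
    rewrite mulr_sumr; apply: eq_bigr => j _; rewrite exprSr.
    by move: (_ ^+ m) => x; field; rewrite gt_eqF.
  have key (X Z Y : R) : X != 0 -> d ord0 k * X * Z * (X^-1 * Y) = d ord0 k * Z * Y.
    by move=> X0; field.
  by rewrite invfM; apply: key; rewrite expf_neq0// gt_eqF.
rewrite -[X in _ --> X](mulfK (_ : c k != 0)); last by rewrite gt_eqF.
apply: cvgM; last apply: cvgV; last exact: cvg_dominant.
  exact: (cvg_dominant (c := fun j => d ord0 j * c j)).
by rewrite gt_eqF.
Qed.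

Lemma top_projE : top_proj (B *m B^T) (B *m diag_mx d *m B^T) =
  \matrix_(i, j) (B i k * B j k).
Proof.
apply/matrixP => i i'; rewrite !mxE; apply: fine_limn_esup_cvg.
rewrite top_rootE (_ : (fun m => _) =
   fun m => \sum_j (d ord0 j / d ord0 k) ^+ m * (B i j * B i' j)).
  exact: (cvg_dominant (c := fun j => B i j * B i' j)).
by apply/funext => m; rewrite krylov_entry exprVn mulKf// expf_neq0// gt_eqF.
Qed.
End dominant.

Section spectrum.
Variables (B : 'M[R]_n) (l : 'rV[R]_n).
Hypothesis uB : B \in unitmx.
Hypothesis l0 : forall i, 0 < l ord0 i.
Hypothesis dl : decr l.

Let tail k : 'rV[R]_n := \row_j (if (k <= j)%N then l ord0 j else 0).

Let tail_dom (k j : 'I_n) : j != k -> 0 <= tail k ord0 j < tail k ord0 k.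
Proof.
move=> jk; rewrite !mxE leqnn; case: leqP => kj; last by rewrite lexx l0.
rewrite ltW//=; move/decrP : dl; apply; rewrite ltn_neqAle kj andbT.
by rewrite eq_sym; exact: jk.
Qed.

Let tail_gt0 (k : 'I_n) : 0 < tail k ord0 k. Proof. by rewrite mxE leqnn. Qed.

Lemma residualE k : (k <= n)%N ->
  residual (B *m B^T) (B *m diag_mx l *m B^T) k = B *m diag_mx (tail k) *m B^T.
Proof.
elim: k => [_|k IH kn] /=.
  by congr (_ *m diag_mx _ *m _); apply/rowP => j; rewrite mxE.
rewrite IH ?(ltnW kn)//; pose k' := Ordinal kn.
rewrite (top_rootE uB (@tail_dom k') (tail_gt0 k')) (top_projE uB (@tail_dom k') (tail_gt0 k')).
have entry t i j : (B *m diag_mx t *m B^T) i j = \sum_m t ord0 m * (B i m * B j m).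
  rewrite mxE; apply: eq_bigr => m _; rewrite mul_mx_diag !mxE.
  by rewrite mulrAC mulrC.
apply/matrixP => i j; rewrite [LHS]mxE [X in _ + X]mxE [X in _ - X]mxE [X in _ - _ * X]mxE.
(* The subtracted rank one matrix is precisely the term of index [k]; all other terms are
   unchanged. *)
rewrite !entry (bigD1 k')//= [RHS](bigD1 k')//= !mxE leqnn ltnn mul0r add0r addrAC subrr.
rewrite add0r; apply: eq_bigr => m mk; rewrite !mxE [in RHS]ltn_neqAle.
by rewrite (_ : k != m)//; apply: contra mk => /eqP km; exact/eqP/val_inj.
Qed.

Lemma top_root_residual (k : 'I_n) :
  top_root (B *m B^T) (residual (B *m B^T) (B *m diag_mx l *m B^T) k) = l ord0 k.
Proof.
rewrite residualE ?(ltnW (ltn_ord k))// (top_rootE uB (@tail_dom k) (tail_gt0 k)).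
by rewrite mxE leqnn.
Qed.

Lemma top_proj_residual (k : 'I_n) :
  top_proj (B *m B^T) (residual (B *m B^T) (B *m diag_mx l *m B^T) k) =
  \matrix_(i, j) (B i k * B j k).
Proof.
by rewrite residualE ?(ltnW (ltn_ord k))// (top_projE uB (@tail_dom k) (tail_gt0 k)).
Qed.
End spectrum.
End power_iteration.

(** * Measurable versions of L(W), B(W), g(W) and z(W) *)

Section decompositions.
Variables (R : realType) (n : nat).
Implicit Types (w : 'M[R]_n * 'M[R]_n) (B P : 'M[R]_n) (l : 'rV[R]_n).

Definition cand_root w : 'rV[R]_n := \row_k top_root (w.1 + w.2) (residual (w.1 + w.2) w.1 k).

Definition cand_proj w (k : 'I_n) : 'M[R]_n :=
  top_proj (w.1 + w.2) (residual (w.1 + w.2) w.1 k).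

(* the column [b] is read off the rank one matrix [b b^T], up to sign *)
Definition cand_basis w : 'M[R]_n := \matrix_(i, k)
  first_nz (fun m => cand_proj w k m m) (fun m => cand_proj w k i m / Num.sqrt (cand_proj w k m m)).

Lemma measurable_cand_root : measurable_fun setT cand_root.
Proof.
apply: measurable_fun_mxP => i j; under eq_fun do rewrite mxE.
by apply: measurable_top_root; [|apply: measurable_residual]; mx_measurable.
Qed.

Lemma measurable_cand_proj k : measurable_fun setT (cand_proj ^~ k).
Proof. by apply: measurable_top_proj; [|apply: measurable_residual]; mx_measurable. Qed.

Lemma measurable_cand_basis : measurable_fun setT cand_basis.
Proof.
apply: measurable_fun_mxP => i j; under eq_fun do rewrite mxE.
have mP k m m' : measurable_fun setT (fun w => cand_proj w k m m').
  by apply: measurable_mx_entry; exact: measurable_cand_proj.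
apply: measurable_first_nz => m //; apply: measurable_funM => //.
by apply: measurable_invr; apply: measurableT_comp => //; apply: continuous_measurable_fun; exact: sqrt_continuous.
Qed.

Lemma decomposition_add w B l : decomposition w (B, l) -> w.1 + w.2 = B *m B^T.
Proof.
by move=> [/= _ _ -> ->]; rewrite -mulmxDl -mulmxDr addrC subrK mulmx1.
Qed.

Lemma ordered_decr l : ordered_roots R n l -> decr l.
Proof. by move=> [_ ol]; apply/decrP. Qed.

Lemma cand_rootE w B l : decomposition w (B, l) -> cand_root w = l.
Proof.
move=> Bl; have [/= uB ol E1 _] := Bl; apply/rowP => k.
rewrite mxE (decomposition_add Bl) E1 top_root_residual//; last exact: ordered_decr.
by move=> i; have [/(_ i)/andP[]] := ol.
Qed.

Lemma cand_basisE w B l : decomposition w (B, l) ->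
  exists s, cand_basis w = B *m col_signs R s.
Proof.
move=> Bl; have [/= uB ol E1 _] := Bl.
exists (fun k => first_nz (B ^~ k) (B ^~ k) < 0); apply/matrixP => i k.
have pE m m' : cand_proj w k m m' = B m k * B m' k.
  rewrite /cand_proj (decomposition_add Bl) E1 top_proj_residual ?mxE//; last exact: ordered_decr.
  by move=> j; have [/(_ j)/andP[]] := ol.
have [m Bm Bm0] := exists_first_nz (unit_col_nz k uB).
rewrite mul_col_signs mxE (@first_nzP _ _ _ _ m).
- rewrite !pE -expr2 sqrtr_sqr -mulrA (@first_nzP _ _ (B ^~ k) (B ^~ k) m Bm Bm0); congr (_ * _).
  have nB : `|B m k| != 0 by rewrite normr_eq0.
  by apply: (mulIf nB); rewrite mulfVK// [LHS]numEsign.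
- by rewrite pE mulf_neq0.
- by move=> j jm; rewrite pE Bm0 ?mul0r.
Qed.

Lemma decomposition_col_signs w B l s : decomposition w (B, l) ->
  decomposition w (B *m col_signs R s, l).
Proof.
have ss (D : 'rV[R]_n) : B *m col_signs R s *m diag_mx D *m (B *m col_signs R s)^T =
    B *m diag_mx D *m B^T.
  rewrite trmx_mul tr_diag_mx !mulmxA -(mulmxA B) -(mulmxA B) !mulmx_diag.
  congr (_ *m diag_mx _ *m _).
  by apply/rowP => j; rewrite !mxE mulrAC -expr2 sqrr_sign mul1r.
move=> [/= uB ol E1 E2]; split=> //=.
- by rewrite unitmx_mul uB col_signs_unit.
- by rewrite ss.
- rewrite -diag_const_mx -linearB/= ss linearB/= diag_const_mx.
  exact: E2.
Qed.

Lemma decomposition_sampleX w B l : decomposition w (B, l) -> sampleX R n w.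
Proof.
move=> Bl; have [/= uB [l01 lo] E1 E2] := Bl; split.
- by rewrite E1; apply: posdef_congr => //; apply/posdef_diagP => i; have /andP[] := l01 i.
- rewrite E2 -diag_const_mx -linearB/=; apply: posdef_congr => //; apply/posdef_diagP => i.
  by rewrite !mxE subr_gt0; have /andP[] := l01 i.
exists [tuple l ord0 i | i < n]; split.
  rewrite map_inj_uniq ?enum_uniq// => i j lij; apply/val_inj.
  have [/lo|/lo|ij] := ltngtP (i : nat) j; last exact: ij.
    by rewrite lij ltxx.
  by rewrite lij ltxx.
move=> x; rewrite (decomposition_add Bl) E1.
have -> : B *m diag_mx l *m B^T - x *: (B *m B^T) = B *m diag_mx (l - const_mx x) *m B^T.
  rewrite linearB/= mulmxBr mulmxBl diag_const_mx mul_mx_scalar.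
  by rewrite -scalemxAl.
rewrite !det_mulmx det_tr det_diag; split=> [/eqP|/tnthP[i ->]].
  have dB : \det B != 0 by rewrite -unitfE -unitmxE.
  rewrite !mulf_eq0 (negbTE dB) orbF /= => /prodf_eq0[i _]; rewrite !mxE subr_eq0 => /eqP <-.
  by apply/tnthP; exists i; rewrite tnth_mktuple.
by rewrite tnth_mktuple (bigD1 i)//= !mxE subrr mul0r mulr0 mul0r.
Qed.

(** Simultaneous diagonalization: null vectors of W_1 - l_j S, normalized for S, are orthogonal for
    S because the roots are distinct. They form the rows of V with V S V^t = I, and B is the inverse
    of V. *)
Lemma sampleX_decomposition w : sampleX R n w -> exists B l, decomposition w (B, l).
Proof.
move=> [p1 p2 [r [ur rP]]].
have pS := posdefD p1 p2; set S := w.1 + w.2 in rP pS.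
pose ls := sort <=%R r.
have sls : size ls = n by rewrite size_sort size_tuple.
have lls : sorted <%R ls by rewrite sort_lt_sorted.
(* Sorting is increasing, so the index is reversed to get decreasing roots. *)
pose l : 'rV[R]_n := \row_j nth 0 ls (rev_ord j).
have lo (i j : 'I_n) : (i < j)%N -> l ord0 j < l ord0 i.
  move=> ij; rewrite !mxE lt_sorted_ltn_nth ?inE ?sls ?ltn_ord//=.
  by apply: ltn_sub2l => //; exact: leq_ltn_trans ij (ltn_ord j).
have lr j : \det (w.1 - l ord0 j *: S) = 0.
  by apply/rP; rewrite -(mem_sort <=%R) mxE mem_nth// sls.
have ex j : {v : 'rV[R]_n | v *m w.1 = l ord0 j *: (v *m S) & (v *m S *m v^T) ord0 ord0 = 1}.
  apply: cid2; have /eqP/det0P[v v0 /eqP] := lr j; rewrite mulmxBr subr_eq0 -scalemxAr => /eqP vE.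
  have vS := pS.2 v v0; set q := (v *m S *m v^T) ord0 ord0 in vS.
  have sq : Num.sqrt q != 0 by rewrite gt_eqF// sqrtr_gt0.
  exists ((Num.sqrt q)^-1 *: v).
    by rewrite -!scalemxAl vE scalerA mulrC -scalerA.
  rewrite linearZ/= -!scalemxAl -scalemxAr scalerA mxE -/q -invfM -expr2.
  by rewrite sqr_sqrtr ?(ltW vS)// mulVf// gt_eqF.
pose V : 'M[R]_n := \matrix_i s2val (ex i).
have rV i : row i V = s2val (ex i) by rewrite rowK.
have entry (A : 'M[R]_n) i j : (V *m A *m V^T) i j = (row i V *m A *m (row j V)^T) ord0 ord0.
  rewrite -row_mul [RHS]mxE [LHS]mxE; apply: eq_bigr => k _.
  by rewrite [row i _ _ _]mxE [V^T _ _]mxE [(row j V)^T _ _]mxE [row j V _ _]mxE.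
have rW i : row i V *m w.1 = l ord0 i *: (row i V *m S) by rewrite rV; exact: (s2valP (ex i)).
have flip (A : 'M[R]_n) (u v : 'rV[R]_n) : A^T = A ->
    (u *m A *m v^T) ord0 ord0 = (v *m A *m u^T) ord0 ord0.
  move=> AT; rewrite -[in LHS]mulmxA -[in RHS]mulmxA.
  by rewrite -[LHS]trace_mx11 -[RHS]trace_mx11 -[RHS]mxtrace_tr !trmx_mul trmxK AT mulmxA.
have VSV : V *m S *m V^T = 1%:M.
  apply/matrixP => i j; rewrite entry [RHS]mxE; have [<-|ij] := eqVneq i j.
    by rewrite rV; exact: (s2valP' (ex i)).
  (* Both sides are the value of the symmetric form W_1 at rows [i] and [j], computed from either
     argument. *)
  have e : l ord0 i * (row i V *m S *m (row j V)^T) ord0 ord0 =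
           l ord0 j * (row i V *m S *m (row j V)^T) ord0 ord0.
    have sc (a : R) (A : 'M[R]_1) : a * A ord0 ord0 = (a *: A) ord0 ord0 by rewrite mxE.
    rewrite [in RHS](flip _ _ _ (posdef_sym pS)) !sc.
    rewrite (scalemxAl _ (row i V *m S)) (scalemxAl _ (row j V *m S)) -!rW.
    exact: (flip _ _ _ (posdef_sym p1)).
  have lij : l ord0 i != l ord0 j.
    by case: (ltngtP i j) ij => [/lo/lt_eqF|/lo/gt_eqF|/val_inj->]; rewrite ?eqxx// eq_sym => ->.
  by move/eqP: e; rewrite -subr_eq0 -mulrBl mulf_eq0 subr_eq0 (negbTE lij) => /eqP.
have VWV : V *m w.1 *m V^T = diag_mx l.
  have -> : V *m w.1 = diag_mx l *m V *m S.
    apply/row_matrixP => i; rewrite row_mul rW -mulmxA row_mul row_diag_mx -scalemxAl.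
    by rewrite -rowE row_mul.
  by rewrite -!mulmxA (mulmxA V) VSV mulmx1.
have /mulmx1_unit[uV _] : V *m (S *m V^T) = 1%:M by rewrite mulmxA.
have uVT : V^T \in unitmx by rewrite unitmx_tr.
have w1E : w.1 = invmx V *m diag_mx l *m (invmx V)^T.
  by rewrite -VWV trmx_inv !mulmxA mulVmx// mul1mx mulmxK.
have w2E : w.2 = invmx V *m (1%:M - diag_mx l) *m (invmx V)^T.
  rewrite mulmxBr mulmxBl mulmx1 -w1E (_ : w.2 = S - w.1); last by rewrite addrC addKr.
  congr (_ - _); rewrite -[S in LHS](mulKmx uV) -[X in _ *m X](mulmxK uVT) mulmxA VSV.
  by rewrite mulmx1 trmx_inv.
have uVV : invmx V \in unitmx by rewrite unitmx_inv.
exists (invmx V), l; split=> //; split=> // i; apply/andP; split.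
  by move: p1; rewrite w1E => /posdef_congrE-/(_ uVV)/posdef_diagP/(_ i).
move: p2; rewrite w2E -diag_const_mx -linearB/= => /posdef_congrE-/(_ uVV)/posdef_diagP/(_ i).
by rewrite !mxE subr_gt0.
Qed.

Lemma measurable_bool_set d (T : measurableType d) (b : T -> bool) :
  measurable_fun setT b -> measurable [set x | b x].
Proof.
move=> mb; rewrite (_ : [set x | b x] = setT `&` b @^-1` [set true]) ?setTI//.
by rewrite -[X in measurable X]setTI; exact: mb.
Qed.

Lemma measurable_eq_mx d (T : measurableType d) m m' (f g : T -> 'M[R]_(m, m')) :
  measurable_fun setT f -> measurable_fun setT g -> measurable [set x | f x = g x].
Proof.
move=> mf mg; rewrite (_ : [set x | _] = \bigcap_(i in [set: 'I_m]) \bigcap_(j in [set: 'I_m'])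
    [set x | f x i j == g x i j]).
  apply: fin_bigcap_measurable => // i _; apply: fin_bigcap_measurable => // j _.
  by apply: measurable_bool_set; apply: measurable_fun_eqr; mx_measurable.
apply/seteqP; split=> x /=; first by move=> fg i _ j _ /=; rewrite fg.
by move=> fg; apply/matrixP => i j; apply/eqP; exact: fg.
Qed.

Lemma measurable_unitmx : measurable (GL R n).
Proof.
rewrite (_ : GL R n = [set A | \det A != 0]).
  rewrite (_ : [set A | _] = ~` [set A : 'M[R]_n | \det A == 0]).
    by apply: measurableC; apply: measurable_bool_set; apply: measurable_fun_eqr; mx_measurable.
  by apply/seteqP; split=> A /= /negP.
by apply/seteqP; split=> A /=; rewrite /GL/= unitmxE unitfE.
Qed.

Lemma measurable_ordered_roots : measurable (ordered_roots R n).
Proof.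
rewrite (_ : ordered_roots R n =
  (\bigcap_(i in [set: 'I_n]) [set l : 'rV[R]_n | 0 < l ord0 i < 1]) `&`
  (\bigcap_(i in [set: 'I_n]) \bigcap_(j in [set: 'I_n])
     [set l : 'rV[R]_n | (i < j)%N ==> (l ord0 j < l ord0 i)])).
  apply: measurableI; apply: fin_bigcap_measurable => // i _.
    apply: measurable_bool_set; apply: measurable_and; apply: measurable_fun_ltr; mx_measurable.
  apply: fin_bigcap_measurable => // j _; apply: measurable_bool_set.
  by case: (i < j)%N => /=; [apply: measurable_fun_ltr; mx_measurable|exact: measurable_cst].
apply/seteqP; split=> l /=.
  by move=> [l01 lo]; split=> [i _|i _ j _ /=]; [exact: l01|apply/implyP; exact: lo].
by move=> [l01 lo]; split=> [i|i j ij]; [exact: l01|exact: (implyP (lo i I j I))].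
Qed.

Lemma measurable_decomposition d (T : measurableType d) (w : T -> 'M[R]_n * 'M[R]_n)
    (B : T -> 'M[R]_n) (l : T -> 'rV[R]_n) :
  measurable_fun setT w -> measurable_fun setT B -> measurable_fun setT l ->
  measurable [set x | decomposition (w x) (B x, l x)].
Proof.
move=> mw mB ml; rewrite (_ : [set x | _] = (B @^-1` GL R n `&` l @^-1` ordered_roots R n) `&`
   ([set x | (w x).1 = B x *m diag_mx (l x) *m (B x)^T] `&`
    [set x | (w x).2 = B x *m (1%:M - diag_mx (l x)) *m (B x)^T])); last first.
  by apply/seteqP; split=> x; [move=> [? ? ? ?]; split|move=> [[? ?] [? ?]]].
apply: measurableI; apply: measurableI.
- by rewrite -[X in measurable X]setTI; apply: mB => //; exact: measurable_unitmx.
- by rewrite -[X in measurable X]setTI; apply: ml => //; exact: measurable_ordered_roots.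
- by apply: measurable_eq_mx; mx_measurable.
- by apply: measurable_eq_mx; mx_measurable.
Qed.

Lemma cand_decomposition w : sampleX R n w -> decomposition w (cand_basis w, cand_root w).
Proof.
move=> /sampleX_decomposition[B [l Bl]]; have [s ->] := cand_basisE Bl.
by rewrite (cand_rootE Bl); exact: decomposition_col_signs.
Qed.

(** A pair lies in the sample space exactly when the candidates computed by power iteration form a
    decomposition of it, which is a matter of measurable equations and inequalities. *)
Lemma measurable_sampleX : measurable (sampleX R n).
Proof.
rewrite (_ : sampleX R n = [set w | decomposition w (cand_basis w, cand_root w)]).
  by apply: measurable_decomposition; [mx_measurable|exact: measurable_cand_basis|exact: measurable_cand_root].
by apply/seteqP; split=> w; [exact: cand_decomposition|exact: decomposition_sampleX].
Qed.

Lemma choose_decompositionP w : sampleX R n w -> decomposition w (B_of w, l_of w).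
Proof.
move=> /sampleX_decomposition[B [l Bl]].
by rewrite /B_of /l_of -surjective_pairing /choose_decomposition; exact: xgetPex (ex_intro _ (B, l) Bl).
Qed.

Lemma l_ofE w B l : decomposition w (B, l) -> l_of w = l.
Proof.
move=> Bl; have := choose_decompositionP (decomposition_sampleX Bl).
by move=> /cand_rootE <-; exact: cand_rootE Bl.
Qed.

(** Both matrices agree up to signs with [cand_basis w], which depends on [w] alone; this yields the
    uniqueness of the decomposition. *)
Lemma B_ofE w B l : decomposition w (B, l) -> exists s, B_of w = B *m col_signs R s.
Proof.
move=> Bl; have [s sE] := cand_basisE Bl.
have [s' s'E] := cand_basisE (choose_decompositionP (decomposition_sampleX Bl)).
exists (fun j => s j (+) s' j); rewrite -col_signsM mulmxA -sE s'E -mulmxA col_signsM.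
rewrite (_ : col_signs R _ = 1%:M) ?mulmx1//.
by apply/matrixP => i j; rewrite !mxE addbb.
Qed.

Section normalized.
Variable P : 'M[R]_n -> 'M[R]_n.
Hypothesis PN : forall L, ordered_diag R n L -> monomial_mx R n (P L).
Hypothesis mP : measurable_fun (ordered_diag R n) P.

(** The identity as default value makes the function measurable and invertible on the whole
    space. *)
Definition P_of l : 'M[R]_n := if l \in ordered_roots R n then P (diag_mx l) else 1%:M.

Lemma P_ofE l : ordered_roots R n l -> P_of l = P (diag_mx l).
Proof. by move=> ol; rewrite /P_of mem_set. Qed.

Lemma P_of_monomial l : ordered_roots R n l -> monomial_mx R n (P_of l).
Proof. by move=> ol; rewrite P_ofE//; apply: PN; exists l. Qed.

Lemma P_of_unit l : P_of l \in unitmx.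
Proof.
rewrite /P_of; case: ifPn => [/set_mem ol|_]; last exact: unitmx1.
by have [] := PN (ex_intro2 _ _ l ol erefl).
Qed.

Lemma measurable_ordered_diag : measurable (ordered_diag R n).
Proof.
pose r (L : 'M[R]_n) : 'rV[R]_n := \row_i L i i.
have mr : measurable_fun setT r.
  apply: measurable_fun_mxP => i j; rewrite /r; under eq_fun do rewrite mxE.
  exact: measurable_mxE.
rewrite (_ : ordered_diag R n = [set L | L = diag_mx (r L)] `&` r @^-1` ordered_roots R n).
  apply: measurableI; first by apply: measurable_eq_mx; mx_measurable.
  by rewrite -[X in measurable X]setTI; apply: mr => //; exact: measurable_ordered_roots.
have rK l : r (diag_mx l) = l by apply/rowP => i; rewrite !mxE eqxx mulr1n.
apply/seteqP; split=> L /=; first by move=> [l ol <-]; rewrite rK.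
by move=> [LE ol]; exists (r L).
Qed.

Lemma measurable_P_of : measurable_fun setT P_of.
Proof.
apply: measurable_fun_if => //.
- apply: (measurable_fun_bool true); rewrite setTI (_ : _ @^-1` _ = ordered_roots R n).
    exact: measurable_ordered_roots.
  by apply/seteqP; split=> l /=; [move/set_mem|move/mem_set].
- apply: (measurable_comp (F := ordered_diag R n)) => //.
  + exact: measurable_ordered_diag.
  + by move=> _ [l [_ /set_mem ol] <-]; exists l.
  + by apply: (measurable_funS measurableT) => //; mx_measurable.
Qed.

(** [g_of] rests on arbitrary choices; measurability is proved for this explicit function, which
    agrees with it on [sampleX]. *)
Definition g_cand w : 'M[R]_n := norm_signs (cand_basis w *m invmx (P_of (cand_root w))).

Lemma measurable_g_cand : measurable_fun setT g_cand.
Proof.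
apply: measurable_norm_signs; apply: measurable_mulmx; first exact: measurable_cand_basis.
apply: measurable_invmx; apply: measurableT_comp; first exact: measurable_P_of.
exact: measurable_cand_root.
Qed.

Lemma norm_signs_mul_invmx B s l : B \in unitmx -> ordered_roots R n l ->
  norm_signs (B *m col_signs R s *m invmx (P_of l)) = norm_signs (B *m invmx (P_of l)).
Proof.
move=> uB ol; have [s' E] := monomial_col_signs s (P_of_monomial ol).
by rewrite -mulmxA E mulmxA norm_signs_col_signs// unitmx_mul uB unitmx_inv P_of_unit.
Qed.

Lemma g_ofE w B l : decomposition w (B, l) -> g_of P w = norm_signs (B *m invmx (P_of l)).
Proof.
move=> Bl; have [/= uB ol _ _] := Bl; have [s sE] := B_ofE Bl.
rewrite /g_of /L_of (l_ofE Bl) -P_ofE// sE.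
have uBP : B *m col_signs R s *m invmx (P_of l) \in unitmx.
  by rewrite !unitmx_mul uB col_signs_unit unitmx_inv P_of_unit.
have [s' s'E] := norm_signsE uBP.
rewrite -(norm_signs_mul_invmx s uB ol).
set A := [set _ | _]; have : A (xget 1%:M A).
  by apply: (xgetPex _); exists (norm_signs (B *m col_signs R s *m invmx (P_of l))); split;
    [exact: norm_signs_half|exists s'].
by move=> [half [t tE]]; rewrite tE in half *; rewrite (GLhalf_norm_signs half).
Qed.

Lemma g_candE w : sampleX R n w -> g_of P w = g_cand w.
Proof. by move=> Xw; exact: g_ofE (cand_decomposition Xw). Qed.

Lemma g_of_half w : sampleX R n w -> GLhalf R n (g_of P w).
Proof.
move=> Xw; rewrite g_candE//; apply: norm_signs_half.
by rewrite unitmx_mul unitmx_inv P_of_unit andbT; have [] := cand_decomposition Xw.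
Qed.

Definition z_root l : 'M[R]_n * 'M[R]_n :=
  (P_of l *m diag_mx l *m (P_of l)^T, P_of l *m (1%:M - diag_mx l) *m (P_of l)^T).

Lemma measurable_z_root : measurable_fun setT z_root.
Proof. by rewrite /z_root; have mP' := measurable_P_of; mx_measurable. Qed.

Lemma z_rootE l : ordered_roots R n l -> z_root l = z_at P (diag_mx l).
Proof. by move=> ol; rewrite /z_root P_ofE. Qed.

Lemma z_root_decomposition l : ordered_roots R n l -> decomposition (z_root l) (P_of l, l).
Proof. by move=> ol; split=> //; exact: P_of_unit. Qed.

(** An image of a measurable set need not be measurable; here it is the set of fixed points in
    [sampleX] of the measurable map z -> z_root (cand_root z). *)
Lemma measurable_Zset : measurable (Zset P).
Proof.
rewrite (_ : Zset P = sampleX R n `&` [set z | z_root (cand_root z) = z]).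
  apply: measurableI; first exact: measurable_sampleX.
  have mz : measurable_fun setT (fun z => z_root (cand_root z)).
    by apply: measurableT_comp; [exact: measurable_z_root|exact: measurable_cand_root].
  rewrite (_ : [set z | _] = [set z | (z_root (cand_root z)).1 = z.1] `&`
     [set z | (z_root (cand_root z)).2 = z.2]).
    by apply: measurableI; apply: measurable_eq_mx; mx_measurable.
  have pE (x y : 'M[R]_n * 'M[R]_n) : x.1 = y.1 -> x.2 = y.2 -> x = y.
    by case: x y => [? ?] [? ?] /= -> ->.
  apply/seteqP; split=> z; last by move=> [z1 z2]; exact: pE.
  by move=> zz; split; [exact: (congr1 fst zz)|exact: (congr1 snd zz)].
apply/seteqP; split=> z.
  move=> [_ [l ol <-] <-]; rewrite -z_rootE//; have dz := z_root_decomposition ol.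
  by split; [exact: decomposition_sampleX dz|rewrite /= (cand_rootE dz)].
move=> [Xz <-]; have [/= _ ol _ _] := cand_decomposition Xz.
by exists (diag_mx (cand_root z)); [exists (cand_root z)|rewrite z_rootE].
Qed.
End normalized.
End decompositions.

(** * The laws of G, Z and L *)

Section sign_symmetrization.
Variables (R : realType) (n : nat).

Lemma GLhalfE : GLhalf R n = GL R n `&` [set A | norm_signs A = A].
Proof.
have c1 : col_signs R (fun _ : 'I_n => false) = 1%:M.
  by rewrite -diag_const_mx; congr diag_mx; apply/rowP => j; rewrite !mxE expr0.
apply/seteqP; split=> A; last by move=> [uA /= <-]; exact: norm_signs_half.
move=> hA; split; first by case: hA.
by have := @GLhalf_norm_signs R n A (fun=> false); rewrite c1 mulmx1; exact.
Qed.

Lemma measurable_GLhalf : measurable (GLhalf R n).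
Proof.
rewrite GLhalfE; apply: measurableI; first exact: measurable_unitmx.
by apply: measurable_eq_mx; [apply: measurable_norm_signs|]; mx_measurable.
Qed.

Lemma col_signs_inj (A : 'M[R]_n) s s' : A \in unitmx ->
  A *m col_signs R s = A *m col_signs R s' -> s =1 s'.
Proof.
move=> uA e j; have [i Ai] := unit_col_nz j uA.
have /matrixP/(_ i j) := e; rewrite !mul_col_signs => /(mulfI Ai).
exact: signr_inj.
Qed.

(** Exactly one of the 2^n sign patterns brings a given invertible matrix into [GLhalf], and each
    pattern preserves Lebesgue measure. *)
Lemma integral_GL_half (F : 'M[R]_n -> \bar R) : measurable_fun setT F ->
  (forall A, 0 <= F A)%E ->
  (forall A s, A \in unitmx -> F (A *m col_signs R s) = F A) ->
  (\int[mxL R n n]_A ((\1_(GL R n) A)%:E * F A) =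
   (2 ^+ n)%:E * \int[mxL R n n]_A ((\1_(GLhalf R n) A)%:E * F A))%E.
Proof.
move=> mF F0 Fs.
pose H A := ((\1_(GLhalf R n) A)%:E * F A)%E.
have mH : measurable_fun setT H.
  apply: emeasurable_funM => //; apply: measurable_EFin_comp; apply: measurable_indic.
  exact: measurable_GLhalf.
have H0 A : (0 <= H A)%E by rewrite mule_ge0// lee_fin.
pose cs (s : {ffun 'I_n -> bool}) : 'M[R]_n := col_signs R s.
have ucs s : cs s \in unitmx by exact: col_signs_unit.
transitivity (\int[mxL R n n]_A (\sum_(s : {ffun 'I_n -> bool}) H (A *m cs s)))%E.
  apply: eq_integral => A _; have [uA|nuA] := boolP (A \in unitmx).
    rewrite indicE mem_set// mul1e.
    have [s0 s0E] := norm_signsE uA.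
    have hs0 : GLhalf R n (A *m cs (finfun s0)).
      rewrite (_ : cs _ = col_signs R s0) -?s0E; first exact: norm_signs_half.
      by congr col_signs; apply/funext => j; rewrite ffunE.
    rewrite (bigD1 (finfun s0))//= big1 ?adde0 => [|s ss0].
      by rewrite /H indicE mem_set// mul1e Fs.
    rewrite /H indicE memNset ?mul0e// => hs; move/eqP: ss0; apply.
    apply/ffunP; apply: (col_signs_inj uA).
    by rewrite -(GLhalf_norm_signs hs) -(GLhalf_norm_signs hs0).
  rewrite indicE memNset ?mul0e; last by move/negP : nuA.
  rewrite big1// => s _; rewrite /H indicE memNset ?mul0e//.
  by move=> [+ _]; rewrite unitmx_mul (negbTE nuA).
rewrite ge0_integral_sum//; last first.
  by move=> s; apply: (measurableT_comp mH); mx_measurable.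
transitivity (\sum_(s : {ffun 'I_n -> bool}) (1%:E * \int[mxL R n n]_A H A))%E.
  apply: eq_bigr => s _; rewrite mul1e -[RHS](integral_mulmxr (ucs s) mH H0).
  by rewrite det_col_signs expr1n mul1e.
rewrite -ge0_sume_distrl//; congr (_ * _)%E.
by rewrite sumEFin sumr_const card_ffun card_bool card_ord natrX.
Qed.
End sign_symmetrization.

(** * From the sample space to the variables G and l *)

Section change_of_variables.
Variables (R : realType) (n : nat) (a b : R) (P : 'M[R]_n -> 'M[R]_n).
Hypothesis PN : forall L, ordered_diag R n L -> monomial_mx R n (P L).
Hypothesis mP : measurable_fun (ordered_diag R n) P.

Let al := a - (n%:R + 1) / 2.
Let be := b - (n%:R + 1) / 2.
Let ex := 2 * (a + b) - n%:R.

Definition beta_weight (x y : R) (l : 'rV[R]_n) : R :=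
  (\prod_(i < n) (l ord0 i) `^ x) * (\prod_(i < n) (1 - l ord0 i) `^ y) * vdm l.

Definition root_weight (l : 'rV[R]_n) : R :=
  \1_(ordered_roots R n) l * (`|\det (P_of P l)| `^ (2 * (a + b)) * beta_weight al be l).

Lemma prod_powR (I : Type) (r : seq I) (f : I -> R) x : (forall i, 0 <= f i) ->
  (\prod_(i <- r) f i) `^ x = \prod_(i <- r) (f i) `^ x.
Proof.
move=> f0; elim: r => [|i r IH]; first by rewrite !big_nil powR1.
by rewrite !big_cons powRM ?IH//; apply: prodr_ge0.
Qed.

Lemma det_congr_diag_powR (B : 'M[R]_n) (d : 'rV[R]_n) x : (forall i, 0 <= d ord0 i) ->
  (\det (B *m diag_mx d *m B^T)) `^ x = `|\det B| `^ (2 * x) * \prod_(i < n) (d ord0 i) `^ x.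
Proof.
move=> d0; rewrite !det_mulmx det_tr det_diag mulrAC -expr2 powRM ?sqr_ge0//; last exact: prodr_ge0.
rewrite prod_powR//; congr (_ * _).
by rewrite -(real_normK (num_real _)) -powR_mulrn// -powRrM.
Qed.

Lemma density_jac (B : 'M[R]_n) (l : 'rV[R]_n) : B \in unitmx -> ordered_roots R n l ->
  (\det (B *m diag_mx l *m B^T)) `^ al * (\det (B *m (1%:M - diag_mx l) *m B^T)) `^ be * jac B l =
  `|\det B| `^ ex * beta_weight al be l.
Proof.
move=> uB ol; have [l01 _] := ol.
have D0 : `|\det B| != 0 by rewrite normr_eq0 -unitfE -unitmxE.
rewrite -diag_const_mx -linearB/= !det_congr_diag_powR; first last.
- by move=> i; have /andP[/ltW] := l01 i.
- by move=> i; rewrite !mxE subr_ge0; have /andP[_ /ltW] := l01 i.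
rewrite /jac (ordered_decr ol) mul1r -powR_mulrn// /beta_weight.
have -> : \prod_(i < n) (const_mx 1 - l) ord0 i `^ be = \prod_(i < n) (1 - l ord0 i) `^ be.
  by apply: eq_bigr => i _; rewrite !mxE.
have -> : ex = 2 * al + 2 * be + n.+2%:R.
  by rewrite /ex /al /be -addn2 natrD; field.
rewrite !powRD ?D0 ?implybT//.
by move: (\prod_(i < n) _) (\prod_(i < n) _) => x y; ring.
Qed.

Lemma root_weight_ge0 l : 0 <= root_weight l.
Proof.
rewrite /root_weight indicE; case: (boolP (_ \in _)) => [/set_mem ol|_]; last by rewrite mul0r.
have v0 := ltW (vdm_ge0 (ordered_decr ol)).
rewrite mul1r mulr_ge0 ?powR_ge0//; apply: mulr_ge0 => //.
by apply: mulr_ge0; apply: prodr_ge0 => i _; exact: powR_ge0.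
Qed.

Lemma measurable_powR_comp d (T : measurableType d) (f : T -> R) x :
  measurable_fun setT f -> measurable_fun setT (fun t => (f t) `^ x).
Proof. by move=> mf; apply: (measurableT_comp (measurable_powR x) mf). Qed.

Lemma measurable_root_weight : measurable_fun setT root_weight.
Proof.
apply: measurable_funM; first by apply: measurable_indic; exact: measurable_ordered_roots.
have mPo := measurable_P_of mP.
apply: measurable_funM; first by apply: measurable_powR_comp; mx_measurable.
apply: measurable_funM; first apply: measurable_funM.
- by apply: measurable_prod => i _; apply: measurable_powR_comp; mx_measurable.
- by apply: measurable_prod => i _; apply: measurable_powR_comp; mx_measurable.
rewrite /vdm; apply: measurable_prod => i _; under eq_fun do rewrite big_mkcond/=.
by apply: measurable_prod => j _; case: (i < j)%N; mx_measurable.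
Qed.

Definition sample_density (w : 'M[R]_n * 'M[R]_n) : R := (\det w.1) `^ al * (\det w.2) `^ be.

Lemma measurable_sample_density : measurable_fun setT sample_density.
Proof. by apply: measurable_funM; apply: measurable_powR_comp; mx_measurable. Qed.

Variable k : 'M[R]_n * 'rV[R]_n -> \bar R.
Hypothesis mk : measurable_fun setT k.
Hypothesis k0 : forall x, (0 <= k x)%E.

Let H w := ((\1_(sampleX R n) w)%:E * (k (g_cand P w, cand_root w) * (sample_density w)%:E))%E.

Let H0 w : (0 <= H w)%E.
Proof. by rewrite !mule_ge0// lee_fin ?mulr_ge0 ?powR_ge0. Qed.

Let mH : measurable_fun setT H.
Proof.
apply: emeasurable_funM.
  by apply: measurable_EFin_comp; apply: measurable_indic; exact: measurable_sampleX.
apply: emeasurable_funM; last first.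
  by apply: measurable_EFin_comp; exact: measurable_sample_density.
apply: (measurableT_comp mk); apply/measurable_fun_pair.
  exact: (measurable_g_cand mP).
exact: measurable_cand_root.
Qed.

(** [H] in the coordinates S = W_1 + W_2 and W = W_1 of a pencil. *)
Let h (w : 'M[R]_n * 'M[R]_n) : \bar R := H (w.2, w.1 - w.2).

Let mh : measurable_fun setT h. Proof. by rewrite /h; mx_measurable. Qed.

Let h_pencil (B : 'M[R]_n) l : B \in unitmx -> ordered_roots R n l ->
  decomposition ((pencil B l).2, (pencil B l).1 - (pencil B l).2) (B, l).
Proof. by move=> uB ol; split=> //=; rewrite mulmxBr mulmxBl mulmx1. Qed.

(** Positivity of W and of S - W bounds the roots by 0 and 1. *)
Let pencil_sample (B : 'M[R]_n) l : B \in unitmx -> decr l ->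
  sampleX R n ((pencil B l).2, (pencil B l).1 - (pencil B l).2) -> ordered_roots R n l.
Proof.
move=> uB /decrP dl [/= p2 p1 _]; split=> // i.
rewrite -[X in X < l ord0 i]/(0 : R).
have := p1; rewrite -[B *m B^T]/((pencil B l).1) -[X in posdef _ _ (X - _)]scale1r.
move=> /(posdef_pencil l 1 uB)/(_ i) ->; rewrite andbT.
by move/(posdef_congrE _ uB)/posdef_diagP : p2.
Qed.

Let psi l (B : 'M[R]_n) : \bar R := ((\1_(GL R n) B)%:E *
  (k (norm_signs (B *m invmx (P_of P l)), l) * (`|\det B| `^ ex * beta_weight al be l)%:E))%E.

Let beta_weight_ge0 l : ordered_roots R n l -> 0 <= beta_weight al be l.
Proof.
move=> ol; have v0 := ltW (vdm_ge0 (ordered_decr ol)); apply: mulr_ge0 => //.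
by apply: mulr_ge0; apply: prodr_ge0 => i _; exact: powR_ge0.
Qed.

Let psi_ge0 l B : ordered_roots R n l -> (0 <= psi l B)%E.
Proof.
by move=> ol; rewrite !mule_ge0// lee_fin// mulr_ge0 ?powR_ge0 ?beta_weight_ge0.
Qed.

Let measurable_indic_comp d (T : measurableType d) (A : set 'M[R]_n) (f : T -> 'M[R]_n) :
  measurable A -> measurable_fun setT f -> measurable_fun setT (fun t => (\1_A (f t) : R)%:E).
Proof.
move=> mA mf; apply: measurable_EFin_comp; apply: (measurableT_comp _ mf).
exact: measurable_indic.
Qed.

Let measurable_psi l : measurable_fun setT (psi l).
Proof.
apply: emeasurable_funM.
  by apply: measurable_indic_comp; [exact: measurable_unitmx|mx_measurable].
apply: emeasurable_funM.
  apply: (measurableT_comp mk); apply/measurable_fun_pair; last by mx_measurable.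
  by apply: measurable_norm_signs; mx_measurable.
by apply: measurable_EFin_comp; apply: measurable_funM; [apply: measurable_powR_comp|]; mx_measurable.
Qed.

Let h_psi l B : ordered_roots R n l -> (h (pencil B l) * (jac B l)%:E)%E = psi l B.
Proof.
move=> ol; rewrite /psi indicE; have [uB|nuB] := boolP (B \in unitmx); last first.
  rewrite memNset; last by move/negP: nuB.
  move: nuB; rewrite unitmxE unitfE negbK => /eqP dB.
  by rewrite /jac dB normr0 expr0n mul0r mulr0 mule0 mul0e.
rewrite mem_set// mul1e.
have dw := h_pencil uB ol.
rewrite /h /H indicE mem_set ?mul1e; last exact: decomposition_sampleX dw.
rewrite -(g_candE PN (decomposition_sampleX dw)) (g_ofE PN dw) (cand_rootE dw).
rewrite -muleA -EFinM /sample_density; congr (_ * _%:E)%E.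
by rewrite -(density_jac uB ol) /=; congr (_ * (\det _) `^ _ * _); rewrite mulmxBr mulmxBl mulmx1.
Qed.

(** B = G P(L) contributes |det P|^n, which completes the exponent 2(a+b) in [root_weight]. The
    integrand then depends on G only up to column signs, so the integral over GL folds onto its
    half. *)
Let inner_half l : ordered_roots R n l ->
  (\int[mxL R n n]_B psi l B = (2 ^+ n)%:E * \int[mxL R n n]_G
     ((root_weight l)%:E * ((\1_(GLhalf R n) G)%:E * (k (G, l) * (`|\det G| `^ ex)%:E))))%E.
Proof.
move=> ol; have uP := P_of_unit PN l.
have q0 : `|\det (P_of P l)| != 0 by rewrite normr_eq0 -unitfE -unitmxE.
pose F G := (k (norm_signs G, l) * (`|\det G| `^ ex * root_weight l)%:E)%E.
have F0 G : (0 <= F G)%E.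
  by rewrite mule_ge0// lee_fin mulr_ge0 ?powR_ge0 ?root_weight_ge0.
have mF : measurable_fun setT F.
  apply: emeasurable_funM.
    apply: (measurableT_comp mk); apply/measurable_fun_pair; last by mx_measurable.
    by apply: measurable_norm_signs; mx_measurable.
  by apply: measurable_EFin_comp; apply: measurable_funM; [apply: measurable_powR_comp|]; mx_measurable.
have p0 B := psi_ge0 B ol.
rewrite -(integral_mulmxr uP (measurable_psi l) p0).
transitivity (\int[mxL R n n]_G ((\1_(GL R n) G)%:E * F G))%E.
  rewrite -ge0_integralZl; first last.
  - by rewrite lee_fin exprn_ge0.
  - by move=> G _; exact: p0.
  - by apply: (measurableT_comp (measurable_psi l)); mx_measurable.
  - exact: measurableT.
  apply: eq_integral => G _; rewrite /psi /F mulmxK// !indicE.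
  have -> : (G *m P_of P l \in GL R n) = (G \in GL R n).
    have GLP (A : 'M[R]_n) : (A \in GL R n) = (A \in unitmx).
      by apply/idP/idP => [/set_mem|uA]; [exact|exact/mem_set].
    by rewrite !GLP unitmx_mul uP andbT.
  rewrite [LHS]muleCA; congr (_ * _)%E; rewrite [LHS]muleCA; congr (_ * _)%E.
  rewrite -EFinM det_mulmx normrM powRM//; congr (_%:E).
  rewrite /root_weight indicE mem_set// mul1r.
  have -> : 2 * (a + b) = ex + n%:R by rewrite /ex subrK.
  have -> : `|\det (P_of P l)| `^ (ex + n%:R) =
      `|\det (P_of P l)| `^ ex * `|\det (P_of P l)| ^+ n.
    by rewrite [LHS]powRD ?q0 ?implybT// powR_mulrn.
  by move: (_ ^+ n) (beta_weight _ _ _) => x y; ring.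
rewrite (integral_GL_half mF F0); last first.
  move=> G s uG; rewrite /F norm_signs_col_signs// det_mulmx normrM.
  by rewrite (det_col_signs R) mulr1.
congr (_ * _)%E; apply: eq_integral => G _; rewrite /F indicE.
case: (boolP (_ \in _)) => [/set_mem|_]; last by rewrite !mul0e mule0.
rewrite GLhalfE => -[_ /= ->]; rewrite !mul1e EFinM [RHS]muleCA; congr (_ * _)%E.
exact: muleC.
Qed.

Lemma integral_sampleX :
  (\int[symL R n]_W1 \int[symL R n]_W2 H (W1, W2) =
   (2 ^+ n)%:E * \int[mxL R 1 n]_l \int[mxL R n n]_G
     ((root_weight l)%:E * ((\1_(GLhalf R n) G)%:E * (k (G, l) * (`|\det G| `^ ex)%:E))))%E.
Proof.
have X_sym w : H w != 0%E -> w.1^T = w.1.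
  rewrite /H indicE; case: (boolP (_ \in _)) => [/set_mem[[]]//|_].
  by rewrite mul0e eqxx.
transitivity (pair_integral h).
  transitivity (\int[symL R n]_W1 \int[symL R n]_S h (S, W1))%E.
    apply: eq_integral => W _; have [WT|WT] := pselect (W^T = W).
      have mhW : measurable_fun setT (fun S => h (S, W)) by mx_measurable.
      apply: etrans (integral_symL_shift WT mhW (fun S => H0 _)).
      by apply: eq_integral => A _; rewrite /h /= addrC addKr.
    have HW W2 : H (W, W2) = 0%E by apply/eqP; apply: contrapT => /negP/X_sym.
    transitivity (0%E : \bar R); [|apply/esym]; apply: integral0_eq => A _; exact: HW.
  apply: (integral_swap (fun W S => h (S, W))); first by mx_measurable.
  by move=> *; exact: H0.
rewrite (pencil_change_of_variables mh (fun w => H0 _)); last first.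
  move=> [S W]; rewrite /h /H /= indicE.
  case: (boolP (_ \in _)) => [/set_mem/sampleX_decomposition[B [l Bl]] _|_]; last first.
    by rewrite mul0e eqxx.
  have [/= uB ol E1 _] := Bl; exists B, l; split=> //; first exact: ordered_decr.
  by rewrite /pencil -E1 -(decomposition_add Bl) /= addrC subrK.
have mG : measurable_fun setT (fun l => \int[mxL R n n]_G
     ((root_weight l)%:E * ((\1_(GLhalf R n) G)%:E * (k (G, l) * (`|\det G| `^ ex)%:E))))%E.
  apply: (measurable_integral (m2 := mxL R n n) (fun (l : 'rV[R]_n) (G : 'M[R]_n) =>
     ((root_weight l)%:E * ((\1_(GLhalf R n) G)%:E * (k (G, l) * (`|\det G| `^ ex)%:E))))%E); last first.
    by move=> l G; rewrite !mule_ge0// lee_fin// ?powR_ge0 ?root_weight_ge0.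
  apply: emeasurable_funM.
    apply: measurable_EFin_comp; apply: measurableT_comp; first exact: measurable_root_weight.
    by mx_measurable.
  apply: emeasurable_funM.
    by apply: measurable_indic_comp; [exact: measurable_GLhalf|mx_measurable].
  apply: emeasurable_funM; first by mx_measurable.
  by apply: measurable_EFin_comp; apply: measurable_powR_comp; mx_measurable.
rewrite -ge0_integralZl; first last.
- by rewrite lee_fin exprn_ge0.
- by integral_nonneg; rewrite !mule_ge0// lee_fin// ?powR_ge0 ?root_weight_ge0.
- exact: mG.
- exact: measurableT.
apply: eq_integral => l _; have [ol|nol] := pselect (ordered_roots R n l).
  by rewrite -inner_half//; apply: eq_integral => B _; exact: h_psi.
transitivity (0%E : \bar R).
  apply: integral0_eq => B _; apply/eqP; rewrite mule_eq0 eqe /jac.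
  case: (boolP (decr l)) => dl; last by rewrite mul0r eqxx orbT.
  have [uB|] := boolP (B \in unitmx); last first.
    by rewrite unitmxE unitfE negbK => /eqP ->; rewrite normr0 expr0n mul0r mulr0 eqxx orbT.
  by rewrite /h /H indicE memNset ?mul0e ?eqxx// => /(pencil_sample uB dl).
rewrite integral0_eq ?mule0// => G _.
by rewrite /root_weight indicE memNset// mul0r mul0e.
Qed.

End change_of_variables.

Section integral_helpers.
Context d (T : measurableType d) (R : realType) (mu : {measure set T -> \bar R}).

Lemma integral_indic_in (D : set T) (f : T -> \bar R) :
  (\int[mu]_(x in D) f x = \int[mu]_x ((\1_D x)%:E * f x))%E.
Proof.
rewrite integral_mkcond; apply: eq_integral => x _; rewrite patchE indicE.
by case: (x \in D); rewrite ?mul1e ?mul0e.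
Qed.

Lemma integral_max_diff (D : set T) (f : T -> R) :
  (\int[mu]_(x in D) (f x)%:E =
   \int[mu]_(x in D) (Num.max 0 (f x))%:E - \int[mu]_(x in D) (Num.max 0 (- f x))%:E)%E.
Proof.
rewrite integralE; congr (_ - _)%E; apply: eq_integral => x _.
  by rewrite funeposE -EFin_max maxC.
by rewrite funenegE -EFinN -EFin_max maxC.
Qed.
End integral_helpers.

(** * Splitting the density into positive and negative parts *)

Section density.
Variables (R : realType) (p : nat) (a b : R) (P : 'M[R]_p -> 'M[R]_p) (t : 'M[R]_p -> R).
Hypothesis PN : forall L, ordered_diag R p L -> monomial_mx R p (P L).
Hypothesis mP : measurable_fun (ordered_diag R p) P.
Hypothesis mt : measurable_fun (GL R p) t.
Hypothesis t_signs : forall (B : 'M[R]_p) (s : 'I_p -> bool),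
  GL R p B -> t (B *m col_signs R s) = t B.

Definition t_GL (A : 'M[R]_p) : R := if A \in GL R p then t A else 0.

Lemma measurable_t_GL : measurable_fun setT t_GL.
Proof.
apply: measurable_fun_if => //.
- apply: (measurable_fun_bool true); rewrite setTI (_ : _ @^-1` _ = GL R p).
    exact: measurable_unitmx.
  by apply/seteqP; split=> l /=; [move/set_mem|move/mem_set].
- apply: measurable_funS mt; first exact: measurable_unitmx.
  by move=> A [_ /set_mem].
Qed.

Definition t_pos A : R := Num.max 0 (t_GL A).
Definition t_neg A : R := Num.max 0 (- t_GL A).

Definition sign_invariant (u : 'M[R]_p -> R) := [/\ measurable_fun setT u,
  forall A, 0 <= u A & forall A s, A \in unitmx -> u (A *m col_signs R s) = u A].

Lemma t_GL_signs A s : A \in unitmx -> t_GL (A *m col_signs R s) = t_GL A.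
Proof.
move=> uA; rewrite /t_GL !mem_set ?t_signs//.
by rewrite /GL /= unitmx_mul uA col_signs_unit.
Qed.

Lemma t_pos_invariant : sign_invariant t_pos.
Proof.
split=> [|A|A s uA]; last by rewrite /t_pos t_GL_signs.
  by apply: measurable_maxr; [exact: measurable_cst|exact: measurable_t_GL].
by rewrite le_max lexx.
Qed.

Lemma t_neg_invariant : sign_invariant t_neg.
Proof.
split=> [|A|A s uA]; last by rewrite /t_neg t_GL_signs.
  apply: measurable_maxr; [exact: measurable_cst|apply: measurable_funN].
  exact: measurable_t_GL.
by rewrite le_max lexx.
Qed.

Let ex := 2 * (a + b) - p%:R.

Definition G_mass (u : 'M[R]_p -> R) (B : set 'M[R]_p) : \bar R :=
  (\int[mxL R p p]_G ((\1_(GLhalf R p) G)%:E * ((\1_B G * u G)%:E * (`|\det G| `^ ex)%:E)))%E.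

Definition root_mass (A : set 'rV[R]_p) : \bar R :=
  (\int[mxL R 1 p]_l (root_weight a b P l * \1_A l)%:E)%E.

Lemma G_mass_ge0 u B : sign_invariant u -> (0 <= G_mass u B)%E.
Proof.
move=> [_ u0 _]; apply: integral_ge0 => G _.
by rewrite !mule_ge0// lee_fin ?mulr_ge0 ?powR_ge0.
Qed.

Lemma root_mass_ge0 A : (0 <= root_mass A)%E.
Proof. by apply: integral_ge0 => l _; rewrite lee_fin mulr_ge0// root_weight_ge0. Qed.

Lemma measurable_G_integrand u B : sign_invariant u -> measurable B ->
  measurable_fun setT (fun G => ((\1_(GLhalf R p) G)%:E *
    ((\1_B G * u G)%:E * (`|\det G| `^ ex)%:E))%E).
Proof.
move=> [mu _ _] mB; apply: emeasurable_funM; last apply: emeasurable_funM.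
- by apply: measurable_EFin_comp; apply: measurable_indic; exact: measurable_GLhalf.
- by apply: measurable_EFin_comp; apply: measurable_funM => //; exact: measurable_indic.
- by apply: measurable_EFin_comp; apply: measurable_powR_comp; mx_measurable.
Qed.

(** The transformed integrand is a product of a function of l and a function of G, so the mass of a
    rectangle factors; independence and both marginal laws are read off from this. *)
Lemma integral_rectangle u (A : set 'rV[R]_p) (B : set 'M[R]_p) :
  sign_invariant u -> measurable A -> measurable B ->
  (\int[symL R p \x symL R p]_w ((\1_(sampleX R p) w)%:E *
     (((\1_B (g_cand P w) * \1_A (cand_root w)) * u (g_cand P w))%:E * (sample_density a b w)%:E)) =
   (2 ^+ p)%:E * (root_mass A * G_mass u B))%E.
Proof.
move=> ui mA mB; have [mu u0 us] := ui.
pose k (x : 'M[R]_p * 'rV[R]_p) : \bar R := ((\1_B x.1 * \1_A x.2) * u x.1)%:E.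
have mk : measurable_fun setT k.
  apply: measurable_EFin_comp; apply: measurable_funM; last by mx_measurable.
  by apply: measurable_funM; [apply: (measurableT_comp (measurable_indic mB))
    |apply: (measurableT_comp (measurable_indic mA))]; mx_measurable.
have k0 x : (0 <= k x)%E by rewrite lee_fin !mulr_ge0.
have sd0 w : 0 <= sample_density a b w by rewrite mulr_ge0 ?powR_ge0.
rewrite integral_prod; first last.
- by move=> w; rewrite !mule_ge0// lee_fin ?sd0// !mulr_ge0.
- apply: emeasurable_funM.
    by apply: measurable_EFin_comp; apply: measurable_indic; exact: measurable_sampleX.
  apply: emeasurable_funM; last first.
    by apply: measurable_EFin_comp; exact: measurable_sample_density.
  apply: (measurableT_comp mk (f := k) (g := fun w => (g_cand P w, cand_root w))).
  apply/measurable_fun_pair; first exact: (measurable_g_cand mP).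
  exact: measurable_cand_root.
apply: etrans (integral_sampleX a b PN mP mk k0) _; congr (_ * _)%E.
transitivity (\int[mxL R 1 p]_l ((root_weight a b P l * \1_A l)%:E * G_mass u B))%E.
  apply: eq_integral => l _; rewrite /G_mass -ge0_integralZl; first last.
  - by rewrite lee_fin mulr_ge0// root_weight_ge0.
  - by move=> G _; rewrite !mule_ge0// lee_fin ?mulr_ge0 ?powR_ge0.
  - exact: measurable_G_integrand.
  - exact: measurableT.
  apply: eq_integral => G _; rewrite /k /=.
  by rewrite -!EFinM; congr (_%:E); ring.
rewrite ge0_integralZr//.
- apply: measurable_EFin_comp; apply: measurable_funM; last exact: measurable_indic.
  exact: measurable_root_weight.
- by move=> l _; rewrite lee_fin mulr_ge0// root_weight_ge0.
- exact: G_mass_ge0.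
Qed.

Lemma G_mass_le u B : sign_invariant u -> measurable B -> (G_mass u B <= G_mass u setT)%E.
Proof.
move=> ui mB; have [_ u0 _] := ui; apply: ge0_le_integral => //.
- by move=> G _; rewrite !mule_ge0// lee_fin ?mulr_ge0 ?powR_ge0.
- exact: measurable_G_integrand.
- exact: measurable_G_integrand.
move=> G _; rewrite -!EFinM lee_fin; apply: ler_wpM2l => //.
apply: ler_wpM2r; first exact: powR_ge0.
apply: ler_wpM2r => //.
by rewrite !indicE in_setT; case: (_ \in _).
Qed.

Lemma integral_GLhalf_f (D : set 'M[R]_p) : D `<=` GL R p ->
  (\int[mxL R p p]_(x in D) (t x * `|\det x| `^ ex)%:E =
   \int[mxL R p p]_x ((\1_D x)%:E * (t_pos x * `|\det x| `^ ex)%:E) -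
   \int[mxL R p p]_x ((\1_D x)%:E * (t_neg x * `|\det x| `^ ex)%:E))%E.
Proof.
move=> DG; rewrite (integral_max_diff _ _ (fun x => t x * `|\det x| `^ ex)) !(integral_indic_in _ D).
congr (_ - _)%E; apply: eq_integral => x _; rewrite indicE.
  case: (boolP (_ \in _)) => [/set_mem/DG xG|_]; last by rewrite !mul0e.
  by rewrite !mul1e /t_pos /t_GL mem_set// maxr_pMl ?powR_ge0// mul0r.
case: (boolP (_ \in _)) => [/set_mem/DG xG|_]; last by rewrite !mul0e.
by rewrite !mul1e /t_neg /t_GL mem_set// maxr_pMl ?powR_ge0// mul0r mulNr.
Qed.

Lemma G_massT u : G_mass u setT =
  (\int[mxL R p p]_x ((\1_(GLhalf R p) x)%:E * (u x * `|\det x| `^ ex)%:E))%E.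
Proof.
by apply: eq_integral => G _; rewrite (indicE _ setT) in_setT mul1r -EFinM.
Qed.

Lemma integral_GL_mass u : sign_invariant u ->
  (\int[mxL R p p]_x ((\1_(GL R p) x)%:E * (u x * `|\det x| `^ ex)%:E) =
   (2 ^+ p)%:E * G_mass u setT)%E.
Proof.
move=> [mu u0 us]; rewrite G_massT.
apply: (@integral_GL_half R p (fun x => (u x * `|\det x| `^ ex)%:E)).
- apply: measurable_EFin_comp; apply: measurable_funM => //.
  by apply: measurable_powR_comp; mx_measurable.
- by move=> A; rewrite lee_fin mulr_ge0 ?powR_ge0.
- by move=> A s uA; rewrite us// det_mulmx normrM det_col_signs mulr1.
Qed.

Section law.
Context (d : measure_display) (Omega : measurableType d) (Pr : probability Omega R).
Variable W : {RV Pr >-> ('M[R]_p * 'M[R]_p)%type}.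
Hypothesis WX : forall o, sampleX R p (W o).
Hypothesis W_distr : forall A : set ('M[R]_p * 'M[R]_p), measurable A ->
  distribution Pr W A =
  (\int[symL R p \x symL R p]_(w in A `&` sampleX R p)
     (t (g_of P w) * (\det w.1) `^ (a - (p%:R + 1) / 2)
                   * (\det w.2) `^ (b - (p%:R + 1) / 2))%:E)%E.

Let mass (u : 'M[R]_p -> R) (A : set ('M[R]_p * 'M[R]_p)) : \bar R :=
  (\int[symL R p \x symL R p]_w ((\1_(sampleX R p) w)%:E *
     ((\1_A w * u (g_cand P w))%:E * (sample_density a b w)%:E)))%E.

Let sd0 (w : 'M[R]_p * 'M[R]_p) : 0 <= sample_density a b w.
Proof. by rewrite mulr_ge0 ?powR_ge0. Qed.

Let mass_ge0 u A : sign_invariant u -> (0 <= mass u A)%E.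
Proof.
move=> [_ u0 _]; apply: integral_ge0 => w _.
by rewrite !mule_ge0// lee_fin ?sd0 ?mulr_ge0.
Qed.

Let measurable_mass u A : sign_invariant u -> measurable A ->
  measurable_fun setT (fun w => ((\1_(sampleX R p) w)%:E *
     ((\1_A w * u (g_cand P w))%:E * (sample_density a b w)%:E))%E).
Proof.
move=> [mu _ _] mA; apply: emeasurable_funM; last apply: emeasurable_funM.
- by apply: measurable_EFin_comp; apply: measurable_indic; exact: measurable_sampleX.
- apply: measurable_EFin_comp; apply: measurable_funM; first exact: measurable_indic.
  by apply: (measurableT_comp mu); exact: (measurable_g_cand mP).
- by apply: measurable_EFin_comp; exact: measurable_sample_density.
Qed.

Let law_diff A : measurable A -> distribution Pr W A = (mass t_pos A - mass t_neg A)%E.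
Proof.
move=> mA; rewrite W_distr// integral_max_diff !(integral_indic_in _ (A `&` sampleX R p)).
have tE w : sampleX R p w -> t (g_of P w) = t_GL (g_cand P w).
  move=> Xw; rewrite -(g_candE PN Xw) /t_GL mem_set//.
  by have [] := g_of_half PN Xw.
congr (_ - _)%E; apply: eq_integral => w _; rewrite !indicE in_setI;
  case: (boolP (w \in sampleX R p)) => [/set_mem Xw|_]; rewrite ?andbF ?mul0e// andbT mul1e;
  rewrite tE// -EFinM -EFinM -mulrA -/(sample_density a b w); congr (_%:E);
  by rewrite -?mulNr -mulrA; congr (_ * _); rewrite /t_pos /t_neg maxr_pMl ?mul0r.
Qed.

(** On the event that t is negative the positive part carries no mass, so the probability of the
    event is minus the whole negative mass; being nonnegative, it forces that mass to vanish. *)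
Let mass_neg0 : mass t_neg setT = 0%E.
Proof.
have mg : measurable_fun setT (fun w => t_GL (g_cand P w)).
  by apply: measurableT_comp; [exact: measurable_t_GL|exact: (measurable_g_cand mP)].
pose A := [set w | t_GL (g_cand P w) < 0].
have mA : measurable A by apply: measurable_bool_set; apply: measurable_fun_ltr.
have mp : mass t_pos A = 0%E.
  apply: integral0_eq => w _; rewrite indicE (indicE _ A).
  case: (boolP (w \in A)) => [/set_mem/ltW wA|_]; last by rewrite mul0r mul0e mule0.
  by rewrite /t_pos (max_idPl wA) mulr0 mul0e mule0.
have mn : mass t_neg setT = mass t_neg A.
  apply: eq_integral => w _; congr (_ * (_%:E * _))%E.
  rewrite !indicE in_setT; case: (boolP (w \in A)) => // wA.
  rewrite mul0r mul1r /t_neg; apply/max_idPl; rewrite oppr_le0 leNgt.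
  by apply: contra wA => wA; exact/mem_set.
have : (0 <= distribution Pr W A)%E by exact: measure_ge0.
rewrite law_diff// mp sub0e oppe_ge0 mn => le0.
by apply/eqP; rewrite eq_le le0 mass_ge0//; exact: t_neg_invariant.
Qed.

Let law_pos A : measurable A -> distribution Pr W A = mass t_pos A.
Proof.
move=> mA; rewrite law_diff// (_ : mass t_neg A = 0%E) ?sube0//.
apply/eqP; rewrite eq_le mass_ge0 ?andbT; last exact: t_neg_invariant.
rewrite -mass_neg0; have ti := t_neg_invariant; have [_ t0 _] := ti.
apply: ge0_le_integral => //.
- by move=> w _; rewrite !mule_ge0// lee_fin ?sd0 ?mulr_ge0.
- exact: measurable_mass.
- exact: measurable_mass.
move=> w _; rewrite -!EFinM lee_fin; apply: ler_wpM2l => //.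
apply: ler_wpM2r; first exact: sd0.
apply: ler_wpM2r => //.
by rewrite !indicE in_setT; case: (_ \in _).
Qed.

Let G (o : Omega) := g_of P (W o).
Let l (o : Omega) := l_of (W o).

Lemma g_of_WE : G = (fun o => g_cand P (W o)).
Proof. by apply/funext => o; exact: (g_candE PN (WX o)). Qed.

Lemma l_of_WE : l = (fun o => cand_root (W o)).
Proof.
apply/funext => o; rewrite /l /= -(cand_rootE (choose_decompositionP (WX o))).
by [].
Qed.

Lemma measurable_g_of_W : measurable_fun setT G.
Proof. by rewrite g_of_WE; apply: (measurableT_comp (measurable_g_cand mP)). Qed.

Lemma measurable_l_of_W : measurable_fun setT l.
Proof. by rewrite l_of_WE; apply: (measurableT_comp (@measurable_cand_root R p)). Qed.

Lemma law_rectangle A B : measurable A -> measurable B ->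
  Pr (l @^-1` A `&` G @^-1` B) = ((2 ^+ p)%:E * (root_mass A * G_mass t_pos B))%E.
Proof.
move=> mA mB; rewrite -integral_rectangle//; last exact: t_pos_invariant.
pose C := g_cand P @^-1` B `&` @cand_root R p @^-1` A.
have mC : measurable C.
  apply: measurableI; rewrite -[X in measurable X]setTI.
    exact: (measurable_g_cand mP).
  exact: measurable_cand_root.
rewrite (_ : _ `&` _ = W @^-1` C); last first.
  by rewrite g_of_WE l_of_WE; apply/seteqP; split=> o [].
rewrite -[LHS]/(distribution Pr W C) law_pos//.
apply: eq_integral => w _; congr (_ * ((_ * _)%:E * _))%E.
by rewrite !indicE /C in_setI -natrM mulnb.
Qed.

Lemma neg_mass0 : (root_mass setT * G_mass t_neg setT)%E = 0%E.
Proof.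
have := mass_neg0; have := integral_rectangle t_neg_invariant measurableT measurableT.
have -> : (\int[symL R p \x symL R p]_w ((\1_(sampleX R p) w)%:E *
     (((\1_[set: 'M[R]_p] (g_cand P w) * \1_[set: 'rV[R]_p] (cand_root w)) * t_neg (g_cand P w))%:E *
       (sample_density a b w)%:E)) = mass t_neg setT)%E.
  apply: eq_integral => w _; congr (_ * ((_ * _)%:E * _))%E.
  by rewrite !indicE !in_setT mulr1.
move=> -> /eqP; rewrite mule_eq0 => /orP[|/eqP//].
by rewrite eqe expf_eq0 pnatr_eq0 andbF.
Qed.

Lemma total_mass : ((2 ^+ p)%:E * (root_mass setT * G_mass t_pos setT) = 1)%E.
Proof. by rewrite -law_rectangle// !preimage_setT setIT probability_setT. Qed.

(** A product of two nonnegative extended reals that equals 1 up to the factor 2^p can have neither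
    factor 0, and hence neither factor infinite. *)
Lemma G_mass_bounds : (0 < G_mass t_pos setT < +oo)%E.
Proof.
have tp := t_pos_invariant; have := total_mass.
have := root_mass_ge0 setT; have := G_mass_ge0 setT tp.
have p2 : (0 < (2 ^+ p)%:E :> \bar R)%E by rewrite lte_fin exprn_gt0.
rewrite le_eqVlt => /predU1P[<- _|v0]; first by rewrite !mule0 => /eqP; rewrite eqe eq_sym oner_eq0.
rewrite le_eqVlt => /predU1P[<-|m0]; first by rewrite mul0e mule0 => /eqP; rewrite eqe eq_sym oner_eq0.
move=> E; rewrite v0 /= ltey; apply/negP => /eqP voo.
by move: E; rewrite voo gt0_muley// gt0_muley.
Qed.

(** The negative mass factors through the same root mass as the positive one, and the total mass 1
    shows that root mass to be nonzero. *)
Lemma G_mass_neg0 B : measurable B -> G_mass t_neg B = 0%E.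
Proof.
move=> mB; apply/eqP; rewrite eq_le G_mass_ge0 ?andbT; last exact: t_neg_invariant.
rewrite (le_trans (G_mass_le t_neg_invariant mB))//.
move/eqP: neg_mass0; rewrite mule_eq0 => /orP[/eqP m0|/eqP->//].
have := total_mass; rewrite m0 mul0e mule0 => /eqP.
by rewrite eqe eq_sym oner_eq0.
Qed.

Let c := fine (G_mass t_pos setT).

Let cE : c%:E = G_mass t_pos setT.
Proof.
have /andP[v0 voo] := G_mass_bounds; rewrite /c fineK// ge0_fin_numE//.
exact: ltW.
Qed.

Let c0 : 0 < c.
Proof. by have /andP[+ _] := G_mass_bounds; rewrite -cE lte_fin. Qed.

Lemma c0E : (\int[mxL R p p]_(x in GLhalf R p) (t x * `|\det x| `^ ex)%:E = c%:E)%E.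
Proof.
rewrite integral_GLhalf_f; last by move=> A [].
by rewrite -!G_massT G_mass_neg0// sube0 cE.
Qed.

Lemma integral_GL_f : (\int[mxL R p p]_(x in GL R p) (t x * `|\det x| `^ ex)%:E = (2 ^+ p)%:E * c%:E)%E.
Proof.
rewrite integral_GLhalf_f// (integral_GL_mass t_pos_invariant) (integral_GL_mass t_neg_invariant).
by rewrite G_mass_neg0// mule0 sube0 cE.
Qed.

Lemma law_l A : measurable A -> Pr (l @^-1` A) = ((2 ^+ p * c)%:E * root_mass A)%E.
Proof.
move=> mA; have := law_rectangle mA measurableT; rewrite preimage_setT setIT => ->.
by rewrite -cE EFinM -muleA; congr (_ * _)%E; rewrite muleC.
Qed.

Lemma law_G B : measurable B -> Pr (G @^-1` B) = (c^-1%:E * G_mass t_pos B)%E.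
Proof.
move=> mB; have := law_rectangle measurableT mB; rewrite preimage_setT setTI => ->.
rewrite muleA; congr (_ * _)%E.
(* Total mass 1 identifies 2^p times the root mass as the inverse of [c]. *)
have := total_mass; rewrite -cE muleA => E.
have : ((2 ^+ p)%:E * root_mass setT * c%:E * c^-1%:E = c^-1%:E)%E by rewrite E mul1e.
by rewrite -muleA -EFinM mulfV ?gt_eqF// mule1.
Qed.

Lemma independent_l_G : independent_rv Pr l G.
Proof.
move=> A B mA mB; rewrite law_rectangle// law_l// law_G//.
rewrite EFinM -!muleA; congr (_ * _)%E; rewrite muleCA; congr (_ * _)%E.
by rewrite muleA -EFinM mulfV ?gt_eqF// mul1e.
Qed.

Let Z (o : Omega) := z_of P (W o).

Lemma l_of_W_ordered o : ordered_roots R p (l o).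
Proof. by have [] := choose_decompositionP (WX o). Qed.

Lemma z_of_WE : Z = (fun o => z_root P (l o)).
Proof. by apply/funext => o; rewrite (z_rootE _ (l_of_W_ordered o)). Qed.

Lemma measurable_z_of_W : measurable_fun setT Z.
Proof.
by rewrite z_of_WE; apply: (measurableT_comp (measurable_z_root mP)); exact: measurable_l_of_W.
Qed.

Lemma z_of_W_Zset o : Zset P (Z o).
Proof. by exists (diag_mx (l o)) => //; exists (l o) => //; exact: l_of_W_ordered. Qed.

Lemma independent_G_Z : independent_rv Pr G Z.
Proof.
move=> A B mA mB; have -> : Z @^-1` B = l @^-1` (z_root P @^-1` B) by rewrite z_of_WE.
rewrite setIC independent_l_G//; first exact: muleC.
by rewrite -[X in measurable X]setTI; exact: (measurable_z_root mP).
Qed.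

(** * The joint law of G and Z *)

Section joint_law.
Variable nu : probability ('M[R]_p * 'M[R]_p)%type R.
Hypothesis nuZ : forall B, measurable B -> nu B = Pr (Z @^-1` B).

Let dens (u : 'M[R]_p -> R) (x : 'M[R]_p) : R :=
  c^-1 * (\1_(GLhalf R p) x * (u x * `|\det x| `^ ex)).

Let dens_ge0 u x : sign_invariant u -> 0 <= dens u x.
Proof. by move=> [_ u0 _]; rewrite !mulr_ge0 ?powR_ge0// invr_ge0 ltW. Qed.

Let measurable_dens u : sign_invariant u -> measurable_fun setT (dens u).
Proof.
move=> [mu _ _]; apply: measurable_funM; first exact: measurable_cst.
apply: measurable_funM; first by apply: measurable_indic; exact: measurable_GLhalf.
by apply: measurable_funM => //; apply: measurable_powR_comp; mx_measurable.
Qed.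

Let integral_dens u B : sign_invariant u -> measurable B ->
  (\int[mxL R p p]_x ((\1_B x)%:E * (dens u x)%:E) = c^-1%:E * G_mass u B)%E.
Proof.
move=> ui mB; have [_ u0 _] := ui.
rewrite /G_mass -ge0_integralZl; first last.
- by rewrite lee_fin invr_ge0 ltW.
- by move=> x _; rewrite !mule_ge0// lee_fin ?mulr_ge0 ?powR_ge0.
- exact: measurable_G_integrand.
- exact: measurableT.
by apply: eq_integral => x _; rewrite -!EFinM /dens; congr (_%:E); ring.
Qed.

Lemma integral_section A u : measurable A -> sign_invariant u ->
  (\int[mxL R p p \x nu]_(x in A `&` (GLhalf R p `*` Zset P))
     (c^-1 * (u x.1 * `|\det x.1| `^ ex))%:E =
   \int[mxL R p p]_x (nu (xsection A x) * (dens u x)%:E))%E.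
Proof.
move=> mA ui; have [mu u0 _] := ui.
have c00 : 0 <= c^-1 by rewrite invr_ge0 ltW.
have mZ := measurable_Zset PN mP.
have mh : measurable (GLhalf R p) by exact: measurable_GLhalf.
rewrite integral_indic_in integral_prod; first last.
- by move=> x; rewrite mule_ge0// lee_fin ?mulr_ge0 ?powR_ge0.
- apply: emeasurable_funM.
    apply: measurable_EFin_comp; apply: measurable_indic; apply: measurableI => //.
    exact: measurableX.
  apply: measurable_EFin_comp; apply: measurable_funM; first exact: measurable_cst.
  apply: measurable_funM; first by apply: (measurableT_comp mu); mx_measurable.
  by apply: measurable_powR_comp; mx_measurable.
apply: eq_integral => x _.
have mS : measurable (xsection A x `&` Zset P).
  by apply: measurableI => //; exact: measurable_xsection.
(* [nu] is the law of Z, which takes its values in [Zset P]. *)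
have -> : nu (xsection A x) = nu (xsection A x `&` Zset P).
  rewrite !nuZ//; last exact: measurable_xsection.
  by congr (Pr _); apply/seteqP; split=> o /=; [split=> //; exact: z_of_W_Zset|case].
rewrite -[in RHS](setIT (_ `&` _)) -[in RHS](integral_indic nu measurableT mS) muleC.
rewrite -ge0_integralZl; first last.
- by rewrite lee_fin dens_ge0.
- by move=> z _; rewrite lee_fin.
- by apply: measurable_EFin_comp; exact: measurable_indic.
- exact: measurableT.
apply: eq_integral => z _; rewrite -!EFinM /dens !indicE; congr (_%:E).
have -> : ((x, z) \in A `&` (GLhalf R p `*` Zset P)) =
    (x \in GLhalf R p) && (z \in xsection A x `&` Zset P).
  apply/idP/andP => [/set_mem[Axz [/= hx hz]]|[/set_mem hx /set_mem[]]].
    by split; apply/mem_set => //; split=> //; exact/mem_set.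
  by rewrite /xsection /= => /set_mem Axz hz; exact/mem_set.
by case: (x \in GLhalf R p); case: (z \in _); rewrite /= ?mul1r ?mul0r ?mulr1 ?mulr0.
Qed.

Lemma joint_law A : measurable A ->
  (forall A, measurable A -> Pr [set o | A (G o, Z o)] = (pushforward Pr G \x nu)%E A) ->
  Pr [set o | A (G o, Z o)] =
  (\int[mxL R p p \x nu]_(x in A `&` (GLhalf R p `*` Zset P))
     (c^-1 * (t x.1 * `|\det x.1| `^ ex))%:E)%E.
Proof.
move=> mA ->//.
have tp := t_pos_invariant; have tn := t_neg_invariant.
have mnu : measurable_fun setT (fun x => nu (xsection A x)) by exact: measurable_fun_xsection.
have c00 : 0 <= c^-1 by rewrite invr_ge0 ltW.
have -> : (\int[mxL R p p \x nu]_(x in A `&` (GLhalf R p `*` Zset P))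
     (c^-1 * (t x.1 * `|\det x.1| `^ ex))%:E =
   \int[mxL R p p]_x (nu (xsection A x) * (dens t_pos x)%:E) -
   \int[mxL R p p]_x (nu (xsection A x) * (dens t_neg x)%:E))%E.
  rewrite -!integral_section// integral_max_diff.
  congr (_ - _)%E; apply: eq_integral => x /set_mem[_ [/= [xG _] _]]; congr (_%:E).
    by rewrite /t_pos /t_GL mem_set// maxr_pMl ?powR_ge0// mul0r maxr_pMr// mulr0.
  by rewrite /t_neg /t_GL mem_set// maxr_pMl ?powR_ge0// mul0r maxr_pMr// mulr0 mulNr mulrN.
(* Sections have [nu] measure at most 1, so the negative term is bounded by the negative mass of G,
   which is 0. *)
rewrite [X in (_ - X)%E](_ : _ = 0%E) ?sube0; last first.
  apply/eqP; rewrite eq_le; apply/andP; split; last first.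
    by apply: integral_ge0 => x _; rewrite mule_ge0// lee_fin dens_ge0.
  apply: (@le_trans _ _ (\int[mxL R p p]_x ((\1_[set: 'M[R]_p] x)%:E * (dens t_neg x)%:E))%E).
    apply: ge0_le_integral; first exact: measurableT.
    - by move=> x _; rewrite mule_ge0// lee_fin dens_ge0.
    - by apply: emeasurable_funM => //; apply: measurable_EFin_comp; exact: measurable_dens.
    - apply: emeasurable_funM; apply: measurable_EFin_comp; last exact: measurable_dens.
      exact: measurable_indic.
    move=> x _; apply: lee_wpmul2r; first by rewrite lee_fin dens_ge0.
    rewrite indicE in_setT; apply: probability_le1; exact: measurable_xsection.
  by rewrite integral_dens// G_mass_neg0// mule0.
(* With [phi := id] this is the measure of density [dens t_pos]; it coincides with the law of G, so
   the integral of the sections against that law becomes a Lebesgue integral. *)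
have [m mE] := density_measure (mxL R p p) (phi := id)
  (measurable_dens tp) (fun x => dens_ge0 x tp) (@measurable_id _ _ _).
rewrite -(mE (fun x => nu (xsection A x)))//.
rewrite /product_measure1; apply: eq_measure_integral.
  exact: measurable_g_of_W.
move=> mG B mB _; apply: etrans (law_G mB) _.
rewrite -integral_dens// -(mE (fun x => (\1_B x)%:E)).
- by rewrite integral_indic// setIT.
- by apply: measurable_EFin_comp; exact: measurable_indic.
- by move=> y; rewrite lee_fin.
Qed.
End joint_law.

End law.
End density.

Lemma measurable_fun_bundle d1 d2 (T1 : measurableType d1) (T2 : measurableType d2)
    (f : T1 -> T2) : measurable_fun setT f ->
  exists g : {mfun T1 >-> T2}, f = g :> (T1 -> T2).
Proof.
move=> mf; pose H := isMeasurableFun.Build _ _ _ _ f mf.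
pose g : {mfun T1 >-> T2} := HB.pack f H.
by exists g.
Qed.

(** Independence is the product formula on rectangles, and the product measure is determined by its
    values there. *)
Lemma independent_product_law d d1 d2 (T : measurableType d) (T1 : measurableType d1)
    (T2 : measurableType d2) (R : realType) (Pr : probability T R)
    (X : {mfun T >-> T1}) (Y : {mfun T >-> T2}) : independent_rv Pr X Y ->
  forall A, measurable A ->
    Pr [set o | A (X o, Y o)] = (distribution Pr X \x distribution Pr Y)%E A.
Proof.
move=> indep A mA.
have mXY : measurable_fun setT (fun o => (X o, Y o)) by exact/measurable_fun_pair.
have [XY XYE] := measurable_fun_bundle mXY.
have lawE D : distribution Pr XY D = Pr ((fun o => (X o, Y o)) @^-1` D) by rewrite XYE.
apply: etrans (esym (lawE A)) _; apply: esym.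
apply: (product_measure_unique (m' := distribution Pr XY)) => // B C mB mC.
by apply: etrans (lawE _) _; exact: indep.
Qed.

Theorem theorem5p2 (R : realType) (p : nat) (hp : (0 < p)%N) (a b : R)
    (ha : (p%:R - 1) / 2 < a) (hb : (p%:R - 1) / 2 < b)
    (P : 'M[R]_p -> 'M[R]_p)
    (PN' : forall L, ordered_diag R p L -> monomial_mx R p (P L))
    (mP : measurable_fun (ordered_diag R p) P)
    (t : 'M[R]_p -> R)
    (mt : measurable_fun (GL R p) t)
    (t_signs : forall (B : 'M[R]_p) (s : 'I_p -> bool),
        GL R p B -> t (B *m col_signs R s) = t B)
    (d : measure_display) (Omega : measurableType d) (Pr : probability Omega R)
    (W : {RV Pr >-> ('M[R]_p * 'M[R]_p)%type})
    (WX : forall o, sampleX R p (W o))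
    (W_distr : forall A : set ('M[R]_p * 'M[R]_p), measurable A ->
       distribution Pr W A =
       (\int[lebesgue_sym R p \x lebesgue_sym R p]_(w in A `&` sampleX R p)
          (t (g_of P w) * (\det w.1) `^ (a - (p%:R + 1) / 2)
                        * (\det w.2) `^ (b - (p%:R + 1) / 2))%:E)%E) :
  let G := fun o => g_of P (W o) in
  let Z := fun o => z_of P (W o) in
  let l := fun o => l_of (W o) in
  let f := fun x : 'M[R]_p => t x * `|\det x| `^ (2 * (a + b) - p%:R) in
  let c0 := (\int[lebesgue_mx R p p]_(x in GLhalf R p) (f x)%:E)%E in
  [/\ [/\ measurable_fun setT G, measurable_fun setT Z & measurable_fun setT l],
      [/\ (0 < c0)%E, (c0 < +oo)%E &
          c0 = ((2 ^- p)%:E *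
                \int[lebesgue_mx R p p]_(x in GL R p) (f x)%:E)%E],
      independent_rv Pr G Z /\
      (exists nu : probability ('M[R]_p * 'M[R]_p)%type R,
         [/\ measurable (Zset P), nu (Zset P) = 1%E &
          forall A : set ('M[R]_p * ('M[R]_p * 'M[R]_p)), measurable A ->
            Pr [set o | A (G o, Z o)] =
            (\int[lebesgue_mx R p p \x nu]_(x in A `&` (GLhalf R p `*` Zset P))
               ((fine c0)^-1 * f x.1)%:E)%E]),
      independent_rv Pr l G &
      forall A : set 'rV[R]_p, measurable A ->
        Pr (l @^-1` A) =
        (\int[lebesgue_mx R 1 p]_(x in A `&` ordered_roots R p)
           (2 ^+ p * fine c0 * `|\det (P (diag_mx x))| `^ (2 * (a + b))
            * (\prod_(i < p) (x ord0 i) `^ (a - (p%:R + 1) / 2))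
            * (\prod_(i < p) (1 - x ord0 i) `^ (b - (p%:R + 1) / 2))
            * (\prod_(i < p) \prod_(j < p | (i < j)%N) (x ord0 i - x ord0 j)))%:E)%E].
Proof.
move: W_distr; rewrite symLE => W_distr G Z l f.
rewrite !mxLE => c0.
have c0v : c0 = (fine (G_mass a b (t_pos t) setT))%:E.
  exact: (c0E PN' mP mt t_signs WX W_distr).
have bounds := G_mass_bounds PN' mP mt t_signs WX W_distr.
have cfin : (fine (G_mass a b (t_pos t) setT))%:E = G_mass a b (t_pos t) setT.
  by case/andP: bounds => v0 voo; rewrite fineK// ge0_fin_numE// ltW.
have mG : measurable_fun setT G by exact: measurable_g_of_W.
have mZ : measurable_fun setT Z by exact: measurable_z_of_W.
have ml : measurable_fun setT l by exact: measurable_l_of_W.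
have iGZ := independent_G_Z PN' mP mt t_signs WX W_distr.
have mZs := measurable_Zset PN' mP.
split.
- by [].
- rewrite c0v; split; first by rewrite cfin; case/andP: bounds.
    exact: ltry.
  rewrite /f (integral_GL_f PN' mP mt t_signs WX W_distr) -!EFinM mulrA.
  have p2 : 2 ^+ p != 0 :> R by rewrite expf_neq0// pnatr_eq0.
  by rewrite mulVf// mul1r.
- split; first exact: iGZ.
  (* The probability on [Zset P] is the law of Z, formed from a bundled copy [Zm] of the
     function. *)
  have [Gm GmE] := measurable_fun_bundle mG; have [Zm ZmE] := measurable_fun_bundle mZ.
  exists (distribution Pr Zm); split; first exact: mZs.
    transitivity (Pr (Z @^-1` Zset P)); first by rewrite ZmE.
    have -> : Z @^-1` Zset P = setT.
      by apply/seteqP; split=> // o _; exact: z_of_W_Zset.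
    exact: probability_setT.
  move=> A mA.
  have nuZ B : measurable B -> distribution Pr Zm B = Pr (Z @^-1` B).
    by move=> _; rewrite ZmE.
  rewrite c0v; apply: (joint_law PN' mP mt t_signs WX W_distr nuZ mA) => A' mA'.
  have iGZ' : independent_rv Pr Gm Zm by move: iGZ; rewrite -/G -/Z GmE ZmE.
  have key : Pr [set o | A' (G o, Z o)] = (pushforward Pr G \x distribution Pr Zm)%E A'.
    have -> : [set o | A' (G o, Z o)] = [set o | A' (Gm o, Zm o)].
      by apply/seteqP; split=> o /=; rewrite -GmE -ZmE.
    have -> : pushforward Pr G = distribution Pr Gm by rewrite GmE.
    exact: independent_product_law.
  exact: key.
- exact: (independent_l_G PN' mP mt t_signs WX W_distr).
move=> A mA; apply: etrans (law_l PN' mP mt t_signs WX W_distr mA) _.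
rewrite integral_indic_in /root_mass -ge0_integralZl; first last.
- by rewrite lee_fin mulr_ge0 ?exprn_ge0// -lee_fin cfin; case/andP: bounds => /ltW.
- by move=> x _; rewrite lee_fin mulr_ge0// root_weight_ge0.
- apply: measurable_EFin_comp; apply: measurable_funM; last exact: measurable_indic.
  exact: measurable_root_weight.
- exact: measurableT.
apply: eq_integral => x _; rewrite -!EFinM /root_weight !indicE (in_setI _ A) c0v /=; congr (_%:E).
case: (boolP (x \in ordered_roots R p)) => [/set_mem ox|_]; last by rewrite andbF !mul0r mulr0.
rewrite andbT P_ofE// /beta_weight /vdm; case: (x \in A); last by rewrite !mul0r !mulr0.
by rewrite !mul1r !mulr1 !mulrA.
Qed.
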